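(* Let $\Gamma$ be a countable nonamenable i.c.c. group, let $(X_0,\mu_0)$ be a diffuse standard probability space, and let $\Gamma\curvearrowright (X,\mu):=(X_0^\Gamma,\mu_0^\Gamma)$ be the Bernoulli action. If $\Gamma$ is exact and not properly proximal, then $\Gamma\curvearrowright X$ is OE-superrigid, i.e., if a free ergodic probability measure preserving action $\Lambda\curvearrowright(Y,\nu)$ of a countable group $\Lambda$ is orbit equivalent to $\Gamma\curvearrowright(X,\mu)$, then these two actions are conjugate.
   Context: Proper proximality: for a countable group $\Gamma$, let $(R_tf)(s)=f(st)$ on $\ell^\infty(\Gamma)$ and $\mathbb S(\Gamma)=\{f\in\ell^\infty(\Gamma): f-R_tf\in c_0(\Gamma)\ \text{for all } t\in\Gamma\}$. The group $\Gamma$ is properly proximal if there is no left-$\Gamma$-invariant state on $\mathbb S(\Gamma)$. Two probability measure preserving actions $\Gamma\curvearrowright (X,\mu)$ and $\Lambda\curvearrowright (Y,\nu)$ are orbit equivalent if there is an isomorphism of probability spaces $\theta:X\to Y$ with $\theta(\Gamma x)=\Lambda\theta(x)$ for a.e. $x\in X$. They are conjugate if there are a group isomorphism $\delta:\Gamma\to\Lambda$ and an isomorphism of probability spaces $\theta:X\to Y$ with $\theta(tx)=\delta(t)\theta(x)$ for all $t\in\Gamma$ and a.e. $x\in X$. The Bernoulli action is the action of $\Gamma$ on $X_0^\Gamma$ by left shift of coordinates. I.c.c. means that every nontrivial conjugacy class is infinite. A group is exact if its reduced C$^*$-algebra is exact. *)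

(* Defs.v *)
From HB Require Import structures.
From mathcomp Require Import all_boot all_order all_algebra.
From mathcomp Require Import finmap.
From mathcomp Require Import all_classical all_reals all_analysis.
From mathcomp Require Import complex.

Set Implicit Arguments.
Unset Strict Implicit.
Unset Printing Implicit Defensive.

Import Order.TTheory GRing.Theory Num.Theory.
Import numFieldNormedType.Exports.

Local Open Scope classical_set_scope.
Local Open Scope ring_scope.
Local Open Scope complex_scope.

(** Throughout, scalars are [R[i]] with its usual partial order: for a complex
    number [c], [0 <= c] says that [c] is real and nonnegative. *)

(** * Amenability, proper proximality, i.c.c. groups *)

Section Groups.
Variables (R : realType) (G : groupType).

Definition ell_infty : set (G -> R[i]) :=
  [set f | exists M : R[i], forall s, `|f s| <= M].

Definition c_zero : set (G -> R[i]) :=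
  [set f | forall e : R[i], 0 < e -> finite_set [set s | e <= `|f s|]].

Definition translate_left (t : G) (f : G -> R[i]) : G -> R[i] :=
  fun s => f (t^-1 * s)%g.

Definition translate_right (t : G) (f : G -> R[i]) : G -> R[i] :=
  fun s => f (s * t)%g.

Definition proximal_functions : set (G -> R[i]) :=
  [set f | ell_infty f /\
    forall t, c_zero (fun s => f s - translate_right t f s)].

(** [phi] is a total function, but only its values on the subspace [V] matter:
    [V] is meant to be a left-invariant operator system in [ell_infty]. *)
Record left_invariant_state (V : set (G -> R[i])) (phi : (G -> R[i]) -> R[i]) :
    Prop := LeftInvariantState {
  state_linear : forall (c : R[i]) f g, V f -> V g ->
    phi (fun s => c * f s + g s) = c * phi f + phi g ;
  state_ge0 : forall f, V f -> (forall s, 0 <= f s) -> 0 <= phi f ;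
  state_unit : phi (fun=> 1) = 1 ;
  state_invariant : forall t f, V f -> phi (translate_left t f) = phi f }.

Definition amenable : Prop := exists phi, left_invariant_state ell_infty phi.

Definition properly_proximal : Prop :=
  ~ exists phi, left_invariant_state proximal_functions phi.

Definition icc : Prop :=
  forall t : G, t <> 1%g -> infinite_set [set (t ^ s)%g | s in [set: G]].

End Groups.

(** * Exactness

    Every Hilbert space is isomorphic to some l^2(I), so by Gelfand-Naimark every
    C*-algebra is isomorphic to a norm-closed *-subalgebra of B(l^2(I)).  A
    bounded operator [a] is represented by its matrix, whose entry at [(i, j)] is
    the inner product <a d_j, d_i>. *)

Section Operators.
Variable R : realType.

Definition opmx (I : Type) := I -> I -> R[i].

(** The operator norm is at most [c]: the norms of the compressions of [a] to
    the coordinate subspaces indexed by finite sets are at most [c]. *)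
Definition opnorm_le (I : choiceType) (a : opmx I) (c : R[i]) : Prop :=
  0 <= c /\ forall (F : {fset I}) (xi eta : I -> R[i]),
    `|\sum_(i <- F) \sum_(j <- F) (eta i)^* * a i j * xi j| ^+ 2 <=
    c ^+ 2 * (\sum_(j <- F) `|xi j| ^+ 2) * (\sum_(i <- F) `|eta i| ^+ 2).

Definition opbounded (I : choiceType) (a : opmx I) : Prop :=
  exists c, opnorm_le a c.

Definition op0 (I : Type) : opmx I := fun _ _ => 0.
Definition opadd (I : Type) (a b : opmx I) : opmx I := fun i j => a i j + b i j.
Definition opsub (I : Type) (a b : opmx I) : opmx I := fun i j => a i j - b i j.
Definition opscale (I : Type) (c : R[i]) (a : opmx I) : opmx I :=
  fun i j => c * a i j.
Definition opadj (I : Type) (a : opmx I) : opmx I := fun i j => (a j i)^*.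

Definition unordered_sum (I : choiceType) (x : I -> R[i]) (l : R[i]) : Prop :=
  forall e : R[i], 0 < e -> exists F0 : {fset I},
    forall F : {fset I}, (F0 `<=` F)%fset -> `|\sum_(k <- F) x k - l| < e.

(** [c] is the composition of [a] and [b].  For bounded [a] and [b] the sums
    converge absolutely, so that [c] exists and is unique. *)
Definition is_opmul (I : choiceType) (a b c : opmx I) : Prop :=
  forall i j, unordered_sum (fun k => a i k * b k j) (c i j).

Record cstar_algebra (I : choiceType) (B : set (opmx I)) : Prop := CstarAlgebra {
  cstar_bounded : forall a, B a -> opbounded a ;
  cstar0 : B (@op0 I) ;
  cstarD : forall a b, B a -> B b -> B (opadd a b) ;
  cstarZ : forall c a, B a -> B (opscale c a) ;
  cstarM : forall a b c, B a -> B b -> is_opmul a b c -> B c ;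
  cstar_adj : forall a, B a -> B (opadj a) ;
  cstar_closed : forall a,
    (forall e : R[i], 0 < e -> exists2 b, B b & opnorm_le (opsub a b) e) -> B a }.

Record star_morphism (I J : choiceType) (B : set (opmx I)) (D : set (opmx J))
    (q : opmx I -> opmx J) : Prop := StarMorphism {
  star_morph_fun : forall a, B a -> D (q a) ;
  star_morphD : forall a b, B a -> B b -> q (opadd a b) = opadd (q a) (q b) ;
  star_morphZ : forall c a, B a -> q (opscale c a) = opscale c (q a) ;
  star_morphM : forall a b c, B a -> B b -> is_opmul a b c ->
    is_opmul (q a) (q b) (q c) ;
  star_morph_adj : forall a, B a -> q (opadj a) = opadj (q a) }.

(** The operator [\sum_k a_k (x) b_k] on l^2(I) (x) l^2(J) = l^2(I * J). *)
Definition tensor_sum (I J : Type) (n : nat)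
    (a : 'I_n -> opmx I) (b : 'I_n -> opmx J) : opmx (I * J) :=
  fun x y => \sum_(k < n) a k x.1 y.1 * b k x.2 y.2.

(** Minimal (spatial) tensor product: the norm closure of the algebraic one. *)
Definition min_tensor (I J : choiceType) (A : set (opmx I)) (B : set (opmx J)) :
    set (opmx (I * J)%type) :=
  [set T | forall e : R[i], 0 < e ->
    exists (n : nat) (a : 'I_n -> opmx I) (b : 'I_n -> opmx J),
      (forall k, A (a k) /\ B (b k)) /\
      opnorm_le (opsub T (tensor_sum a b)) e].

(** [S] is the image of [T], an element of the minimal tensor product of [A] and
    [B], by [id (x) q].  As [id (x) q] is contractive on the algebraic tensor
    product, the graph of its continuous extension is the closure of its
    graph. *)
Definition id_tensor (I J K : choiceType) (A : set (opmx I)) (B : set (opmx J))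
    (q : opmx J -> opmx K) (T : opmx (I * J)%type) (S : opmx (I * K)%type) :
    Prop :=
  forall e : R[i], 0 < e ->
    exists (n : nat) (a : 'I_n -> opmx I) (b : 'I_n -> opmx J),
      [/\ forall k, A (a k) /\ B (b k),
          opnorm_le (opsub T (tensor_sum a b)) e &
          opnorm_le (opsub S (tensor_sum a (fun k => q (b k)))) e].

(** Up to isomorphism, a short exact sequence of C*-algebras is
    0 -> ker q -> B -> D -> 0 with [q] a surjective *-morphism.  Exactness of the
    sequence tensored with [A] is automatic except in the middle, where it says
    that ker (id (x) q) = A (x) ker q. *)
Definition exact_cstar (I : choiceType) (A : set (opmx I)) : Prop :=
  forall (J K : choiceType) (B : set (opmx J)) (D : set (opmx K))
      (q : opmx J -> opmx K),
    cstar_algebra B -> cstar_algebra D -> star_morphism B D q -> set_surj B D q ->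
  forall T : opmx (I * J)%type,
    id_tensor A B q T (@op0 _) <->
    min_tensor A (B `&` [set b | q b = @op0 K]) T.

Definition left_regular (G : groupType) (t : G) : opmx G :=
  fun s s' => (s == t * s')%g%:R.

Definition reduced_cstar (G : groupType) : set (opmx G) :=
  [set T | forall e : R[i], 0 < e ->
    exists (n : nat) (c : 'I_n -> R[i]) (t : 'I_n -> G),
      opnorm_le (opsub T (fun s s' => \sum_(k < n) c k * left_regular (t k) s s')) e].

Definition exact_group (G : groupType) : Prop := exact_cstar (@reduced_cstar G).

End Operators.

(** * Probability spaces and actions *)

Definition standard_borel (R : realType) (d : measure_display)
    (T : measurableType d) : Prop :=
  exists (P : completePseudoMetricType R) (f : T -> P),
    [/\ hausdorff_space P, @second_countable P, bijective f &
        forall A : set T, measurable A <-> <<s @open P >> (f @` A)].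

Definition diffuse (R : realType) (d : measure_display) (T : measurableType d)
    (mu : probability T R) : Prop := forall x, mu [set x] = 0%E.

Section Actions.
Variables (R : realType) (d : measure_display) (X : measurableType d).
Variables (mu : probability X R) (G : groupType) (a : G -> X -> X).

Record pmp_action : Prop := PmpAction {
  pmp_act1 : forall x, a 1%g x = x ;
  pmp_actM : forall s t x, a (s * t)%g x = a s (a t x) ;
  pmp_measurable : forall t, measurable_fun setT (a t) ;
  pmp_preserving : forall t A, measurable A -> mu (a t @^-1` A) = mu A }.

Definition free_action : Prop :=
  {ae mu, forall x, forall t, a t x = x -> t = 1%g}.

Definition ergodic_action : Prop := forall A, measurable A ->
  (forall t, a t @^-1` A = A) -> mu A = 0%E \/ mu A = 1%E.

Definition act_orbit (x : X) : set X := [set a t x | t in [set: G]].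

End Actions.

Section Equivalences.
Variables (R : realType) (d1 d2 : measure_display).
Variables (X : measurableType d1) (Y : measurableType d2).
Variables (mu : probability X R) (nu : probability Y R).

Definition probability_iso (theta : X -> Y) : Prop :=
  [/\ measurable_fun setT theta,
      forall B, measurable B -> mu (theta @^-1` B) = nu B &
      exists theta' : Y -> X,
        [/\ measurable_fun setT theta',
            {ae mu, forall x, theta' (theta x) = x} &
            {ae nu, forall y, theta (theta' y) = y}]].

Definition orbit_equivalent (G H : groupType) (a : G -> X -> X)
    (b : H -> Y -> Y) : Prop :=
  exists2 theta : X -> Y, probability_iso theta &
    {ae mu, forall x, theta @` act_orbit a x = act_orbit b (theta x)}.

Definition conjugate_actions (G H : groupType) (a : G -> X -> X)
    (b : H -> Y -> Y) : Prop :=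
  exists (delta : {multiplicative G -> H}) (theta : X -> Y),
    [/\ bijective delta, probability_iso theta &
        forall t, {ae mu, forall x, theta (a t x) = b (delta t) (theta x)}].

End Equivalences.

(** * Bernoulli actions *)

Section Bernoulli.
Variables (R : realType) (d : measure_display) (X0 : measurableType d).

Definition coordinate_sets (I : Type) : set (set (I -> X0)) :=
  [set E | exists (i : I) (A : set X0),
    measurable A /\ E = [set x : I -> X0 | A (x i)]].

(** [I -> X0] with the product sigma-algebra *)
Definition power_space (I : Type) := g_sigma_algebraType (@coordinate_sets I).

HB.instance Definition _ (I : Type) := Measurable.on (power_space I).

(** [mu] is the product measure, i.e. the (unique) probability measure with the
    prescribed values on cylinders. *)
Definition is_power_measure (I : choiceType) (mu0 : probability X0 R)
    (mu : probability (power_space I) R) : Prop :=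
  forall (F : {fset I}) (A : I -> set X0), (forall i, measurable (A i)) ->
    mu [set x : I -> X0 | forall i, i \in F -> A i (x i)] =
    (\prod_(i <- F) mu0 (A i))%E.

Definition bernoulli_shift (G : groupType) (t : G) (x : power_space G) :
    power_space G :=
  fun s => x (t^-1 * s)%g.

End Bernoulli.

(* Main.v *)
(** An orbit equivalence amounts to a cocycle [w] of [G] with values in a countable
    group, and the point is to show that [w] is cohomologous to a homomorphism.

    The influence of a set [A] of coordinates on [w t] is the probability that [w t]
    changes when these coordinates are resampled.  The spectral sample of [w t] is a
    random finite subset of [G] whose probability of meeting [A] is comparable to the
    influence of [A]; multiplying [w t] by a function of finitely many coordinates
    barely affects it away from these coordinates.  Since [w (s t)] is the translate of
    [w t] by [s] multiplied on the left by [w s], averaging a function on [G] over the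
    spectral sample of [w t], with slowly varying weights that are negligible near the
    coordinates of [w s], is almost equivariant; since [w (t s)] is [w t] multiplied on
    the right by a translate of [w s] by [t], this average varies slowly with [t], so
    that an invariant mean on S(G) can be applied to it.  If the mean of the influence
    did not vanish at infinity, this would produce almost invariant means on [G].

    Let [x'] be obtained from [x] by resampling the coordinates that carry a mark in a
    small set.  On average over [s], the elements [w s x] and [w s x'] are then likely
    to agree, hence the mean of the law of [w s x (w s x')^-1] has a large atom, and
    this atom intertwines [w t x] and [w t x'].  Finitely many such steps lead from [x]
    to an independent copy [y], and by mixing an intertwiner between [w t x] and [w t y]
    is a product of functions of [x] and of [y]: this untwists [w]. *)
Require Import Defs.
From HB Require Import structures.
From mathcomp Require Import all_boot all_order all_algebra.
From mathcomp Require Import finmap.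
From mathcomp Require Import all_classical all_reals all_analysis.
From mathcomp Require Import complex.
From mathcomp Require Import measurable_realfun.
From mathcomp Require Import ring lra zify.

Set Implicit Arguments.
Unset Strict Implicit.
Unset Printing Implicit Defensive.

Import Order.TTheory GRing.Theory Num.Theory.
Import numFieldNormedType.Exports.

Local Open Scope classical_set_scope.
Local Open Scope ring_scope.

(** * Expectations and measure preserving maps *)

Section Expectation.
Context {R : realType}.

Section OneSpace.
Context d (T : measurableType d) (P : probability T R).

(** The mean given by the failure of proper proximality only applies to functions that vary slowly
    under right translation, so every averaged quantity must be shown to do so. Spectral averages
    do, because the weights vanish at infinity. Laws of quotients do only when finitely many
    coordinates are resampled; hence means are taken along an exhaustion, and the small influence of
    sets near infinity makes their ultralimit close to the mean for each large finite set.

    Marks form an independent Bernoulli configuration: no proper nonempty set of coordinates is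
    invariant under the group, whereas the random set of coordinates with a mark in a given set
    moves with the shift, and the enlarged system stays mixing. As the base is diffuse, it splits
    into finitely many small pieces; resampling over one piece after another leads to the
    independent copy, and intertwiners multiply along the way.

    Zero-one laws come from mixing along an infinite set of group elements: the group itself at
    first, later a nontrivial kernel of the homomorphism obtained, which is infinite by the i.c.c.
    condition. *)

Definition pr (A : set T) : R := fine (P A).

Definition bounded_measurable (f : T -> R) : Prop :=
  measurable_fun setT f /\ exists M : R, forall x, `|f x| <= M.

Definition expect (f : T -> R) : R := \int[P]_x f x.

Lemma prE A : measurable A -> (pr A)%:E = P A.
Proof. by move=> mA; rewrite fineK// fin_num_measure. Qed.

Lemma bm_cst c : bounded_measurable (fun=> c).
Proof. by split=> //; exists `|c|. Qed.

Lemma bm_add f g : bounded_measurable f -> bounded_measurable g ->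
  bounded_measurable (fun x => f x + g x).
Proof.
move=> [mf [M fM]] [mg [N gN]]; split; first exact: measurable_funD.
exists (M + N) => x; apply: (le_trans (ler_normD _ _)); exact: lerD.
Qed.

Lemma bm_opp f : bounded_measurable f -> bounded_measurable (fun x => - f x).
Proof.
move=> [mf [M fM]]; split; first exact: measurableT_comp.
by exists M => x; rewrite normrN.
Qed.

Lemma bm_sub f g : bounded_measurable f -> bounded_measurable g ->
  bounded_measurable (fun x => f x - g x).
Proof. by move=> bf bg; apply: bm_add => //; exact: bm_opp. Qed.

Lemma bm_mul f g : bounded_measurable f -> bounded_measurable g ->
  bounded_measurable (fun x => f x * g x).
Proof.
move=> [mf [M fM]] [mg [N gN]]; split; first exact: measurable_funM.
by exists (M * N) => x; rewrite normrM ler_pM.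
Qed.

Lemma bm_indic A : measurable A -> bounded_measurable (\1_A : T -> R).
Proof.
move=> mA; split; first exact: measurable_indic.
by exists 1 => x; rewrite indicE; case: (_ \in _); rewrite ?normr1 ?normr0.
Qed.

Lemma bm_integrable f : bounded_measurable f -> P.-integrable setT (EFin \o f).
Proof.
move=> [mf [M fM]]; apply: measurable_bounded_integrable => //.
  by rewrite -ge0_fin_numE// fin_num_measure.
exists M; split; first by rewrite num_real.
by move=> N MN x _ /=; apply: (le_trans (fM x)); exact: ltW.
Qed.

Lemma expectD f g : bounded_measurable f -> bounded_measurable g ->
  expect (fun x => f x + g x) = expect f + expect g.
Proof. by move=> bf bg; rewrite /expect RintegralD//; exact: bm_integrable. Qed.

Lemma expectB f g : bounded_measurable f -> bounded_measurable g ->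
  expect (fun x => f x - g x) = expect f - expect g.
Proof. by move=> bf bg; rewrite /expect RintegralB//; exact: bm_integrable. Qed.

Lemma expectZ c f : bounded_measurable f ->
  expect (fun x => c * f x) = c * expect f.
Proof. by move=> bf; rewrite /expect RintegralZl//; exact: bm_integrable. Qed.

Lemma expect_cst c : expect (fun=> c) = c.
Proof.
have PT : fine (P setT) = 1 by rewrite probability_setT.
by rewrite /expect Rintegral_cst// [X in _ * X]PT mulr1.
Qed.

Lemma expect_le f g : bounded_measurable f -> bounded_measurable g ->
  (forall x, f x <= g x) -> expect f <= expect g.
Proof.
move=> bf bg fg; rewrite /expect; apply: le_Rintegral => //; exact: bm_integrable.
Qed.

Lemma expect_ge0 f : (forall x, 0 <= f x) -> 0 <= expect f.
Proof. by move=> f0; apply: Rintegral_ge0. Qed.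

Lemma expect_norm_le f M : bounded_measurable f -> (forall x, `|f x| <= M) ->
  `|expect f| <= M.
Proof.
move=> bf fM; rewrite ler_norml; apply/andP; split.
  rewrite -[- M]expect_cst; apply: expect_le => // [|x]; first exact: bm_cst.
  by have := fM x; rewrite ler_norml => /andP[].
rewrite -[leRHS]expect_cst; apply: expect_le => // [|x]; first exact: bm_cst.
exact: le_trans (ler_norm _) (fM x).
Qed.

Lemma expect_indic A : measurable A -> expect (\1_A) = pr A.
Proof.
by move=> mA; rewrite /expect /Rintegral integral_indic// setIT.
Qed.

Lemma pr_ge0 A : 0 <= pr A.
Proof. by rewrite fine_ge0. Qed.

Lemma prT : pr setT = 1.
Proof. by rewrite /pr probability_setT. Qed.

Lemma pr0 : pr set0 = 0.
Proof. by rewrite /pr measure0. Qed.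

Lemma pr_le A B : measurable A -> measurable B -> A `<=` B -> pr A <= pr B.
Proof.
by move=> mA mB AB; rewrite -lee_fin !prE//; apply: le_measure; rewrite ?inE.
Qed.

Lemma pr_le1 A : measurable A -> pr A <= 1.
Proof. by move=> mA; rewrite -prT; exact: pr_le. Qed.

Lemma prDI A B : measurable A -> measurable B ->
  pr A = pr (A `\` B) + pr (A `&` B).
Proof.
move=> mA mB; apply: EFin_inj; rewrite EFinD !prE//.
- exact: measureDI.
- exact: measurableI.
- exact: measurableD.
Qed.

Lemma prU A B : measurable A -> measurable B -> A `&` B = set0 ->
  pr (A `|` B) = pr A + pr B.
Proof.
move=> mA mB AB; apply: EFin_inj; rewrite EFinD !prE//.
  exact: measureU.
exact: measurableU.
Qed.

Lemma prU_le A B : measurable A -> measurable B -> pr (A `|` B) <= pr A + pr B.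
Proof.
move=> mA mB; rewrite -lee_fin EFinD !prE//; first exact: measureU2.
exact: measurableU.
Qed.

Lemma prC A : measurable A -> pr (~` A) = 1 - pr A.
Proof.
move=> mA; have := prDI measurableT mA; rewrite prT setTI setTD => ->; lra.
Qed.

(** Continuity from below as an error bound, the form in which it enters the estimates below. *)
Lemma pr_bigcup_approx (F : nat -> set T) (e : R) :
  (forall n, measurable (F n)) -> 0 < e ->
  exists n, pr (\bigcup_k F k `\` \big[setU/set0]_(k < n) F k) <= e.
Proof.
move=> mF e0; pose G n := \big[setU/set0]_(k < n) F k.
have mG n : measurable (G n) by apply: bigsetU_measurable.
have GE : \bigcup_n G n = \bigcup_n F n.
  apply/seteqP; split=> x [n _ Fx]; first exact: bigsetU_bigcup Fx.
  by exists n.+1 => //; rewrite /G big_ord_recr; right.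
have mU : measurable (\bigcup_n F n) by exact: bigcupT_measurable.
have ndG : nondecreasing_seq G.
  by move=> m n mn; apply/subsetPset; exact: subset_bigsetU.
have : (P \o G @ \oo --> (pr (\bigcup_n F n))%:E)%E.
  by rewrite prE// -GE; apply: nondecreasing_cvg_mu => //; rewrite GE.
move=> /fine_cvgP[_] /cvgrPdist_le /(_ e e0)[N _ /(_ N (leqnn N))].
rewrite /= -/(pr (G N)) => h; exists N.
have GF : G N `<=` \bigcup_k F k by rewrite -GE; exact: bigcup_sup.
rewrite [pr (_ `\` _)](_ : _ = pr (\bigcup_n F n) - pr (G N)).
  exact: le_trans (ler_norm _) h.
by rewrite (prDI mU (mG N)) (setIidr GF) addrK.
Qed.

Lemma pr_bigU_le (I : Type) (s : seq I) (F : I -> set T) :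
  (forall i, measurable (F i)) ->
  pr (\big[setU/set0]_(i <- s) F i) <= \sum_(i <- s) pr (F i).
Proof.
move=> mF; elim: s => [|i s IH]; first by rewrite !big_nil pr0.
rewrite !big_cons; apply: (le_trans (prU_le _ _)) => //.
  by apply: bigsetU_measurable.
by rewrite lerD2l.
Qed.

Lemma pr_eq0_le A B : measurable A -> measurable B -> A `<=` B -> pr B = 0 ->
  pr A = 0.
Proof.
move=> mA mB AB B0; apply/eqP; rewrite eq_le pr_ge0 andbT -B0; exact: pr_le.
Qed.

End OneSpace.

Lemma measurable_preimage d d' (T : measurableType d) (T' : measurableType d')
    (h : T -> T') A :
  measurable_fun setT h -> measurable A -> measurable (h @^-1` A).
Proof. by move=> mh mA; rewrite -[X in measurable X]setTI; exact: mh. Qed.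

Section Transport.
Context d d' (T : measurableType d) (T' : measurableType d').
Variables (P : probability T R) (Q : probability T' R).

Definition measure_preserving (h : T -> T') : Prop :=
  measurable_fun setT h /\ forall A, measurable A -> P (h @^-1` A) = Q A.

Lemma bm_comp (h : T -> T') f : measurable_fun setT h ->
  bounded_measurable f -> bounded_measurable (f \o h).
Proof.
move=> mh [mf [M fM]]; split; first exact: measurableT_comp.
by exists M => x; exact: fM.
Qed.

Lemma mp_pr h A : measure_preserving h -> measurable A ->
  pr P (h @^-1` A) = pr Q A.
Proof. by move=> [mh hP] mA; rewrite /pr hP. Qed.

Lemma mp_expect h f : measure_preserving h -> bounded_measurable f ->
  expect P (f \o h) = expect Q f.
Proof.
move=> [mh hP] bf; rewrite /expect /Rintegral; congr fine.
transitivity (\int[pushforward P h]_x (f x)%:E)%E.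
  rewrite integral_pushforward//.
  - by case: bf => mf _; exact/measurable_EFinP.
  - by rewrite preimage_setT; apply: bm_integrable; exact: bm_comp.
by apply: eq_measure_integral => A mA _; exact: hP.
Qed.

(** The pi-lambda theorem: the sets on which the two probabilities agree are stable under
    complements and countable disjoint unions. *)
Lemma mp_pi_system (G : set (set T')) h : @measurable _ T' = <<s G >> ->
  setI_closed G -> measurable_fun setT h ->
  (forall A, G A -> P (h @^-1` A) = Q A) -> measure_preserving h.
Proof.
move=> GE GI mh hG; split=> // A mA.
have mG B : G B -> measurable B.
  by move=> GB; rewrite GE; exact: sub_sigma_algebra.
suff [] : [set B | measurable B /\ P (h @^-1` B) = Q B] A by [].
apply: (@dynkin_induction _ T' G) => //=.
- by split=> //; rewrite preimage_setT !probability_setT.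
- by move=> B GB; split; [exact: mG|exact: hG].
- move=> B mB [_ e]; split; first exact: measurableC.
  rewrite preimage_setC !probability_setC ?e//.
  exact: measurable_preimage.
- move=> F mF tF e; split; first exact: bigcupT_measurable.
  rewrite preimage_bigcup !measure_bigcup//.
  + by apply: eq_eseriesr => i _; exact: (e i).2.
  + by move=> i _; exact: measurable_preimage.
  + apply/trivIsetP => i j _ _ ij; rewrite -preimage_setI.
    by move/trivIsetP : tF => /(_ i j I I ij) ->; rewrite preimage_set0.
- by rewrite -GE.
Qed.

End Transport.

Lemma mp_comp d d' d'' (T : measurableType d) (T' : measurableType d')
    (T'' : measurableType d'') (P : probability T R) (Q : probability T' R)
    (S : probability T'' R) g h :
  measure_preserving P Q h -> measure_preserving Q S g ->
  measure_preserving P S (g \o h).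
Proof.
move=> [mh hP] [mg gP]; split; first exact: measurableT_comp.
by move=> A mA; rewrite -gP// -hP//; exact: measurable_preimage.
Qed.

Section Product.
Context d d' (T : measurableType d) (T' : measurableType d').
Variables (P : probability T R) (Q : probability T' R).

Definition product_prob : probability (T * T')%type R := (P \x Q)%E.

Lemma product_probE A B : measurable A -> measurable B ->
  product_prob (A `*` B) = (P A * Q B)%E.
Proof. by move=> mA mB; rewrite /= product_measure1E. Qed.

Lemma pr_rect A B : measurable A -> measurable B ->
  pr product_prob (A `*` B) = pr P A * pr Q B.
Proof.
move=> mA mB; apply: EFin_inj; rewrite EFinM !prE//; last exact: measurableX.
exact: product_probE.
Qed.

Section Fubini.
Variables (f : T * T' -> R).
Hypothesis bf : bounded_measurable f.

Let inner x : bounded_measurable (fun y => f (x, y)).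
Proof.
case: bf => mf [M fM]; split; last by exists M.
exact: (measurableT_comp mf (pair1_measurable x)).
Qed.

Let innerE x : (\int[Q]_y (f (x, y))%:E)%E = (expect Q (fun y => f (x, y)))%:E.
Proof.
rewrite /expect /Rintegral fineK//.
exact: (integrable_fin_num measurableT (bm_integrable Q (inner x))).
Qed.

Lemma bm_expect : bounded_measurable (fun x => expect Q (fun y => f (x, y))).
Proof.
split.
  apply/measurable_EFinP.
  have := @measurable_fubini_F _ _ T T' R P Q (EFin \o f)
     (bm_integrable product_prob bf).
  by rewrite /fubini_F; under [X in measurable_fun _ X]eq_fun do rewrite innerE.
case: (bf) => _ [M fM]; exists M => x.
by apply: expect_norm_le => // y.
Qed.

Lemma expect_product :
  expect product_prob f = expect P (fun x => expect Q (fun y => f (x, y))).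
Proof.
rewrite /expect /Rintegral; congr fine.
have := @integral12_prod_meas1 _ _ T T' R P Q (EFin \o f)
     (bm_integrable product_prob bf).
move=> <-; rewrite /fubini_F; apply: eq_integral => x _; exact: innerE.
Qed.

End Fubini.

Lemma mp_rect d1 (S : measurableType d1) (PS : probability S R)
    (h : S -> T * T') : measurable_fun setT h ->
  (forall A B, measurable A -> measurable B ->
    PS (h @^-1` (A `*` B)) = (P A * Q B)%E) ->
  measure_preserving PS product_prob h.
Proof.
move=> mh hr; apply: (@mp_pi_system _ _ _ _ _ _ [set A `*` B | A in measurable & B in measurable]) => //.
- exact: measurable_prod_measurableType.
- move=> _ _ [A mA [B mB <-]] [A' mA' [B' mB' <-]].
  exists (A `&` A'); first exact: measurableI.
  by exists (B `&` B'); [exact: measurableI|rewrite setXI].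
- move=> _ [A mA [B mB <-]]; rewrite hr//; exact/esym/product_probE.
Qed.

End Product.

End Expectation.

(** * Ultralimits and exhaustions *)

Definition bdd_fun {R : realType} {T : Type} (f : T -> R) : Prop :=
  exists M : R, forall x, `|f x| <= M.

Section BoundedFunctions.
Context {R : realType} {T : Type}.
Implicit Types f g : T -> R.

Lemma bdd_cst (c : R) : bdd_fun (fun _ : T => c).
Proof. by exists `|c|. Qed.

Lemma bdd_lin (c : R) f g : bdd_fun f -> bdd_fun g ->
  bdd_fun (fun x => c * f x + g x).
Proof.
move=> [M fM] [N gN]; exists (`|c| * M + N) => x.
by apply: (le_trans (ler_normD _ _)); rewrite lerD// normrM ler_wpM2l.
Qed.

Lemma bdd01 f : (forall x, 0 <= f x <= 1) -> bdd_fun f.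
Proof. by move=> f01; exists 1 => x; have /andP[f0 f1] := f01 x; rewrite ger0_norm. Qed.

End BoundedFunctions.

Section UltraLimit.
Context {R : realType}.

(** A free ultrafilter, because the averages along an exhaustion need not converge and their limit
    has to be linear. *)
Definition ultra_nat : set_system nat :=
  sval (cid (@ultraFilterLemma nat \oo _)).

Lemma ultra_natP : UltraFilter ultra_nat /\ \oo `<=` ultra_nat.
Proof. by rewrite /ultra_nat; case: cid. Qed.

Instance ultra_nat_ultra : UltraFilter ultra_nat := ultra_natP.1.

Definition is_ulim (u : nat -> R) (l : R) : Prop :=
  forall e : R, 0 < e -> ultra_nat [set n | `|u n - l| <= e].

Lemma is_ulim_uniq u l l' : is_ulim u l -> is_ulim u l' -> l = l'.
Proof.
move=> ul ul'; apply/eqP; rewrite -subr_eq0 -normr_le0; apply/ler_addgt0Pr => e e0.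
have e2 : 0 < e / 2 by rewrite divr_gt0.
have : ultra_nat ([set n | `|u n - l| <= e / 2] `&` [set n | `|u n - l'| <= e / 2]).
  by apply: filterI; [exact: ul|exact: ul'].
move=> /filter_ex[n [/= h h']]; rewrite add0r.
rewrite (_ : l - l' = (u n - l') - (u n - l)); last by ring.
by apply: (le_trans (ler_normB _ _)); rewrite (splitr e) lerD.
Qed.

(** The limit is the supremum of the levels that [u] exceeds on a set of the ultrafilter; a level
    slightly above it is exceeded only on the complement of such a set. *)
Lemma is_ulim_ex u : bdd_fun u -> exists l, is_ulim u l.
Proof.
move=> [M uM]; pose S := [set r : R | ultra_nat [set n | r <= u n]].
have S0 : S (- M).
  apply: filterS filterT => n _ /=; have := uM n.
  by rewrite ler_norml => /andP[].
have SM : ubound S M.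
  move=> r /filter_ex[n /= rn]; apply: (le_trans rn).
  by have := uM n; rewrite ler_norml => /andP[].
have hS : has_sup S by split; [exists (- M)|exists M].
exists (sup S) => e e0.
have [r Sr rS] := sup_adherent e0 hS.
have [SS|SnS] := in_ultra_setVsetC [set n | sup S + e <= u n] ultra_nat_ultra.
  have : sup S + e <= sup S by apply: ub_le_sup => //; exists M.
  by rewrite gerDl leNgt e0.
have : ultra_nat ([set n | r <= u n] `&` ~` [set n | sup S + e <= u n]).
  exact: filterI.
apply: filterS => n [/= rn /negP]; rewrite -ltNge => un.
rewrite ler_distl; apply/andP; split; last by rewrite ltW.
by apply: le_trans rn; rewrite lerBlDr; move: rS; rewrite ltrBlDr => /ltW.
Qed.

Definition ulim (u : nat -> R) : R := xget 0 [set l | is_ulim u l].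

Lemma ulimP u : bdd_fun u -> is_ulim u (ulim u).
Proof.
move=> /is_ulim_ex[l ul]; rewrite /ulim; case: xgetP => [x _//|/(_ l)].
by move=> /(_ ul).
Qed.

Lemma ulimE u l : is_ulim u l -> ulim u = l.
Proof.
move=> ul; rewrite /ulim; case: xgetP => [x _ ux|/(_ l)/(_ ul)//].
exact: is_ulim_uniq ux ul.
Qed.

Lemma ulim_cst c : ulim (fun=> c) = c.
Proof.
apply: ulimE => e e0; apply: filterS filterT => n _ /=.
by rewrite subrr normr0 ltW.
Qed.

Lemma ulim_lin c u v : bdd_fun u -> bdd_fun v ->
  ulim (fun n => c * u n + v n) = c * ulim u + ulim v.
Proof.
move=> bu bv; apply: ulimE => e e0.
have c0 : 0 < 2 * (`|c| + 1) by rewrite mulr_gt0// ltr_wpDl.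
have : ultra_nat ([set n | `|u n - ulim u| <= e / (2 * (`|c| + 1))] `&`
   [set n | `|v n - ulim v| <= e / 2]).
  by apply: filterI; apply: ulimP => //; rewrite divr_gt0.
apply: filterS => n [/= hu hv].
rewrite (_ : _ - _ = c * (u n - ulim u) + (v n - ulim v)); last by ring.
apply: (le_trans (ler_normD _ _)); rewrite normrM (splitr e); apply: lerD => //.
apply: (le_trans (ler_wpM2l _ hu)) => //.
have -> : e / (2 * (`|c| + 1)) = (e / 2) / (`|c| + 1).
  by rewrite invfM mulrA.
rewrite mulrCA ger_pMr ?divr_gt0// ler_pdivrMr ?mul1r ?lerDl//.
Qed.

Lemma ulim_le_near u c N : bdd_fun u -> (forall n, (N <= n)%N -> u n <= c) ->
  ulim u <= c.
Proof.
move=> bu uc; apply/ler_addgt0Pr => e e0.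
have : ultra_nat ([set n | `|u n - ulim u| <= e] `&` [set n | (N <= n)%N]).
  apply: filterI; first exact: ulimP.
  by apply: ultra_natP.2; exists N.
move=> /filter_ex[n [/= h Nn]]; have := uc n Nn.
by move: h; rewrite ler_distlC => /andP[_ h] un; lra.
Qed.

Lemma bdd_opp (T : Type) (u : T -> R) : bdd_fun u -> bdd_fun (fun n => - u n).
Proof. by move=> [M uM]; exists M => n; rewrite normrN. Qed.

Lemma ulimN u : bdd_fun u -> ulim (fun n => - u n) = - ulim u.
Proof.
move=> bu; have := ulim_lin (-1) bu (bdd_cst 0); rewrite ulim_cst addr0 mulN1r => <-.
by congr ulim; apply/funext => n; rewrite mulN1r addr0.
Qed.

Lemma ulim_ge_near u c N : bdd_fun u -> (forall n, (N <= n)%N -> c <= u n) ->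
  c <= ulim u.
Proof.
move=> bu uc; rewrite -lerN2 -ulimN//; apply: (@ulim_le_near _ _ N).
  exact: bdd_opp.
by move=> n Nn; rewrite lerN2 uc.
Qed.

Lemma ulim_dist_near u l e N : bdd_fun u ->
  (forall n, (N <= n)%N -> `|u n - l| <= e) -> `|ulim u - l| <= e.
Proof.
move=> bu h; rewrite ler_distl; apply/andP; split.
  apply: (ulim_ge_near (N := N)) => // n /h; rewrite ler_distl => /andP[//].
apply: (ulim_le_near (N := N)) => // n /h; rewrite ler_distl => /andP[//].
Qed.

End UltraLimit.

Section Exhaustion.
Context {T : choiceType}.

Record exhaustion (E : nat -> seq T) : Prop := Exhaustion {
  exhaustion_uniq : forall n, uniq (E n) ;
  exhaustion_mono : forall m n, (m <= n)%N -> {subset E m <= E n} ;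
  exhaustion_cover : forall x, exists n, x \in E n }.

Lemma exhaustion_ex : countable [set: T] -> exists E, exhaustion E.
Proof.
move=> /pcard_injP[e einj].
have ei : injective e by move=> x y; apply: einj; rewrite inE.
have fin n : finite_set [set x | (e x < n)%N].
  by apply: (@finite_preimage _ _ [set k | (k < n)%N] e); [move=> x y _ _; exact: ei|exact: finite_II].
exists (fun n => enum_fset (fset_set [set x | (e x < n)%N])).
have memE n x : (x \in enum_fset (fset_set [set x | (e x < n)%N])) = (e x < n)%N.
  by rewrite -[LHS]/(x \in fset_set _) in_fset_set//; apply/idP/idP; rewrite inE.
split.
- by move=> n; exact: fset_uniq.
- by move=> m n mn x; rewrite !memE => /leq_trans; exact.
- by move=> x; exists (e x).+1; rewrite memE.
Qed.

Lemma exhaustion_seq E : exhaustion E -> forall s : seq T,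
  exists n, {subset s <= E n}.
Proof.
move=> eE; elim=> [|x s [n sn]]; first by exists 0%N.
have [m xm] := exhaustion_cover eE x; exists (maxn n m) => y.
rewrite inE => /predU1P[->|/sn].
  exact: (exhaustion_mono eE (leq_maxr n m)).
exact: (exhaustion_mono eE (leq_maxl n m)).
Qed.

End Exhaustion.

(** * Invariant means on slowly varying functions *)

Section States.
Context {R : realType} {G : groupType}.
Implicit Types f g : G -> R.

(** The real-valued elements of the space S(G): boundedness, and [f - R_t f] in c_0 for each [t]. *)
Definition slowly_varying f : Prop :=
  bdd_fun f /\
  forall (t : G) (e : R), 0 < e -> finite_set [set s | e <= `|f s - f (s * t)%g|].

Lemma slowly_varying_lin c f g : slowly_varying f -> slowly_varying g ->
  slowly_varying (fun s => c * f s + g s).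
Proof.
move=> [bf sf] [bg sg]; split; first exact: bdd_lin.
move=> t e e0; have c0 : 0 < `|c| + 1 by rewrite ltr_wpDl.
have e1 : 0 < e / 2 / (`|c| + 1) by rewrite !divr_gt0.
have e2 : 0 < e / 2 by rewrite divr_gt0.
apply: (@sub_finite_set _ _ ([set s | e / 2 / (`|c| + 1) <= `|f s - f (s * t)%g|] `|`
   [set s | e / 2 <= `|g s - g (s * t)%g|])); last first.
  by rewrite finite_setU; split; [exact: sf|exact: sg].
move=> s /= es; apply/orP; rewrite -implyNb -!ltNge; apply/implyP => h.
rewrite leNgt; apply/negP => h'.
move: es; apply/negP; rewrite -ltNge.
rewrite (_ : _ - _ = c * (f s - f (s * t)%g) + (g s - g (s * t)%g)); last by ring.
apply: (le_lt_trans (ler_normD _ _)); rewrite (splitr e) normrM.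
apply: ler_ltD => //.
move: h; rewrite ltr_pdivlMr// => /ltW; apply: le_trans.
by rewrite mulrC ler_wpM2l// lerDl.
Qed.

Lemma slowly_varying_cst c : slowly_varying (fun=> c).
Proof.
split; first exact: bdd_cst.
move=> t e e0; rewrite (_ : [set _ | _] = set0)//.
by apply/seteqP; split=> // s /=; rewrite subrr normr0 leNgt e0.
Qed.

Lemma slowly_varying_shift t f : slowly_varying f ->
  slowly_varying (fun s => f (t * s)%g).
Proof.
move=> [[M fM] sf]; split; first by exists M.
move=> s e e0; have := sf s e e0.
set A := [set _ | _]; rewrite (_ : [set _ | _] = (fun r => (t * r)%g) @^-1` A); last first.
  by apply/seteqP; split=> r; rewrite /A /= mulgA.
by apply: finite_preimage => x y _ _; exact: mulgI.
Qed.

Record invariant_mean (ph : (G -> R) -> R) : Prop := InvariantMean {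
  mean_lin : forall c f g, slowly_varying f -> slowly_varying g ->
    ph (fun s => c * f s + g s) = c * ph f + ph g ;
  mean_ge0 : forall f, slowly_varying f -> (forall s, 0 <= f s) -> 0 <= ph f ;
  mean_unit : ph (fun=> 1) = 1 ;
  mean_shift : forall t f, slowly_varying f -> ph (fun s => f (t * s)%g) = ph f }.

Section MeanTheory.
Variable ph : (G -> R) -> R.
Hypothesis phP : invariant_mean ph.

Lemma mean_cst c : ph (fun=> c) = c.
Proof.
have h := mean_lin phP c (slowly_varying_cst 1) (slowly_varying_cst 0).
have h0 := mean_lin phP (-1) (slowly_varying_cst 0) (slowly_varying_cst 0).
have p0 : ph (fun=> 0) = 0.
  move: h0; rewrite (_ : (fun s : G => -1 * 0 + 0) = (fun=> 0)); last first.
    by apply/funext => s; ring.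
  by rewrite mulN1r addNr.
move: h; rewrite p0 (mean_unit phP) addr0 mulr1 => h.
by rewrite -[RHS]h; congr ph; apply/funext => s; rewrite addr0 mulr1.
Qed.

Lemma mean_le f g : slowly_varying f -> slowly_varying g ->
  (forall s, f s <= g s) -> ph f <= ph g.
Proof.
move=> sf sg fg; rewrite -subr_ge0.
rewrite (_ : ph g - ph f = ph (fun s => -1 * f s + g s)); last first.
  by rewrite mean_lin// mulN1r addrC.
apply: (mean_ge0 phP); first exact: slowly_varying_lin.
by move=> s; rewrite mulN1r addrC subr_ge0.
Qed.

Lemma mean_sub f g : slowly_varying f -> slowly_varying g ->
  ph (fun s => f s - g s) = ph f - ph g.
Proof.
move=> sf sg; have := mean_lin phP (-1) sg sf; rewrite mulN1r addrC => <-.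
by congr ph; apply/funext => s; rewrite mulN1r addrC.
Qed.

Lemma mean_dist_le f g h e : slowly_varying f -> slowly_varying g ->
  slowly_varying h -> ph h <= e ->
  (forall s, `|f s - g s| <= h s) -> `|ph f - ph g| <= e.
Proof.
move=> sf sg sh he fgh.
have le1 f' g' : slowly_varying f' -> slowly_varying g' ->
    (forall s, `|f' s - g' s| <= h s) -> ph f' - ph g' <= e.
  move=> sf' sg' h'; apply: le_trans he; rewrite -mean_sub//.
  apply: mean_le => //.
    have := slowly_varying_lin (-1) sg' sf'; congr slowly_varying.
    by apply/funext => s; rewrite mulN1r addrC.
  by move=> s; apply: le_trans (h' s); exact: ler_norm.
rewrite ler_norml; apply/andP; split; last exact: le1.
rewrite lerNl opprB; apply: le1 => // s; by rewrite distrC.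
Qed.

Lemma mean_dist_cst f g e : slowly_varying f -> slowly_varying g ->
  (forall s, `|f s - g s| <= e) -> `|ph f - ph g| <= e.
Proof.
move=> sf sg fg; apply: (@mean_dist_le f g (fun=> e)) => //.
- exact: slowly_varying_cst.
- by rewrite mean_cst.
Qed.

End MeanTheory.

End States.

Local Open Scope complex_scope.

(** The real part of a complex state is a real linear functional on real functions. Invariance is
    used at [t^-1], as [translate_left] inverts its argument. *)
Lemma not_properly_proximal_mean (R : realType) (G : groupType) :
  ~ properly_proximal R G -> exists ph : (G -> R) -> R, invariant_mean ph.
Proof.
move=> /notP[phi [lin ge0 unit inv]].
have VC (f : G -> R) : slowly_varying f ->
    @proximal_functions R G (fun s => (f s)%:C).
  move=> [[M fM] sf]; split.
    exists M%:C => s; rewrite normc_def /= expr0n addr0 sqrtr_sqr lecR.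
    exact: fM.
  move=> t e; rewrite ltcE => /andP[/eqP /= e0 ere].
  apply: (sub_finite_set _ (sf t _ ere)) => s /=.
  rewrite /translate_right -rmorphB normc_def /= expr0n addr0 sqrtr_sqr.
  by rewrite lecE => /andP[_].
exists (fun f => complex.Re (phi (fun s => (f s)%:C))); split.
- move=> c f g sf sg; have := lin c%:C _ _ (VC f sf) (VC g sg).
  rewrite (_ : (fun s => c%:C * (f s)%:C + (g s)%:C) =
     (fun s => (c * f s + g s)%:C)); last first.
    by apply/funext => s; rewrite rmorphD rmorphM.
  move=> ->; case: (phi _) => a b; case: (phi _) => a' b' /=.
  by rewrite mul0r subr0.
- move=> f sf f0; have := ge0 _ (VC f sf).
  rewrite lecE => /(_ _)/andP[|_ //].
  by move=> s; rewrite ler0c.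
- have := unit; rewrite (_ : (fun=> 1%:C) = (fun=> 1)) => [->//|].
  by apply/funext => s.
- move=> t f sf; have := inv t^-1%g _ (VC f sf).
  by rewrite /translate_left invgK => ->.
Qed.

(** * Amenability from almost invariant positive functionals *)

Section Amenability.
Context {R : realType} {G : groupType}.
Implicit Types f g : G -> R.

(** The mass is only kept away from 0: averages over a spectral sample are normalized where the
    sample is heavy, not everywhere. It is divided out after a limit has been taken. *)
Record almost_mean (c : R) (K : seq G) (k : R) (M : (G -> R) -> R) : Prop :=
  AlmostMean {
  almost_mean_lin : forall a f g, bdd_fun f -> bdd_fun g ->
    M (fun s => a * f s + g s) = a * M f + M g ;
  almost_mean_ge0 : forall f, bdd_fun f -> (forall s, 0 <= f s) -> 0 <= M f ;
  almost_mean_unit : c <= M (fun=> 1) <= 1 ;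
  almost_mean_shift : forall f t, (forall s, 0 <= f s <= 1) -> t \in K ->
    `|M (fun s => f (t * s)%g) - M f| <= k }.

Lemma almost_mean_bound c K k M f B : almost_mean c K k M ->
  (forall s, `|f s| <= B) -> 0 <= B -> `|M f| <= B.
Proof.
move=> [lin ge0 /andP[_ le1] _] fB B0.
have bf : bdd_fun f by exists B.
have b1 : bdd_fun (fun _ : G => 1 : R) by exact: bdd_cst.
have b0 : bdd_fun (fun _ : G => 0 : R) by exact: bdd_cst.
have M0 : M (fun=> 0) = 0.
  have := lin (-1) _ _ b0 b0; rewrite (_ : (fun s : G => -1 * 0 + 0) = (fun=> 0)).
    by move=> ->; rewrite mulN1r addNr.
  by apply/funext => s; ring.
have MB : M (fun=> B) <= B.
  have := lin B _ _ b1 b0; rewrite M0 !addr0 mulr1 => ->; by rewrite ler_piMr.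
rewrite ler_norml; apply/andP; split.
  have := ge0 (fun s => 1 * f s + B) (bdd_lin 1 bf (bdd_cst B)).
  rewrite (lin _ _ _ bf (bdd_cst B)) mul1r => h.
  rewrite lerNl -subr_ge0 opprK; apply: (le_trans (h _)).
    move=> s; have := fB s; rewrite ler_norml mul1r => /andP[h1 _]; lra.
  by rewrite addrC lerD2r.
have := ge0 (fun s => -1 * f s + B) (bdd_lin (-1) bf (bdd_cst B)).
rewrite (lin _ _ _ bf (bdd_cst B)) mulN1r => h.
rewrite -subr_ge0; apply: (le_trans (h _)).
  move=> s; have := fB s; rewrite ler_norml => /andP[_ h1]; lra.
by rewrite addrC lerD2r.
Qed.

(** The ultralimit over growing [K] and [k = 1/(n+1)] is exactly invariant on functions with values
    in [0,1], hence on bounded functions by affine rescaling. Dividing by its mass, at least [c],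
    and treating real and imaginary parts separately gives a state. *)
Lemma amenable_of_almost_means (c : R) : countable [set: G] -> 0 < c ->
  (forall K k, 0 < k -> exists M, almost_mean c K k M) -> amenable R G.
Proof.
move=> /exhaustion_ex[E EP] c0 hM.
have k0 n : 0 < n.+1%:R^-1 :> R by [].
pose M n := sval (cid (hM (E n) _ (k0 n))).
have MP n : almost_mean c (E n) n.+1%:R^-1 (M n) by rewrite /M; case: cid.
have bM f : bdd_fun f -> bdd_fun (fun n => M n f).
  move=> [B fB]; exists B => n; apply: (almost_mean_bound (MP n)) => //.
  exact: le_trans (fB 1%g).
pose N f := ulim (fun n => M n f).
have Nlin a f g : bdd_fun f -> bdd_fun g ->
    N (fun s => a * f s + g s) = a * N f + N g.
  move=> bf bg; rewrite /N -ulim_lin; [|exact: bM..].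
  congr ulim; apply/funext => n; exact: (almost_mean_lin (MP n)).
have Nge0 f : bdd_fun f -> (forall s, 0 <= f s) -> 0 <= N f.
  move=> bf f0; apply: (@ulim_ge_near _ _ _ 0%N); first exact: bM.
  by move=> n _; exact: (almost_mean_ge0 (MP n)).
have N1 : 0 < N (fun=> 1).
  apply: (lt_le_trans c0); apply: (@ulim_ge_near _ _ _ 0%N).
    by apply: bM; exact: bdd_cst.
  by move=> n _; have /andP[] := almost_mean_unit (MP n).
have bshift t f : bdd_fun f -> bdd_fun (fun s => f (t * s)%g).
  by move=> [B fB]; exists B.
have Nshift01 f t : (forall s, 0 <= f s <= 1) -> N (fun s => f (t * s)%g) = N f.
  move=> f01; have bf := bdd01 f01; have bft := bshift t _ bf.
  apply/eqP; rewrite -subr_eq0 -normr_le0; apply/ler_addgt0Pr => e e0.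
  rewrite add0r -[N _ - _]subr0.
  rewrite (_ : N _ - N f = ulim (fun n => -1 * M n f + M n (fun s => f (t * s)%g))); last first.
    by rewrite ulim_lin; [rewrite mulN1r addrC|exact: bM..].
  have [m tm] := exhaustion_cover EP t.
  pose n0 := maxn m (Num.bound e^-1).
  apply: (@ulim_dist_near _ _ _ _ n0); first by apply: bdd_lin; exact: bM.
  move=> n; rewrite geq_max => /andP[mn en]; rewrite subr0 mulN1r addrC.
  apply: le_trans (almost_mean_shift (MP n) f01 (exhaustion_mono EP mn tm)) _.
  rewrite invf_ple ?posrE//; apply/ltW; apply: (lt_le_trans (archi_boundP _)).
    by rewrite invr_ge0 ltW.
  by rewrite ler_nat; exact: leqW.
have b1 : bdd_fun (fun _ : G => 1 : R) by exact: bdd_cst.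
have Nshift f t : bdd_fun f -> N (fun s => f (t * s)%g) = N f.
  move=> [B fB]; pose A := `|B| + 1.
  have A0 : 0 < A by rewrite /A ltr_wpDl.
  pose h s := (2 * A)^-1 * f s + 2^-1.
  have h01 s : 0 <= h s <= 1.
    have : `|f s| <= A by apply: (le_trans (fB s)); rewrite /A (le_trans (ler_norm _))// lerDl.
    rewrite ler_norml => /andP[l u].
    rewrite /h invfM -mulrA [A^-1 * _]mulrC.
    have l' : -1 <= f s / A by rewrite ler_pdivlMr// mulN1r.
    have u' : f s / A <= 1 by rewrite ler_pdivrMr// mul1r.
    by apply/andP; split; lra.
  have bh := bdd01 h01.
  have fE : f = (fun s => (2 * A) * h s + (- A)).
    apply/funext => s; rewrite /h mulrDr mulVKf ?gt_eqF ?mulr_gt0//.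
    rewrite mulrAC divff ?mul1r ?addrK//.
  have NA := bdd_cst (T := G) (- A).
  have -> : N (fun s => f (t * s)%g) = N (fun s => 2 * A * h (t * s)%g + (- A)).
    by congr N; apply/funext => s; rewrite [in LHS]fE.
  have -> : N f = N (fun s => 2 * A * h s + (- A)) by rewrite [in LHS]fE.
  have bht := bshift t h bh.
  by rewrite (Nlin _ _ _ bht NA) (Nlin _ _ _ bh NA) (Nshift01 h t h01).
exists (fun f : G -> R[i] => (N (@complex.Re R \o f) / N (fun=> 1)) +i*
                 (N (@complex.Im R \o f) / N (fun=> 1))).
have bRe (f : G -> R[i]) : ell_infty f -> bdd_fun (@complex.Re R \o f).
  move=> [B fB]; exists (complex.Re B) => s; have := fB s.
  move=> /(le_trans (normc_ge_Re _)); rewrite lecE => /andP[_]//.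
have bIm (f : G -> R[i]) : ell_infty f -> bdd_fun (@complex.Im R \o f).
  move=> [B fB]; exists (complex.Re B) => s; have := fB s.
  rewrite normc_def lecE => /andP[_ /= h]; apply: le_trans h.
  by rewrite -sqrtr_sqr ler_wsqrtr// lerDr sqr_ge0.
split.
- move=> c' f g /[dup] /bRe rf /bIm jf /[dup] /bRe rg /bIm jg.
  case: c' => a b.
  have -> : @complex.Re R \o (fun s => (a +i* b) * f s + g s) =
      (fun s => a * (complex.Re (f s)) + (- b * complex.Im (f s) + complex.Re (g s))).
    by apply/funext => s /=; case: (f s) => x y; case: (g s) => x' y' /=; ring.
  have -> : @complex.Im R \o (fun s => (a +i* b) * f s + g s) =
      (fun s => a * (complex.Im (f s)) + (b * complex.Re (f s) + complex.Im (g s))).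
    by apply/funext => s /=; case: (f s) => x y; case: (g s) => x' y' /=; ring.
  rewrite !Nlin //; try exact: bdd_lin.
  by apply/eqP; rewrite eq_complex /=; apply/andP; split; apply/eqP; ring.
- move=> f bf f0; rewrite lecE /=; apply/andP; split.
    apply/eqP; rewrite (_ : @complex.Im R \o f = (fun s => -1 * 0 + 0)).
      by rewrite Nlin; [|exact: bdd_cst..]; rewrite mulN1r addNr mul0r.
    apply/funext => s /=; have := f0 s; rewrite lecE => /andP[/eqP -> _] /=.
    by ring.
  apply: divr_ge0; last exact: ltW.
  apply: Nge0; first exact: bRe.
  by move=> s /=; have := f0 s; rewrite lecE => /andP[].
- apply/eqP; rewrite eq_complex /=; apply/andP; split.
    by rewrite divff// gt_eqF.
  rewrite (_ : @complex.Im R \o _ = (fun s => -1 * 0 + 0)).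
    by rewrite Nlin; [|exact: bdd_cst..]; rewrite mulN1r addNr mul0r.
  by apply/funext => s /=; ring.
- move=> t f /[dup] /bRe rf /bIm jf; rewrite /translate_left.
  by rewrite -(Nshift _ t^-1%g rf) -(Nshift _ t^-1%g jf).
Qed.

End Amenability.

(** * Spectral samples *)

Section SpectralSample.
Context {R : realType} {T : eqType}.
Implicit Types (s : pred T -> R) (A B C : pred T) (D S : seq T)
  (psi : seq T -> R).

Definition addp (g : T) A : pred T := fun x => (x == g) || A x.

(* Read [s B] as the probability that a random finite set [S] avoids [B]; then
   [spec s D A psi] is the expectation of [psi (S :&: D)] on the event that [S]
   avoids [A]. *)
Fixpoint spec s D A psi : R :=
  if D is g :: D' then
    spec s D' (addp g A) psi +
    (spec s D' A (fun S => psi (g :: S)) -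
     spec s D' (addp g A) (fun S => psi (g :: S)))
  else psi [::] * s A.

Lemma spec_lin s c D A psi psi' :
  spec s D A (fun S => c * psi S + psi' S) = c * spec s D A psi + spec s D A psi'.
Proof.
by elim: D A psi psi' => [|g D IH] A psi psi' /=; [ring|rewrite !IH; ring].
Qed.

Lemma spec_lin_sample c s s' D A psi :
  spec (fun B => c * s B + s' B) D A psi = c * spec s D A psi + spec s' D A psi.
Proof.
by elim: D A psi => [|g D IH] A psi /=; [ring|rewrite !IH; ring].
Qed.

Lemma spec_cst s D A c : spec s D A (fun=> c) = c * s A.
Proof. by elim: D A => [|g D IH] A //=; rewrite !IH; ring. Qed.

Lemma spec0 D A psi : spec (fun=> 0) D A psi = 0.
Proof.
elim: D A psi => [|g D IH] A psi /=; first by rewrite mulr0.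
by rewrite !IH subrr addr0.
Qed.

(** A coordinate outside [C] integrates out: the three terms of the recursion at it telescope to
    one. *)
Lemma spec_filter s C D A psi :
  spec s D A (fun S => psi (seq.filter C S)) = spec s (seq.filter C D) A psi.
Proof.
elim: D A psi => [|g D IH] A psi //=.
case: ifP => gC /=; first by rewrite !IH (IH A (fun S => psi (g :: S)))
  (IH _ (fun S => psi (g :: S))).
by rewrite !IH; ring.
Qed.

(** This justifies reading [s] as an avoidance probability: nothing in the recursion is specific to
    one choice of [psi]. *)
Lemma spec_avoid s C D A : spec s D A (fun S => (~~ has C S)%:R) =
  s (fun x => A x || (x \in D) && C x).
Proof.
elim: D A => [|g D IH] A /=.
  by rewrite mul1r; congr s; apply/funext => x; rewrite orbF.
case: (boolP (C g)) => gC /=.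
  rewrite !spec_cst !mul0r subrr addr0 IH; congr s; apply/funext => x.
  rewrite /addp in_cons; case: eqVneq => [->|_] /=; last by [].
  by rewrite gC orbT.
rewrite !IH; rewrite addrC subrK; congr s; apply/funext => x.
by rewrite in_cons; case: eqVneq => [->|//]; rewrite (negbTE gC) !andbF.
Qed.

Lemma spec_ext s s' D A psi :
  (forall B, (forall x, B x -> A x || (x \in D)) -> s B = s' B) ->
  spec s D A psi = spec s' D A psi.
Proof.
elim: D A psi => [|g D IH] A psi ss' /=.
  by rewrite ss'// => x ->.
have h1 : forall psi, spec s D (addp g A) psi = spec s' D (addp g A) psi.
  move=> psi'; apply: IH => B hB; apply: ss' => x /hB.
  by rewrite /addp in_cons; case: (x == g); case: (A x).
have h2 : forall psi, spec s D A psi = spec s' D A psi.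
  move=> psi'; apply: IH => B hB; apply: ss' => x /hB.
  by rewrite in_cons; case: (A x) => //= ->; rewrite orbT.
by rewrite !h1 !h2.
Qed.

(** The factor 3 counts the recursive calls. A bound exponential in the size of [D] is harmless
    here, as it only serves to let [e] tend to 0 with [D] fixed. *)
Lemma spec_dist s s' D A psi e M : (forall B, `|s B - s' B| <= e) ->
  (forall S, `|psi S| <= M) ->
  `|spec s D A psi - spec s' D A psi| <= 3 ^+ size D * (M * e).
Proof.
move=> ss'; elim: D A psi => [|g D IH] A psi psiM /=.
  by rewrite expr0 mul1r -mulrBr normrM ler_pM.
set a := spec s D _ psi; set a' := spec s' D _ psi.
set b := spec s D A _; set b' := spec s' D A _.
set c := spec s D _ _; set c' := spec s' D _ _.
have h1 : `|a - a'| <= 3 ^+ size D * (M * e) by exact: IH.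
have h2 : `|b - b'| <= 3 ^+ size D * (M * e) by apply: IH => S; exact: psiM.
have h3 : `|c - c'| <= 3 ^+ size D * (M * e) by apply: IH => S; exact: psiM.
rewrite (_ : _ - _ = (a - a') + ((b - b') - (c - c'))); last by ring.
apply: (le_trans (ler_normD _ _)).
have := ler_normB (b - b') (c - c'); rewrite exprS; lra.
Qed.

Lemma spec_map (f : T -> T) s s' D A psi : injective f ->
  (forall B, s' B = s (B \o f)) ->
  spec s' (map f D) A psi = spec s D (A \o f) (psi \o map f).
Proof.
move=> fi ss'; elim: D A psi => [|g D IH] A psi /=; first by rewrite ss'.
have e : addp (f g) A \o f = addp g (A \o f).
  by apply/funext => x; rewrite /addp /= (inj_eq fi).
by rewrite !IH e.
Qed.

Definition symmetric psi : Prop := forall S S', perm_eq S S' -> psi S = psi S'.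

Lemma symmetric_cons psi g : symmetric psi -> symmetric (fun S => psi (g :: S)).
Proof. by move=> sp S S' SS'; apply: sp; rewrite perm_cons. Qed.

Lemma spec_swap s g D1 D2 A psi : symmetric psi ->
  spec s (D1 ++ g :: D2) A psi = spec s (g :: D1 ++ D2) A psi.
Proof.
elim: D1 A psi => [|h D1 IH] A psi sp //.
rewrite [LHS]/= !IH; [|exact: symmetric_cons|exact: symmetric_cons|by []].
have e B : addp g (addp h B) = addp h (addp g B).
  by apply/funext => x; rewrite /addp orbCA.
have es : (fun S => psi [:: g, h & S]) = (fun S => psi [:: h, g & S]).
  by apply/funext => S; apply: sp; rewrite (perm_catCA [:: g] [:: h]).
by rewrite /= !e es; ring.
Qed.

Lemma spec_perm s D D' A psi : symmetric psi -> perm_eq D D' ->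
  spec s D A psi = spec s D' A psi.
Proof.
elim: D D' A psi => [|g D IH] D' A psi sp.
  by rewrite perm_sym => /perm_nilP ->.
move=> DD'; have gD' : g \in D' by rewrite -(perm_mem DD') mem_head.
case/splitPr: gD' DD' => D1 D2 DD'.
rewrite spec_swap//.
have {}DD' : perm_eq D (D1 ++ D2).
  by move: DD'; rewrite (perm_sym (g :: D)) (perm_catCA D1 [:: g]) /= perm_cons perm_sym.
rewrite /= (IH (D1 ++ D2) _ psi)//.
by rewrite !(IH (D1 ++ D2) _ (fun S => psi (g :: S)))//; exact: symmetric_cons.
Qed.

(** * Samples given by commuting orthogonal projections *)

Section Hilbert.
Context {X : Type}.
Variables (V : (X -> R) -> Prop) (E : T -> (X -> R) -> X -> R) (N : (X -> R) -> R).
Hypothesis VB : forall h k, V h -> V k -> V (fun x => h x - k x).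
Hypothesis VE : forall g h, V h -> V (E g h).
Hypothesis EB : forall g h k, V h -> V k ->
  E g (fun x => h x - k x) = (fun x => E g h x - E g k x).
Hypothesis EC : forall g g' h, V h -> E g (E g' h) = E g' (E g h).
Hypothesis NE : forall g h, V h -> N (fun x => h x - E g h x) = N h - N (E g h).
Hypothesis N0 : forall h, V h -> 0 <= N h.

(* If [s A] is the squared norm of the projection [E_A h], splitting [h] into [E g h]
   and [h - E g h] for each [g] in [D] exhibits [spec] as a sum of squared norms. *)
Fixpoint spec_norm D psi (h : X -> R) : R :=
  if D is g :: D' then
    spec_norm D' psi (E g h) +
    spec_norm D' (fun S => psi (g :: S)) (fun x => h x - E g h x)
  else psi [::] * N h.

(** Pythagoras at each leaf of the recursion; since the projections commute, splitting along [g] can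
    be carried past all the coordinates of [D]. This turns the subtraction in [spec] into a squared
    norm. *)
Lemma spec_norm_sub g D psi h : V h ->
  spec_norm D psi (fun x => h x - E g h x) =
  spec_norm D psi h - spec_norm D psi (E g h).
Proof.
elim: D psi h => [|g' D IH] psi h Vh /=; first by rewrite NE//; ring.
have VEh := VE g Vh; have VEh' := VE g' Vh.
have e1 : E g' (fun x => h x - E g h x) = (fun x => E g' h x - E g (E g' h) x).
  by rewrite EB// (EC g' g).
rewrite e1 IH//.
rewrite (_ : (fun x => h x - E g h x - (E g' h x - E g (E g' h) x)) =
   (fun x => (fun x => h x - E g' h x) x - E g (fun x => h x - E g' h x) x)); last first.
  by rewrite EB//; apply/funext => x; ring.
rewrite IH ?EB//; last exact: VB.
by rewrite (EC g g')//; ring.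
Qed.

Lemma spec_norm_ge0 D psi h : V h -> (forall S, 0 <= psi S) ->
  0 <= spec_norm D psi h.
Proof.
elim: D psi h => [|g D IH] psi h Vh p0 /=; first by rewrite mulr_ge0// N0.
by rewrite addr_ge0// IH//; [exact: VE|apply: VB => //; exact: VE].
Qed.

Lemma spec_norm_le D psi M h : V h -> (forall S, psi S <= M) ->
  spec_norm D psi h <= M * N h.
Proof.
elim: D psi h => [|g D IH] psi h Vh pM /=; first by rewrite ler_wpM2r// N0.
rewrite [N h](_ : _ = N (E g h) + N (fun x => h x - E g h x)); last first.
  by rewrite NE// addrC subrK.
by rewrite mulrDr lerD// IH//; [exact: VE|apply: VB => //; exact: VE].
Qed.

Variable VD : forall h k, V h -> V k -> V (fun x => h x + k x).
Variable ED : forall g h k, V h -> V k ->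
  E g (fun x => h x + k x) = (fun x => E g h x + E g k x).
Variable ND : forall (e : R) h k, 0 < e -> V h -> V k ->
  N (fun x => h x + k x) <= (1 + e) * N h + (1 + e^-1) * N k.

(** Each component of the decomposition is linear in the function, so [ND] applies leaf by leaf. In
    contrast to [spec_dist], no constant depends on [D]. *)
Lemma spec_norm_add_le D psi (e : R) h k : 0 < e -> V h -> V k ->
  (forall S, 0 <= psi S) ->
  spec_norm D psi (fun x => h x + k x) <=
  (1 + e) * spec_norm D psi h + (1 + e^-1) * spec_norm D psi k.
Proof.
move=> e0; elim: D psi h k => [|g D IH] psi h k Vh Vk p0 /=.
  apply: (le_trans (ler_wpM2l (p0 _) (ND e0 Vh Vk))).
  by rewrite mulrDr !(mulrCA (psi _)).
rewrite ED//.
rewrite (_ : (fun x => h x + k x - _) =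
   (fun x => (h x - E g h x) + (k x - E g k x))); last first.
  by apply/funext => x; ring.
have h1 := IH psi _ _ (VE g Vh) (VE g Vk) p0.
have h2 := IH (fun S => psi (g :: S)) _ _ (VB Vh (VE g Vh)) (VB Vk (VE g Vk))
  (fun S => p0 _).
by apply: (le_trans (lerD h1 h2)); lra.
Qed.

Lemma spec_spec_norm (EA : pred T -> X -> R) D A psi :
  (forall A, V (EA A)) -> (forall g A, EA (addp g A) = E g (EA A)) ->
  spec (fun B => N (EA B)) D A psi = spec_norm D psi (EA A).
Proof.
move=> VEA EAg; elim: D A psi => [|g D IH] A psi //=.
by rewrite !IH EAg spec_norm_sub.
Qed.

End Hilbert.

End SpectralSample.

(** * Resampling coordinates *)

(** Rectangles are intersections of two strips, and the bases of the strips that are generated form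
    a sigma-algebra. The conditions on [setT] ensure that strips over generators are themselves
    generators. *)
Lemma prod_pi_system d d' (T : measurableType d) (T' : measurableType d')
    (G : set (set T)) (G' : set (set T')) :
  @measurable _ T = <<s G >> -> @measurable _ T' = <<s G' >> ->
  G setT -> G' setT ->
  @measurable _ (T * T')%type = <<s [set A `*` B | A in G & B in G'] >>.
Proof.
move=> GE GE' GT GT'; set H := [set A `*` B | A in G & B in G'].
have mH : H `<=` @measurable _ (T * T')%type.
  move=> _ [A GA [B GB <-]]; apply: measurableX.
    by rewrite GE; exact: sub_sigma_algebra.
  by rewrite GE'; exact: sub_sigma_algebra.
apply/seteqP; split; last first.
  by apply: smallest_sub => //; exact: sigma_algebra_measurable.
have [s0 sC sU] := smallest_sigma_algebra setT H.
have sAT A : measurable A -> <<s H >> (A `*` setT).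
  rewrite GE; suff /(_ A) : <<s G >> `<=` [set A | <<s H >> (A `*` setT)] by [].
  apply: smallest_sub.
    split=> /= [|B HB|F HF].
    - by rewrite set0X.
    - rewrite (_ : _ `*` _ = setT `\` (B `*` setT)); first exact: sC.
      by apply/seteqP; split=> -[x y] /=; tauto.
    - rewrite (_ : _ `*` _ = \bigcup_k (F k `*` setT)); first exact: sU.
      apply/seteqP; split=> -[x y] /=; first by move=> [[k _ Fx] _]; exists k.
      by move=> [k _ [Fx _]]; split=> //; exists k.
  by move=> B GB; apply: sub_sigma_algebra; exists B => //; exists setT.
have sTB B : measurable B -> <<s H >> (setT `*` B).
  rewrite GE'; suff /(_ B) : <<s G' >> `<=` [set B | <<s H >> (setT `*` B)] by [].
  apply: smallest_sub.
    split=> /= [|A HB|F HF].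
    - by rewrite setX0.
    - rewrite (_ : _ `*` _ = setT `\` (setT `*` A)); first exact: sC.
      by apply/seteqP; split=> -[x y] /=; tauto.
    - rewrite (_ : _ `*` _ = \bigcup_k (setT `*` F k)); first exact: sU.
      apply/seteqP; split=> -[x y] /=; first by move=> [_ [k _ Fx]]; exists k.
      by move=> [k _ [_ Fx]]; split=> //; exists k.
  by move=> A GA; apply: sub_sigma_algebra; exists setT => //; exists A.
rewrite measurable_prod_measurableType.
apply: smallest_sub; first exact: smallest_sigma_algebra.
move=> _ [A mA [B mB <-]].
rewrite (_ : A `*` B = (A `*` setT) `&` (setT `*` B)); last first.
  by apply/seteqP; split=> -[x y] /=; tauto.
have := sAT _ mA; have := sTB _ mB.
move=> hB hA; exact: (@measurableI _ (g_sigma_algebraType H)).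
Qed.

Section PowerSpace.
Context {R : realType} {d0 : measure_display} {X0 : measurableType d0}.
Context {I : choiceType}.
Let X := power_space X0 I.

Lemma measurable_coord (i : I) (A : set X0) : measurable A ->
  measurable ([set x | A (x i)] : set X).
Proof. by move=> mA; apply: sub_sigma_algebra; exists i, A. Qed.

Lemma measurable_power d (T : measurableType d) (f : T -> X) :
  (forall i (A : set X0), measurable A -> measurable [set t | A (f t i)]) ->
  measurable_fun setT f.
Proof.
move=> h; apply: (@measurability _ _ _ _ setT f (@coordinate_sets _ X0 I)) => //.
by move=> _ [_ [i [A [mA ->]]] <-]; rewrite setTI; exact: h.
Qed.

Definition cylinder (F : {fset I}) (A : I -> set X0) : set X :=
  [set x : X | forall i, i \in F -> A i (x i)].

Definition cylinders : set (set X) :=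
  [set C | exists F A, (forall i, measurable (A i)) /\ C = cylinder F A].

Lemma cylinder_widen (F F' : {fset I}) (A : I -> set X0) : (F `<=` F')%fset ->
  cylinder F A = cylinder F' (fun i => if i \in F then A i else setT).
Proof.
move=> FF'; apply/seteqP; split=> x h i /=; rewrite -/(is_true _).
  by case: ifPn => // iF _; exact: h.
by move=> iF; have := h i (fsubsetP FF' _ iF); rewrite /= iF.
Qed.

Lemma measurable_cylinder F A : (forall i, measurable (A i)) ->
  measurable (cylinder F A).
Proof.
move=> mA; rewrite (_ : cylinder F A = \bigcap_(i in [set` F]) [set x : X | A i (x i)]).
  apply: fin_bigcap_measurable; first exact: finite_fset.
  by move=> i _; exact: measurable_coord.
by apply/seteqP; split=> x h i /h.
Qed.

Lemma cylinders_setT : cylinders setT.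
Proof.
exists fset0, (fun=> setT); split=> //.
by apply/seteqP; split=> x.
Qed.

Lemma cylinders_setI : setI_closed cylinders.
Proof.
move=> _ _ [F [A [mA ->]]] [F' [A' [mA' ->]]].
rewrite (@cylinder_widen F (F `|` F')%fset) ?fsubsetUl//.
rewrite (@cylinder_widen F' (F `|` F')%fset) ?fsubsetUr//.
exists (F `|` F')%fset, (fun i => (if i \in F then A i else setT) `&`
   (if i \in F' then A' i else setT)); split.
  by move=> i; apply: measurableI; case: ifP.
apply/seteqP; split=> x.
  by move=> [h h'] i iF; split; [exact: h|exact: h'].
by move=> h; split=> i iF; have [] := h i iF.
Qed.

Lemma cylinders_generate : @measurable _ X = <<s cylinders >>.
Proof.
apply/seteqP; split.
  apply: smallest_sub; first exact: smallest_sigma_algebra.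
  move=> _ [i [A [mA ->]]]; apply: sub_sigma_algebra.
  exists [fset i]%fset, (fun=> A); split=> //.
  apply/seteqP; split=> x /=.
    by move=> h j; rewrite inE => /eqP ->.
  by apply; rewrite inE.
apply: smallest_sub; first exact: sigma_algebra_measurable.
by move=> _ [F [A [mA ->]]]; exact: measurable_cylinder.
Qed.

Variables (mu0 : probability X0 R) (mu : probability X R).
Hypothesis mu_power : is_power_measure mu0 mu.

Let X2 := (X * X)%type.
Let mu2 := product_prob mu mu.

Definition resample (A : pred I) (x y : X) : X :=
  fun i => if A i then y i else x i.

Lemma measurable_resample d (T : measurableType d) (A : pred I) (f g : T -> X) :
  measurable_fun setT f -> measurable_fun setT g ->
  measurable_fun setT (fun t => resample A (f t) (g t)).
Proof.
move=> mf mg; apply: measurable_power => i B mB; rewrite /resample.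
case: (A i); first exact: (measurable_preimage mg (measurable_coord i mB)).
exact: (measurable_preimage mf (measurable_coord i mB)).
Qed.

(** Resampling is the first component of this involution. Exchanging coordinates between two
    independent copies preserves the product measure, and invariance under it yields the
    self-adjointness of conditional expectations. *)
Definition swap (A : pred I) (z : X2) : X2 :=
  (resample A z.1 z.2, resample A z.2 z.1).

Lemma measurable_swap A : measurable_fun setT (swap A).
Proof. by apply: measurable_fun_pair; exact: measurable_resample. Qed.

Lemma swapK A : involutive (swap A).
Proof.
case=> x y; rewrite /swap /=; congr pair; apply/funext => i;
  rewrite /resample; by case: (A i).
Qed.

Lemma mp_swap A : measure_preserving mu2 mu2 (swap A).
Proof.
apply: (@mp_pi_system _ _ _ _ _ _ _ [set B `*` C | B in cylinders & C in cylinders]).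
- apply: prod_pi_system; [exact: cylinders_generate|exact: cylinders_generate|
    exact: cylinders_setT|exact: cylinders_setT].
- move=> _ _ [B cB [C cC <-]] [B' cB' [C' cC' <-]].
  exists (B `&` B'); first exact: cylinders_setI.
  by exists (C `&` C'); [exact: cylinders_setI|rewrite setXI].
- exact: measurable_swap.
move=> _ [_ [F [B [mB ->]]] [_ [F' [C [mC ->]]] <-]].
rewrite (@cylinder_widen F (F `|` F')%fset) ?fsubsetUl//.
rewrite (@cylinder_widen F' (F `|` F')%fset) ?fsubsetUr//.
set K := (F `|` F')%fset.
pose B' i := if i \in F then B i else setT; pose C' i := if i \in F' then C i else setT.
have mB' i : measurable (B' i) by rewrite /B'; case: ifP.
have mC' i : measurable (C' i) by rewrite /C'; case: ifP.
pose B2 i := if A i then C' i else B' i; pose C2 i := if A i then B' i else C' i.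
have mB2 i : measurable (B2 i) by rewrite /B2; case: ifP.
have mC2 i : measurable (C2 i) by rewrite /C2; case: ifP.
rewrite -/B' -/C'.
rewrite (_ : swap A @^-1` _ = cylinder K B2 `*` cylinder K C2); last first.
  apply/seteqP; split=> -[x y] /=; rewrite /swap /resample /cylinder /B2 /C2 /=.
    by move=> [h1 h2]; split=> i iK; have := h1 i iK; have := h2 i iK; case: (A i).
  by move=> [h1 h2]; split=> i iK; have := h1 i iK; have := h2 i iK; case: (A i).
rewrite !product_probE; try exact: measurable_cylinder.
rewrite !mu_power//.
rewrite -!big_split /=; apply: eq_bigr => i _; rewrite /B2 /C2.
by case: (A i) => //; rewrite muleC.
Qed.

Lemma mp_resample A : measure_preserving mu2 mu (fun z => resample A z.1 z.2).
Proof.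
have [ms sP] := mp_swap A; split; first exact: measurable_resample.
move=> B mB.
rewrite (_ : _ @^-1` B = swap A @^-1` (B `*` setT)); last first.
  by apply/seteqP; split=> z //= [].
rewrite sP; last exact: measurableX.
by rewrite product_probE// probability_setT mule1.
Qed.

Section ConditionalExpectation.
Implicit Types (A B : pred I) (f g : X -> R).

(** The conditional expectation given the coordinates outside [A]. Integrating over an independent
    copy defines it at every point, so its algebraic identities are equalities of functions. *)
Definition cond_expect A f : X -> R := fun x => expect mu (fun y => f (resample A x y)).

Lemma bm_resample A f : bounded_measurable f ->
  bounded_measurable (fun z : X2 => f (resample A z.1 z.2)).
Proof. by move=> bf; apply: bm_comp => //; exact: (mp_resample A).1. Qed.

Lemma bm_resample1 A f x : bounded_measurable f ->
  bounded_measurable (fun y => f (resample A x y)).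
Proof.
move=> bf; apply: bm_comp => //.
by apply: (@measurable_resample _ _ A (cst x) id) => //; exact: measurable_cst.
Qed.

Lemma bm_cond_expect A f : bounded_measurable f ->
  bounded_measurable (cond_expect A f).
Proof. by move=> bf; exact: (bm_expect mu mu (bm_resample A bf)). Qed.

Lemma cond_expectB A f g : bounded_measurable f -> bounded_measurable g ->
  cond_expect A (fun x => f x - g x) =
  (fun x => cond_expect A f x - cond_expect A g x).
Proof.
by move=> bf bg; apply/funext => x; rewrite /cond_expect expectB//; exact: bm_resample1.
Qed.

Lemma cond_expectD A f g : bounded_measurable f -> bounded_measurable g ->
  cond_expect A (fun x => f x + g x) =
  (fun x => cond_expect A f x + cond_expect A g x).
Proof.
by move=> bf bg; apply/funext => x; rewrite /cond_expect expectD//; exact: bm_resample1.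
Qed.

(** The independent copies used for [A] and for [B] merge into a single one by [mp_resample]. *)
Lemma cond_expect_comp A B f : bounded_measurable f ->
  cond_expect A (cond_expect B f) = cond_expect (fun i => A i || B i) f.
Proof.
move=> bf; apply/funext => x; rewrite /cond_expect.
have bF : bounded_measurable (fun y => f (resample (fun i => A i || B i) x y)).
  exact: bm_resample1.
rewrite -(mp_expect (mp_resample B) bF).
rewrite expect_product; last exact: bm_comp (mp_resample B).1 bF.
congr expect; apply/funext => y /=; congr expect; apply/funext => z; congr f.
by apply/funext => i; rewrite /resample; case: (A i); case: (B i).
Qed.

Lemma cond_expect_selfadjoint A f g : bounded_measurable f ->
  bounded_measurable g ->
  expect mu (fun x => cond_expect A f x * g x) =
  expect mu (fun x => f x * cond_expect A g x).
Proof.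
move=> bf bg.
have b1 : bounded_measurable (fun z : X2 => g z.1).
  by apply: (bm_comp (h := fst)) => //; exact: measurable_fst.
have b1' : bounded_measurable (fun z : X2 => f z.1).
  by apply: (bm_comp (h := fst)) => //; exact: measurable_fst.
transitivity (expect mu2 (fun z => f (resample A z.1 z.2) * g z.1)).
  rewrite expect_product; last by apply: bm_mul => //; exact: bm_resample.
  congr expect; apply/funext => x /=; rewrite mulrC -expectZ; last exact: bm_resample1.
  by congr expect; apply/funext => y; rewrite mulrC.
transitivity (expect mu2 (fun z => f z.1 * g (resample A z.1 z.2))).
  have bF : bounded_measurable (fun z => f z.1 * g (resample A z.1 z.2)).
    by apply: bm_mul => //; exact: bm_resample.
  rewrite -(mp_expect (mp_swap A) bF); congr expect; apply/funext => z /=.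
  by have := congr1 fst (swapK A z) => /= ->.
rewrite expect_product; last by apply: bm_mul => //; exact: bm_resample.
by congr expect; apply/funext => x /=; rewrite expectZ//; exact: bm_resample1.
Qed.

Definition norm2 f : R := expect mu (fun x => f x * f x).

Lemma norm2_cond_expect A f : bounded_measurable f ->
  norm2 (cond_expect A f) = expect mu (fun x => f x * cond_expect A f x).
Proof.
move=> bf; rewrite /norm2 cond_expect_selfadjoint//; last exact: bm_cond_expect.
congr expect; apply/funext => x; congr (_ * _); rewrite cond_expect_comp//.
by rewrite (_ : (fun i => A i || A i) = A)//; apply/funext => i; rewrite orbb.
Qed.

Lemma norm2_sub_cond_expect A f : bounded_measurable f ->
  norm2 (fun x => f x - cond_expect A f x) = norm2 f - norm2 (cond_expect A f).
Proof.
move=> bf; have bE := bm_cond_expect A bf.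
have bfE := bm_mul bf bE; have bEE := bm_mul bE bE; have bff := bm_mul bf bf.
have e := norm2_cond_expect A bf.
rewrite [LHS](_ : _ = expect mu (fun x => (f x * f x - f x * cond_expect A f x) -
  (f x * cond_expect A f x - cond_expect A f x * cond_expect A f x))); last first.
  by congr expect; apply/funext => x; ring.
rewrite !expectB//; [|exact: bm_sub..].
by rewrite -e -/(norm2 (cond_expect A f)) -/(norm2 f); ring.
Qed.

Lemma norm2_ge0 f : 0 <= norm2 f.
Proof. by apply: expect_ge0 => x; rewrite -expr2 sqr_ge0. Qed.

Lemma norm2D (e : R) f g : 0 < e -> bounded_measurable f -> bounded_measurable g ->
  norm2 (fun x => f x + g x) <= (1 + e) * norm2 f + (1 + e^-1) * norm2 g.
Proof.
move=> e0 bf bg; have bff := bm_mul bf bf; have bgg := bm_mul bg bg.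
rewrite /norm2 -expectZ// -[in leRHS]expectZ// -expectD; last 2 first.
- by apply: bm_mul => //; exact: bm_cst.
- by apply: bm_mul => //; exact: bm_cst.
apply: expect_le.
- by apply: bm_mul; exact: bm_add.
- by apply: bm_add; apply: bm_mul => //; exact: bm_cst.
move=> x; rewrite -subr_ge0.
rewrite (_ : _ - _ = e^-1 * (e * f x - g x) ^+ 2); last by field; rewrite gt_eqF.
by rewrite mulr_ge0 ?sqr_ge0// invr_ge0 ltW.
Qed.

End ConditionalExpectation.

End PowerSpace.

(** * Functions with values in a countable set *)

Section DiscreteValued.
Context {d : measure_display} {T : measurableType d}.

Lemma measurable_prop (A : Prop) : measurable ([set _ | A] : set T).
Proof.
have [a|na] := pselect A.
  by rewrite (_ : [set _ | _] = setT)//; apply/seteqP; split.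
by rewrite (_ : [set _ | _] = set0)//; apply/seteqP; split.
Qed.

(** Measurability for the discrete structure, stated on fibres so that a countable group need not be
    equipped with a sigma-algebra. *)
Definition dmeasurable (L : Type) (w : T -> L) : Prop :=
  forall l, measurable (w @^-1` [set l]).

Section Combine.
Context {L L' L'' : choiceType}.
Hypotheses (cL : countable [set: L]) (cL' : countable [set: L']).

Lemma dmeasurable_set (w : T -> L) (A : set L) : dmeasurable w ->
  measurable (w @^-1` A).
Proof.
move=> mw; rewrite (_ : w @^-1` A = \bigcup_l ((w @^-1` [set l]) `&` [set _ | A l])).
  apply: countable_bigcupT_measurable => // l; apply: measurableI => //.
  exact: measurable_prop.
by apply/seteqP; split=> [x Ax|x [l _ [<-]]//]; exists (w x).
Qed.

Lemma dmeasurable2 (w : T -> L) (v : T -> L') (A : set (L * L')) :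
  dmeasurable w -> dmeasurable v -> measurable [set x | A (w x, v x)].
Proof.
move=> mw mv; rewrite (_ : [set x | _] =
  \bigcup_l ((w @^-1` [set l]) `&` (v @^-1` [set l' | A (l, l')]))).
  apply: countable_bigcupT_measurable => // l; apply: measurableI => //.
  rewrite (_ : v @^-1` _ = \bigcup_l' ((v @^-1` [set l']) `&` [set _ | A (l, l')])).
    apply: countable_bigcupT_measurable => // l'; apply: measurableI => //.
    exact: measurable_prop.
  by apply/seteqP; split=> [x Ax|x [l' _ [<-]]//]; exists (v x).
by apply/seteqP; split=> [x Ax|x [l _ [<-]]//]; exists (w x).
Qed.

Lemma dmeasurable_op2 (op : L -> L' -> L'') (w : T -> L) (v : T -> L') :
  dmeasurable w -> dmeasurable v -> dmeasurable (fun x => op (w x) (v x)).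
Proof.
move=> mw mv l.
exact: (@dmeasurable2 w v [set p | op p.1 p.2 = l]).
Qed.

End Combine.

Lemma measurable_eq_dmeasurable (L : choiceType) (w v : T -> L) :
  countable [set: L] -> dmeasurable w -> dmeasurable v ->
  measurable [set x | w x = v x].
Proof.
by move=> cL mw mv; exact: (@dmeasurable2 L L cL cL w v [set p | p.1 = p.2]).
Qed.

Lemma measurable_neq_dmeasurable (L : choiceType) (w v : T -> L) :
  countable [set: L] -> dmeasurable w -> dmeasurable v ->
  measurable [set x | w x <> v x].
Proof.
by move=> cL mw mv; exact: (@dmeasurable2 L L cL cL w v [set p | p.1 <> p.2]).
Qed.

End DiscreteValued.

Lemma dmeasurable_comp d d' (T : measurableType d) (T' : measurableType d')
    (L : Type) (w : T' -> L) (h : T -> T') :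
  dmeasurable w -> measurable_fun setT h -> dmeasurable (w \o h).
Proof. by move=> mw mh l; exact: (measurable_preimage mh (mw l)). Qed.

Section FiniteRange.
Context {R : realType} d (T : measurableType d) (P : probability T R).
Context {L : choiceType}.

Lemma dmeasurable_finite_range (E : nat -> seq L) (w : T -> L) (e : R) :
  countable [set: L] -> exhaustion E -> dmeasurable w -> 0 < e ->
  exists N, forall n, (N <= n)%N -> pr P [set x | w x \notin E n] <= e.
Proof.
move=> cL EP mw e0.
have mF n : measurable [set x | w x \in E n] by exact: (dmeasurable_set cL [set l | l \in E n]).
have [N hN] := pr_bigcup_approx P mF e0; exists N => n Nn.
apply: le_trans hN; apply: pr_le.
- exact: (dmeasurable_set cL [set l | l \notin E n]).
- by apply: measurableD; [exact: bigcupT_measurable|exact: bigsetU_measurable].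
move=> x /= wx; split.
  by have [m wm] := exhaustion_cover EP (w x); exists m.
have -> : \big[setU/set0]_(k < N) [set x | w x \in E k] =
    \bigcup_(k < N) [set x | w x \in E k] by rewrite bigcup_mkord.
move=> [k /= kN wk]; move: wx; apply/negP; rewrite negbK.
exact: (exhaustion_mono EP (leq_trans (ltnW kN) Nn)).
Qed.

End FiniteRange.

Lemma le_of_dist (R : realFieldType) (a a' b b' r : R) : `|a - a'| <= r / 2 ->
  `|b - b'| <= r / 2 -> b' <= a' -> b <= a + r.
Proof. by rewrite !ler_distl => /andP[h1 h2] /andP[h3 h4] h5; lra. Qed.

(** * Agreement under resampling and the spectral sample of a discrete function *)

Section Agreement.
Context {R : realType} {d0 : measure_display} {X0 : measurableType d0}.
Context {I : choiceType}.
Let X := power_space X0 I.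
Variables (mu0 : probability X0 R) (mu : probability X R).
Hypothesis mu_power : is_power_measure mu0 mu.
Let X2 := (X * X)%type.
Let mu2 := product_prob mu mu.
Context {L : choiceType}.
Hypothesis cL : countable [set: L].
Implicit Types (A B C : pred I) (w v : X -> L).

Lemma dmeasurable_resample A w : dmeasurable w ->
  dmeasurable (fun z : X2 => w (resample A z.1 z.2)).
Proof.
by move=> mw; apply: (dmeasurable_comp mw); exact: (mp_resample mu_power A).1.
Qed.

Lemma dmeasurable_fst w : dmeasurable w -> dmeasurable (fun z : X2 => w z.1).
Proof. by move=> mw; apply: (dmeasurable_comp mw); exact: measurable_fst. Qed.

(** This is the avoidance function fed to [spec]. With it, the sample of [w] restricted to a finite
    [D] meets a subset of [D] with probability equal to the influence [disagree] of that subset. *)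
Definition agree w A : R := pr mu2 [set z | w (resample A z.1 z.2) = w z.1].

Definition disagree w A : R := pr mu2 [set z | w (resample A z.1 z.2) <> w z.1].

Lemma measurable_agree w A : dmeasurable w ->
  measurable [set z : X2 | w (resample A z.1 z.2) = w z.1].
Proof.
by move=> mw; apply: measurable_eq_dmeasurable => //;
  [exact: dmeasurable_resample|exact: dmeasurable_fst].
Qed.

Lemma measurable_disagree w A : dmeasurable w ->
  measurable [set z : X2 | w (resample A z.1 z.2) <> w z.1].
Proof. by move=> mw; exact: measurableC (measurable_agree A mw). Qed.

Lemma disagreeE w A : dmeasurable w -> disagree w A = 1 - agree w A.
Proof. by move=> mw; rewrite -prC//; exact: measurable_agree. Qed.

Lemma disagree_ge0 w A : 0 <= disagree w A. Proof. exact: pr_ge0. Qed.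

Lemma disagree_le1 w A : dmeasurable w -> disagree w A <= 1.
Proof. by move=> mw; apply: pr_le1; exact: measurable_disagree. Qed.

Lemma agree0 w : agree w pred0 = 1.
Proof.
rewrite /agree (_ : [set z | _] = setT) ?prT//.
by apply/seteqP; split=> // -[x y] _.
Qed.

Definition level w (l : L) : X -> R := \1_(w @^-1` [set l]).

Lemma bm_level w l : dmeasurable w -> bounded_measurable (level w l).
Proof. by move=> mw; exact: bm_indic. Qed.

Lemma norm2_level w l A : dmeasurable w ->
  norm2 mu (cond_expect mu A (level w l)) =
  pr mu2 [set z | w (resample A z.1 z.2) = l /\ w z.1 = l].
Proof.
move=> mw; rewrite (norm2_cond_expect mu_power)//; last exact: bm_level.
have mS : measurable [set z : X2 | w (resample A z.1 z.2) = l /\ w z.1 = l].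
  by apply: measurableI; [exact: (dmeasurable_resample A mw)|exact: (dmeasurable_fst mw)].
rewrite -expect_indic// expect_product; last exact: bm_indic.
congr expect; apply/funext => x; rewrite /cond_expect -expectZ; last first.
  by apply: bm_resample1; exact: bm_level.
congr expect; apply/funext => y; rewrite /level !indicE -natrM mulnb andbC.
congr (_%:R); congr nat_of_bool; apply/andP/idP; rewrite !inE /=.
  by move=> [].
by move=> [].
Qed.

(** Truncation to finitely many values. The orthogonal decomposition concerns one real function at a
    time, so [w] is replaced by the indicators of its levels; a finite list of levels avoids
    series. *)
Definition agree_on (ls : seq L) w A : R :=
  \sum_(l <- ls) norm2 mu (cond_expect mu A (level w l)).

Lemma agree_on_dist ls w A : uniq ls -> dmeasurable w ->
  `|agree w A - agree_on ls w A| <= pr mu [set x | w x \notin ls].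
Proof.
move=> uls mw.
pose S l := [set z : X2 | w (resample A z.1 z.2) = l /\ w z.1 = l].
have mS l : measurable (S l).
  by apply: measurableI; [exact: (dmeasurable_resample A mw)|exact: (dmeasurable_fst mw)].
have e : agree_on ls w A = pr mu2 (\big[setU/set0]_(l <- ls) S l).
  rewrite /agree_on; elim: ls uls => [|l ls IH] /=.
    by rewrite !big_nil pr0.
  move=> /andP[lls uls]; rewrite !big_cons IH// norm2_level// prU//.
    by apply: bigsetU_measurable.
  apply/seteqP; split=> // z [] [_ /= zl].
  rewrite -bigcup_seq => -[l' /= l'ls [_ zl']].
  by move: lls; rewrite -zl zl' l'ls.
have mU : measurable (\big[setU/set0]_(l <- ls) S l) by apply: bigsetU_measurable.
have mA := measurable_agree A mw.
have sub : \big[setU/set0]_(l <- ls) S l `<=` [set z | w (resample A z.1 z.2) = w z.1].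
  by move=> z; rewrite -bigcup_seq => -[l _ [/= -> ->]].
rewrite e /agree (prDI mu2 mA mU) (setIidr sub) addrK ger0_norm ?pr_ge0//.
have mN : measurable [set x | w x \notin ls].
  exact: (dmeasurable_set cL [set l | l \notin ls]).
have := pr_rect mu mu mN measurableT; rewrite prT mulr1 => <-.
apply: pr_le; [exact: measurableD|exact: measurableX|].
move=> z /= [zA zN]; split=> //; apply/negP => zls; apply: zN.
by rewrite -bigcup_seq; exists (w z.1).
Qed.

Definition spec_on ls w D (psi : seq I -> R) : R :=
  \sum_(l <- ls) spec_norm (fun i => cond_expect mu (pred1 i)) (norm2 mu) D psi
     (level w l).

Let VB := @bm_sub R _ X.
Let VD := @bm_add R _ X.
Let VE := fun i : I => @bm_cond_expect R d0 X0 I mu0 mu mu_power (pred1 i).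

Let EB i h k : bounded_measurable h -> bounded_measurable k ->
  cond_expect mu (pred1 i) (fun x => h x - k x) =
  (fun x => cond_expect mu (pred1 i) h x - cond_expect mu (pred1 i) k x).
Proof. exact: cond_expectB. Qed.

Let ED i h k : bounded_measurable h -> bounded_measurable k ->
  cond_expect mu (pred1 i) (fun x => h x + k x) =
  (fun x => cond_expect mu (pred1 i) h x + cond_expect mu (pred1 i) k x).
Proof. exact: cond_expectD. Qed.

Let NE i h : bounded_measurable h ->
  norm2 mu (fun x => h x - cond_expect mu (pred1 i) h x) =
  norm2 mu h - norm2 mu (cond_expect mu (pred1 i) h).
Proof. exact: (norm2_sub_cond_expect mu_power). Qed.

Let ND (e : R) h k : 0 < e -> bounded_measurable h -> bounded_measurable k ->
  norm2 mu (fun x => h x + k x) <= (1 + e) * norm2 mu h + (1 + e^-1) * norm2 mu k.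
Proof. exact: norm2D. Qed.

Let EC i j h : bounded_measurable h ->
  cond_expect mu (pred1 i) (cond_expect mu (pred1 j) h) =
  cond_expect mu (pred1 j) (cond_expect mu (pred1 i) h).
Proof.
move=> bh; rewrite !(cond_expect_comp mu_power)//.
by congr (cond_expect mu _ h); apply/funext => k; rewrite orbC.
Qed.

Lemma spec_agree_on ls w D psi : dmeasurable w ->
  spec (agree_on ls w) D pred0 psi = spec_on ls w D psi.
Proof.
move=> mw; rewrite /agree_on /spec_on; elim: ls => [|l ls IH].
  rewrite (_ : (fun A => _) = (fun=> 0)); last first.
    by apply/funext => A; rewrite big_nil.
  by rewrite big_nil spec0.
rewrite big_cons -IH.
have bl := bm_level l mw.
have e0 : cond_expect mu pred0 (level w l) = level w l.
  by apply/funext => x; exact: (expect_cst mu (level w l x)).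
have := spec_spec_norm VB VE EB EC NE
  (EA := fun A => cond_expect mu A (level w l)) D pred0 psi.
rewrite e0 => <-; last 2 first.
- by move=> A; exact: (bm_cond_expect mu_power).
- by move=> i A; rewrite (cond_expect_comp mu_power).
rewrite -[X in _ = X + _]mul1r -spec_lin_sample; congr spec.
by apply/funext => A; rewrite big_cons mul1r.
Qed.

Lemma spec_agree_dist ls w D psi M : uniq ls -> dmeasurable w ->
  (forall S, `|psi S| <= M) ->
  `|spec (agree w) D pred0 psi - spec_on ls w D psi| <=
  3 ^+ size D * (M * pr mu [set x | w x \notin ls]).
Proof.
move=> uls mw pM; rewrite -spec_agree_on//; apply: spec_dist => // B.
exact: agree_on_dist.
Qed.

Lemma sum_norm2_level ls w : uniq ls -> dmeasurable w ->
  \sum_(l <- ls) norm2 mu (level w l) <= 1.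
Proof.
move=> uls mw; rewrite (_ : \sum_(l <- ls) _ = agree_on ls w pred0).
  rewrite /agree_on; under eq_bigr do rewrite norm2_level//.
  have mS l : measurable [set z : X2 | w (resample pred0 z.1 z.2) = l /\ w z.1 = l].
    by apply: measurableI; [exact: (dmeasurable_resample pred0 mw)|exact: (dmeasurable_fst mw)].
  suff -> : \sum_(l <- ls) pr mu2 [set z : X2 | w (resample pred0 z.1 z.2) = l /\ w z.1 = l] =
     pr mu2 (\big[setU/set0]_(l <- ls) [set z : X2 | w (resample pred0 z.1 z.2) = l /\ w z.1 = l]).
    by apply: pr_le1; apply: bigsetU_measurable.
  elim: ls uls => [|l ls IH] /=; first by rewrite !big_nil pr0.
  move=> /andP[lls uls]; rewrite !big_cons IH// prU//.
    by apply: bigsetU_measurable.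
  apply/seteqP; split=> // z [] [_ /= zl].
  rewrite -bigcup_seq => -[l' /= l'ls [_ zl']].
  by move: lls; rewrite -zl zl' l'ls.
apply: eq_bigr => l _; congr norm2.
by apply/funext => x; apply/esym; exact: (expect_cst mu (level w l x)).
Qed.

Lemma spec_on_ge0 ls w D psi : dmeasurable w -> (forall S, 0 <= psi S) ->
  0 <= spec_on ls w D psi.
Proof.
move=> mw p0; apply: sumr_ge0 => l _.
apply: (spec_norm_ge0 VB VE) => //; last exact: bm_level.
by move=> h _; exact: norm2_ge0.
Qed.

Lemma spec_on_le ls w D psi M : uniq ls -> dmeasurable w -> 0 <= M ->
  (forall S, psi S <= M) -> spec_on ls w D psi <= M.
Proof.
move=> uls mw M0 pM.
apply: (@le_trans _ _ (M * \sum_(l <- ls) norm2 mu (level w l))).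
  rewrite mulr_sumr; apply: ler_sum => l _.
  apply: (spec_norm_le VB VE NE) => //; last exact: bm_level.
  by move=> h _; exact: norm2_ge0.
by rewrite ler_piMr// sum_norm2_level.
Qed.

(** Where [w] and [v] differ, at most two indicators of levels differ, whence the factor 2. *)
Lemma sum_norm2_level_sub ls w v : uniq ls -> dmeasurable w -> dmeasurable v ->
  \sum_(l <- ls) norm2 mu (fun x => level w l x - level v l x) <=
  2 * pr mu [set x | w x <> v x].
Proof.
move=> uls mw mv.
have mN : measurable [set x | w x <> v x] by exact: measurable_neq_dmeasurable.
have bN : bounded_measurable (\1_[set x | w x <> v x] : X -> R) by exact: bm_indic.
have bl l := bm_level l mw; have bk l := bm_level l mv.
have bs l : bounded_measurable (fun x => (level w l x - level v l x) *
  (level w l x - level v l x)) by apply: bm_mul; exact: bm_sub.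
have bS s : bounded_measurable (fun x => \sum_(l <- s) (level w l x - level v l x) *
  (level w l x - level v l x)).
  elim: s => [|l s IH].
    under [X in bounded_measurable X]eq_fun do rewrite big_nil.
    exact: bm_cst.
  under [X in bounded_measurable X]eq_fun do rewrite big_cons.
  exact: bm_add.
rewrite -expect_indic// -expectZ//.
rewrite (_ : \sum_(l <- ls) _ = expect mu (fun x => \sum_(l <- ls)
  (level w l x - level v l x) * (level w l x - level v l x))); last first.
  elim: ls {uls} => [|l ls IH].
    rewrite big_nil -[LHS](expect_cst mu); congr expect.
    by apply/funext => x; rewrite big_nil.
  rewrite big_cons IH -expectD//; congr expect.
  by apply/funext => x; rewrite big_cons.
apply: expect_le => //; first by apply: bm_mul => //; exact: bm_cst.
move=> x.
have lE (u : X -> L) l : level u l x = (u x == l)%:R.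
  rewrite /level indicE; congr (_%:R); congr nat_of_bool.
  by apply/idP/eqP; rewrite inE.
under eq_bigr do rewrite !lE.
have [wv|wv] := pselect (w x = v x).
  rewrite wv big1; last by move=> l _; rewrite subrr mulr0.
  by rewrite mulr_ge0// indicE ler0n.
rewrite indicE mem_set//= mulr1.
have h1 (l0 : L) : \sum_(l <- ls) (l0 == l)%:R <= 1 :> R.
  elim: ls uls {bS} => [|l ls IH] /=; first by rewrite big_nil.
  move=> /andP[lls uls]; rewrite big_cons; case: eqVneq => [->|_] /=.
    rewrite big_seq big1 ?addr0// => l' l'ls.
    by case: eqVneq => // e; move: lls; rewrite e l'ls.
  by rewrite add0r IH.
apply: (@le_trans _ _ (\sum_(l <- ls) ((w x == l)%:R + (v x == l)%:R))).
  apply: ler_sum => l _; case: (w x == l); case: (v x == l) => /=; lra.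
rewrite big_split /=; have := h1 (w x); have := h1 (v x); lra.
Qed.

Lemma spec_on_close ls w v D psi (M e : R) : uniq ls -> dmeasurable w ->
  dmeasurable v -> 0 < e -> (forall S, 0 <= psi S <= M) ->
  spec_on ls w D psi <= spec_on ls v D psi + e * M +
    (1 + e^-1) * (M * (2 * pr mu [set x | w x <> v x])).
Proof.
move=> uls mw mv e0 pM.
have M0 : 0 <= M by have /andP[] := pM [::]; exact: le_trans.
have p0 S : 0 <= psi S by have /andP[] := pM S.
have pM' S : psi S <= M by have /andP[] := pM S.
apply: (@le_trans _ _ ((1 + e) * spec_on ls v D psi + (1 + e^-1) *
   \sum_(l <- ls) spec_norm (fun i => cond_expect mu (pred1 i)) (norm2 mu) D psi
     (fun x => level w l x - level v l x))).
  rewrite /spec_on !mulr_sumr -big_split; apply: ler_sum => l _ /=.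
  have := spec_norm_add_le VB VE ED ND D e0 (bm_level l mv)
    (bm_sub (bm_level l mw) (bm_level l mv)) p0.
  congr (_ <= _); congr spec_norm; apply/funext => x /=; ring.
have h1 := spec_on_le D uls mv M0 pM'.
have h2 : \sum_(l <- ls) spec_norm (fun i => cond_expect mu (pred1 i)) (norm2 mu) D psi
     (fun x => level w l x - level v l x) <= M * (2 * pr mu [set x | w x <> v x]).
  apply: (@le_trans _ _ (M * \sum_(l <- ls) norm2 mu (fun x => level w l x - level v l x))).
    rewrite mulr_sumr; apply: ler_sum => l _.
    apply: (spec_norm_le VB VE NE) => //.
      by move=> h _; exact: norm2_ge0.
    by apply: bm_sub; exact: bm_level.
  by rewrite ler_wpM2l// sum_norm2_level_sub.
have e1 : 0 <= 1 + e^-1 by rewrite addr_ge0// invr_ge0 ltW.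
rewrite mulrDl mul1r -!addrA lerD2l lerD//; first by rewrite ler_wpM2l// ltW.
by rewrite ler_wpM2l.
Qed.

Lemma finite_range2 w v (e : R) : dmeasurable w -> dmeasurable v -> 0 < e ->
  exists ls : seq L, [/\ uniq ls, pr mu [set x | w x \notin ls] <= e &
    pr mu [set x | v x \notin ls] <= e].
Proof.
move=> mw mv e0; have [E EP] := exhaustion_ex cL.
have [N hN] := dmeasurable_finite_range mu cL EP mw e0.
have [M hM] := dmeasurable_finite_range mu cL EP mv e0.
exists (E (maxn N M)); split; first exact: exhaustion_uniq.
  by apply: hN; exact: leq_maxl.
by apply: hM; exact: leq_maxr.
Qed.

Lemma spec_agree_approx w v D psi (M e : R) : dmeasurable w -> dmeasurable v ->
  (forall S, 0 <= psi S <= M) -> 0 < e ->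
  exists ls, [/\ uniq ls,
    `|spec (agree w) D pred0 psi - spec_on ls w D psi| <= e &
    `|spec (agree v) D pred0 psi - spec_on ls v D psi| <= e].
Proof.
move=> mw mv pM e0.
have M0 : 0 <= M by have /andP[] := pM [::]; exact: le_trans.
have pM' S : `|psi S| <= M by have /andP[h1 h2] := pM S; rewrite ger0_norm.
pose C : R := 3 ^+ size D * M.
have C0 : 0 <= C by rewrite mulr_ge0// exprn_ge0.
have C1 : 0 < C + 1 by rewrite ltr_wpDl.
have [ls [uls h1 h2]] := finite_range2 mw mv (divr_gt0 e0 C1).
have Ce : C * (e / (C + 1)) <= e.
  by rewrite mulrA ler_pdivrMr// mulrC ler_pM2l// lerDl.
exists ls; split=> //.
  apply: (le_trans (spec_agree_dist D uls mw pM')); rewrite mulrA -/C.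
  by apply: le_trans Ce; rewrite ler_wpM2l.
apply: (le_trans (spec_agree_dist D uls mv pM')); rewrite mulrA -/C.
by apply: le_trans Ce; rewrite ler_wpM2l.
Qed.

(** The recursion of [spec] contains a subtraction, so positivity is not apparent; it is inherited
    from the sums of squared norms [spec_on] as the truncation error tends to 0. *)
Lemma spec_agree_ge0 w D psi (M : R) : dmeasurable w -> (forall S, 0 <= psi S <= M) ->
  0 <= spec (agree w) D pred0 psi.
Proof.
move=> mw pM; apply/ler_addgt0Pr => e e0.
have [ls [uls h _]] := spec_agree_approx D mw mw pM e0.
have p0 S : 0 <= psi S by have /andP[] := pM S.
have := spec_on_ge0 ls D mw p0; move: h; rewrite ler_distl => /andP[h1 _]; lra.
Qed.

Lemma spec_agree_close w v D psi (M e : R) : dmeasurable w -> dmeasurable v ->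
  0 < e -> (forall S, 0 <= psi S <= M) ->
  spec (agree w) D pred0 psi <= spec (agree v) D pred0 psi + e * M +
    (1 + e^-1) * (M * (2 * pr mu [set x | w x <> v x])).
Proof.
move=> mw mv e0 pM; apply/ler_addgt0Pr => r r0.
have r2 : 0 < r / 2 by rewrite divr_gt0.
have [ls [uls h1 h2]] := spec_agree_approx D mw mv pM r2.
have := spec_on_close D uls mw mv e0 pM.
move: h1 h2; rewrite !ler_distl => /andP[_ h1] /andP[h2 _]; lra.
Qed.

(** For [A] inside [B] the projection for [B] factors through the one for [A], so it decreases the
    norm of every level further. *)
Lemma agree_mono w A B : dmeasurable w -> (forall i, A i -> B i) ->
  agree w B <= agree w A.
Proof.
move=> mw AB; apply/ler_addgt0Pr => r r0.
have r2 : 0 < r / 2 by rewrite divr_gt0.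
have [ls [uls h _]] := finite_range2 mw mw r2.
have hA := le_trans (agree_on_dist A uls mw) h.
have hB := le_trans (agree_on_dist B uls mw) h.
have : agree_on ls w B <= agree_on ls w A.
  apply: ler_sum => l _; have bl := bm_level l mw.
  have bA := bm_cond_expect mu_power A bl.
  have -> : cond_expect mu B (level w l) =
      cond_expect mu B (cond_expect mu A (level w l)).
    have e : (fun i => B i || A i) = B.
      apply/funext => i; case: (boolP (B i)) => //= /negP nB.
      by apply/negP => /AB.
    by rewrite (cond_expect_comp mu_power)// e.
  rewrite -subr_ge0 -(norm2_sub_cond_expect mu_power)//; exact: norm2_ge0.
move=> h'; exact: le_of_dist hA hB h'.
Qed.

End Agreement.

(** * Approximation by functions of finitely many coordinates *)

Section Determined.
Context {R : realType} {d0 : measure_display} {X0 : measurableType d0}.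
Context {I : choiceType}.
Let X := power_space X0 I.
Variables (mu0 : probability X0 R) (mu : probability X R).
Hypothesis mu_power : is_power_measure mu0 mu.
Let X2 := (X * X)%type.
Let mu2 := product_prob mu mu.
Implicit Types (A B C : pred I) (F : seq I).

Definition determined (L : Type) F (w : X -> L) : Prop :=
  forall x y : X, (forall i, i \in F -> x i = y i) -> w x = w y.

Lemma determined_resample (L : Type) F A (w : X -> L) x y : determined F w ->
  (forall i, i \in F -> ~~ A i) -> w (resample A x y) = w x.
Proof.
by move=> dw FA; apply: dw => i iF; rewrite /resample (negbTE (FA i iF)).
Qed.

Definition set_change A (S : set X) : set X2 :=
  [set z | S (resample A z.1 z.2) /\ ~ S z.1] `|`
  [set z | ~ S (resample A z.1 z.2) /\ S z.1].

Lemma measurable_set_change A S : measurable S -> measurable (set_change A S).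
Proof.
move=> mS; have mr := (mp_resample mu_power A).1.
have m1 := measurable_preimage mr mS.
have m2 : measurable (fst @^-1` S : set X2).
  exact: measurable_preimage measurable_fst mS.
apply: measurableU; apply: measurableI => //; exact: measurableC.
Qed.

(** Approximation by cylinders, expressed through resampling: in this form the approximable sets are
    easily seen to be a sigma-algebra, and the estimate is already one on influences. *)
Definition finitely_approximable (S : set X) : Prop := measurable S /\
  forall e : R, 0 < e -> exists F, forall A, (forall i, i \in F -> ~~ A i) ->
    pr mu2 (set_change A S) <= e.

Lemma finitely_approximable_bigcup (S : nat -> set X) :
  (forall n, finitely_approximable (S n)) -> finitely_approximable (\bigcup_n S n).
Proof.
move=> aS; have mS n : measurable (S n) by case: (aS n).
split; first exact: bigcupT_measurable.
(* Half of [e] is spent on the first [N] sets and a quarter on each occurrence of the tail, before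
   and after resampling. *)
move=> e e0; have e4 : 0 < e / 4 by rewrite divr_gt0.
have e2 : 0 < e / 2 by rewrite divr_gt0.
have [N hN] := pr_bigcup_approx mu mS e4.
pose U := \big[setU/set0]_(k < N) S k.
have mU : measurable U by apply: bigsetU_measurable.
have eN : 0 < e / 2 / N.+1%:R by rewrite !divr_gt0.
have hF n : exists F, forall A, (forall i, i \in F -> ~~ A i) ->
    pr mu2 (set_change A (S n)) <= e / 2 / N.+1%:R by exact: (aS n).2.
pose F n := sval (cid (hF n)).
have FP n A : (forall i, i \in F n -> ~~ A i) ->
    pr mu2 (set_change A (S n)) <= e / 2 / N.+1%:R.
  by rewrite /F; case: cid => ? /= h; exact: h.
exists (flatten [seq F n | n <- iota 0 N]) => A hA.
have FA n : (n < N)%N -> pr mu2 (set_change A (S n)) <= e / 2 / N.+1%:R.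
  move=> nN; apply: FP => i iF; apply: hA; apply/flattenP.
  by exists (F n) => //; apply: map_f; rewrite mem_iota.
pose V := \bigcup_n S n `\` U.
have mV : measurable V by apply: measurableD => //; exact: bigcupT_measurable.
have mr := (mp_resample mu_power A).1.
pose V1 := (fun z : X2 => resample A z.1 z.2) @^-1` V.
pose V2 := (fst @^-1` V : set X2).
have mV1 : measurable V1 by exact: measurable_preimage.
have mV2 : measurable V2 by exact: measurable_preimage measurable_fst mV.
have hV1 : pr mu2 V1 <= e / 4.
  by rewrite (mp_pr (mp_resample mu_power A) mV).
have hV2 : pr mu2 V2 <= e / 4.
  rewrite (_ : V2 = V `*` setT); last by apply/seteqP; split=> z //= [].
  by rewrite pr_rect// prT mulr1.
have mc n : measurable (set_change A (S n)) by exact: measurable_set_change.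
have mW : measurable (\big[setU/set0]_(k < N) set_change A (S k)).
  by apply: bigsetU_measurable.
apply: (@le_trans _ _ (pr mu2 ((\big[setU/set0]_(k < N) set_change A (S k)) `|` (V1 `|` V2)))).
  apply: pr_le.
  - by apply: measurable_set_change; exact: bigcupT_measurable.
  - by apply: measurableU => //; exact: measurableU.
  have UE : U = \bigcup_(k < N) S k by rewrite bigcup_mkord.
  have WE : \big[setU/set0]_(k < N) set_change A (S k) =
      \bigcup_(k < N) set_change A (S k) by rewrite bigcup_mkord.
  rewrite WE => z [[[n _ Sn] nS]|[nS [n _ Sn]]].
    have [|nU] := pselect (U (resample A z.1 z.2)).
      by rewrite UE => -[k kN Sk]; left; exists k => //; left; split=> // Skz; apply: nS; exists k.
    by right; left; split=> //; exists n.
  have [|nU] := pselect (U z.1).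
    by rewrite UE => -[k kN Sk]; left; exists k => //; right; split=> // Skz; apply: nS; exists k.
  by right; right; split=> //; exists n.
apply: (le_trans (prU_le _ _ _)) => //; first exact: measurableU.
have hW := pr_bigU_le mu2 (index_enum 'I_N) (fun k : 'I_N => mc k).
have hV := prU_le mu2 mV1 mV2.
apply: (le_trans (lerD hW hV)).
have : \sum_(i < N) pr mu2 (set_change A (S i)) <= e / 2.
  apply: (@le_trans _ _ (\sum_(i < N) e / 2 / N.+1%:R)).
    by apply: ler_sum => i _; exact: FA.
  rewrite sumr_const card_ord -[_ *+ N]mulr_natr -[leLHS]mulrA.
  by rewrite ler_piMr ?(ltW e2)// mulrC ler_pdivrMr// mul1r ler_nat.
lra.
Qed.

Lemma measurable_finitely_approximable S : measurable S -> finitely_approximable S.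
Proof.
move=> mS.
suff : <<s @coordinate_sets _ X0 I >> `<=` finitely_approximable by exact.
apply: smallest_sub.
  split=> [|B aB|B aB]; last exact: finitely_approximable_bigcup.
    split=> // e e0; exists [::] => A _.
    rewrite (_ : set_change A set0 = set0) ?pr0 ?ltW//.
    by apply/seteqP; split=> // z [[]|[]].
  rewrite setTD; split; first by apply: measurableC; exact: aB.1.
  move=> e e0; have [F hF] := aB.2 e e0; exists F => A /hF; congr (pr mu2 _ <= _).
  by apply/seteqP; split=> z; rewrite /set_change /= ?notE; tauto.
move=> _ [i [B [mB ->]]]; split; first exact: measurable_coord.
move=> e e0; exists [:: i] => A /(_ i (mem_head _ _)) Ai.
rewrite (_ : set_change A _ = set0) ?pr0 ?ltW//.
by apply/seteqP; split=> // z []; rewrite /= /resample (negbTE Ai); tauto.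
Qed.

Section Discrete.
Context {L : choiceType}.
Hypothesis cL : countable [set: L].
Implicit Types (w v : X -> L).

(** Finitely many levels carry most of the mass, and each of them is almost unaffected by resampling
    away from finitely many coordinates. *)
Lemma disagree_small w (e : R) : dmeasurable w -> 0 < e ->
  exists F, forall A, (forall i, i \in F -> ~~ A i) -> disagree mu w A <= e.
Proof.
move=> mw e0; have e2 : 0 < e / 2 by rewrite divr_gt0.
have [ls [uls hls _]] := finite_range2 mu cL mw mw e2.
have eN : 0 < e / 2 / (size ls).+1%:R by rewrite !divr_gt0.
have hF l : exists F, forall A, (forall i, i \in F -> ~~ A i) ->
    pr mu2 (set_change A (w @^-1` [set l])) <= e / 2 / (size ls).+1%:R.
  exact: (measurable_finitely_approximable (mw l)).2.
pose F l := sval (cid (hF l)).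
have FP l A : (forall i, i \in F l -> ~~ A i) ->
    pr mu2 (set_change A (w @^-1` [set l])) <= e / 2 / (size ls).+1%:R.
  by rewrite /F; case: cid => ? /= h; exact: h.
exists (flatten [seq F l | l <- ls]) => A hA.
have FA l : l \in ls -> pr mu2 (set_change A (w @^-1` [set l])) <= e / 2 / (size ls).+1%:R.
  move=> lls; apply: FP => i iF; apply: hA; apply/flattenP.
  by exists (F l) => //; exact: map_f.
have mN : measurable [set x | w x \notin ls].
  exact: (dmeasurable_set cL [set l | l \notin ls]).
have mNT : measurable ([set x | w x \notin ls] `*` setT : set X2) by exact: measurableX.
have mc l : measurable (set_change A (w @^-1` [set l])).
  by apply: measurable_set_change; exact: mw.
have mW : measurable (\big[setU/set0]_(l <- ls) set_change A (w @^-1` [set l])).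
  by apply: bigsetU_measurable.
apply: (@le_trans _ _ (pr mu2 ((\big[setU/set0]_(l <- ls) set_change A (w @^-1` [set l]))
   `|` ([set x | w x \notin ls] `*` setT)))).
  apply: pr_le; [exact: (measurable_disagree mu_power cL _ mw)|exact: measurableU|].
  move=> z /= zw; have [wls|wls] := boolP (w z.1 \in ls); last by right.
  by left; rewrite -bigcup_seq; exists (w z.1) => //; right.
apply: (le_trans (prU_le _ _ _)) => //; rewrite pr_rect// prT mulr1.
rewrite (splitr e); apply: lerD => //.
apply: (le_trans (pr_bigU_le mu2 _ mc)).
apply: (@le_trans _ _ (\sum_(l <- ls) e / 2 / (size ls).+1%:R)).
  by rewrite big_seq [leRHS]big_seq; apply: ler_sum => l; exact: FA.
rewrite big_const_seq count_predT iter_addr_0 -[_ *+ size ls]mulr_natr -[leLHS]mulrA.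
by rewrite ler_piMr ?(ltW e2)// mulrC ler_pdivrMr// mul1r ler_nat.
Qed.

(** The approximant is [w] with the coordinates outside [F] frozen at a point [y]; by Fubini the
    average error over [y] is small, so some [y] is good. *)
Lemma determined_approx w (e : R) : dmeasurable w -> 0 < e ->
  exists F v, [/\ dmeasurable v, determined F v & pr mu [set x | w x <> v x] <= e].
Proof.
move=> mw e0; have e2 : 0 < e / 2 by rewrite divr_gt0.
have [F hF] := disagree_small mw e2.
pose A : pred I := fun i => i \notin F.
have FA i : i \in F -> ~~ A i by rewrite /A negbK.
have mD : measurable [set z : X2 | w (resample A z.2 z.1) <> w z.2].
  have := measurable_preimage (measurable_swap predT) (measurable_disagree mu_power cL A mw).
  by congr measurable; apply/seteqP; split=> z.
have : pr mu2 [set z | w (resample A z.2 z.1) <> w z.2] <= e / 2.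
  apply: le_trans (hF A FA).
  rewrite /disagree -[leRHS](mp_pr (mp_swap mu_power predT) (measurable_disagree mu_power cL A mw)).
  by rewrite le_eqVlt; apply/orP; left; apply/eqP; congr pr; apply/seteqP; split=> z.
rewrite -expect_indic// expect_product; last exact: bm_indic.
set f := (X in expect mu X <= _) => hf.
have [y hy] : exists y, f y <= e.
  apply: contrapT => /forallNP h.
  have : e <= expect mu f.
    rewrite -[leLHS](expect_cst mu); apply: expect_le => [||y]; first exact: bm_cst.
      exact: (bm_expect mu mu (bm_indic mD)).
    by have /negP := h y; rewrite -ltNge => /ltW.
  by move: hf e0 => /[swap] _; lra.
exists F, (fun x => w (resample A x y)); split.
- apply: (dmeasurable_comp mw).
  by apply: (@measurable_resample _ _ _ _ _ A id (cst y)) => //; exact: measurable_cst.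
- move=> x x' xx'; congr w; apply/funext => i; rewrite /resample /A.
  by case: (boolP (i \in F)) => //= /xx'.
apply: le_trans hy; rewrite /f le_eqVlt; apply/orP; left; apply/eqP.
have mS : measurable [set x | w x <> w (resample A x y)].
  apply: measurable_neq_dmeasurable => //; apply: (dmeasurable_comp mw).
  by apply: (@measurable_resample _ _ _ _ _ A id (cst y)) => //; exact: measurable_cst.
rewrite -expect_indic//; congr expect; apply/funext => x; rewrite !indicE.
by congr (_%:R); congr nat_of_bool; apply/idP/idP; rewrite !inE /=;
  apply: contra_not => ->.
Qed.

(** Exchanging the coordinates in [B] between the two copies turns the point resampled on [B] into
    the base point, and leaves a resampling of [C] alone. *)
Lemma disagree_union w B C : dmeasurable w -> (forall i, B i -> ~~ C i) ->
  pr mu2 [set z | w (resample (fun i => B i || C i) z.1 z.2) <> w (resample B z.1 z.2)]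
  = disagree mu w C.
Proof.
move=> mw BC; rewrite /disagree -[RHS](mp_pr (mp_swap mu_power B) (measurable_disagree mu_power cL C mw)).
congr pr; apply/seteqP; split=> z /=;
  rewrite (_ : resample C (resample B z.1 z.2) (resample B z.2 z.1) =
   resample (fun i => B i || C i) z.1 z.2)//;
  apply/funext => i; rewrite /resample; have := BC i; case: (B i) => [/(_ isT)/negbTE ->|_]//.
Qed.

End Discrete.

Section Relabel.
Variables (b b' : I -> I).
Hypothesis bK : cancel b b'.

Definition relabel (x : X) : X := fun i => x (b i).

Lemma measurable_relabel : measurable_fun setT relabel.
Proof. by apply: measurable_power => i A mA; exact: measurable_coord. Qed.

Lemma mp_relabel : measure_preserving mu mu relabel.
Proof.
apply: (@mp_pi_system _ _ _ _ _ _ _ cylinders).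
- exact: cylinders_generate.
- exact: cylinders_setI.
- exact: measurable_relabel.
move=> _ [F [A [mA ->]]].
rewrite (_ : relabel @^-1` _ = cylinder [fset b i | i in F]%fset (A \o b')); last first.
  apply/seteqP; split=> x /= h i.
    by move=> /imfsetP[j /= jF ->]; rewrite bK; exact: h.
  by move=> iF; have := h (b i); rewrite /= bK; apply; exact: in_imfset.
rewrite !mu_power//; last by move=> i; exact: mA.
rewrite big_imfset /=; last by move=> i j _ _ /(can_inj bK).
by apply: eq_bigr => i _; rewrite bK.
Qed.

Lemma mp_relabel2 :
  measure_preserving mu2 mu2 (fun z => (relabel z.1, relabel z.2)).
Proof.
have [mr rP] := mp_relabel; apply: mp_rect.
  by apply: measurable_fun_pair; apply: measurableT_comp.
move=> A B mA mB.
rewrite (_ : _ @^-1` _ = (relabel @^-1` A) `*` (relabel @^-1` B))//.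
rewrite product_probE ?rP//; exact: measurable_preimage.
Qed.

Lemma agree_relabel (L : choiceType) (w : X -> L) A : countable [set: L] ->
  dmeasurable w -> agree mu (w \o relabel) A = agree mu w (A \o b).
Proof.
move=> cL mw; rewrite /agree.
by rewrite -[RHS](mp_pr mp_relabel2 (measurable_agree mu_power cL (A \o b) mw)).
Qed.

End Relabel.

End Determined.

(** * Slowly varying weights *)

Section WeightedAverage.
Context {R : realType} {T : eqType}.
Implicit Types (tau f : T -> R) (S C : seq T).

Definition mass tau S : R := \sum_(g <- undup S) tau g.

(** The denominator is truncated at 1. A light sample then gets a small value instead of an unstable
    quotient, so that deleting elements of small weight changes little, while a sample containing a
    point of weight 1 gets a true weighted average. *)
Definition wavg tau f S : R := mass (fun g => tau g * f g) S / Num.max 1 (mass tau S).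

Lemma max1_gt0 (x : R) : 0 < Num.max 1 x. Proof. by rewrite lt_max ltr01. Qed.

Lemma wavg_lin tau c f f' S :
  wavg tau (fun g => c * f g + f' g) S = c * wavg tau f S + wavg tau f' S.
Proof.
rewrite /wavg mulrA -mulrDl; congr (_ / _); rewrite /mass mulr_sumr -big_split.
by apply: eq_bigr => g _ /=; ring.
Qed.

Lemma mass_ge0 tau S : (forall g, 0 <= tau g) -> 0 <= mass tau S.
Proof. by move=> t0; apply: sumr_ge0 => g _. Qed.

Lemma mass_le tau tau' S : (forall g, tau g <= tau' g) -> mass tau S <= mass tau' S.
Proof. by move=> tt'; apply: ler_sum => g _. Qed.

Lemma wavg01 tau f S : (forall g, 0 <= tau g) -> (forall g, 0 <= f g <= 1) ->
  0 <= wavg tau f S <= 1.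
Proof.
move=> t0 f01; have f0 g : 0 <= f g by have /andP[] := f01 g.
have f1 g : f g <= 1 by have /andP[] := f01 g.
apply/andP; split.
  rewrite divr_ge0//; last exact: ltW (max1_gt0 _).
  by apply: mass_ge0 => g; rewrite mulr_ge0.
rewrite ler_pdivrMr ?max1_gt0// mul1r le_max; apply/orP; right.
by apply: mass_le => g; rewrite ler_piMr.
Qed.

Lemma ratio_close (a n n' u u' : R) : 0 <= n' <= u' ->
  `|n - n'| <= a -> `|u - u'| <= a ->
  `|n / Num.max 1 u - n' / Num.max 1 u'| <= 2 * (a / Num.max 1 u).
Proof.
move=> /andP[n'0 n'u'] nn' uu'.
set m := Num.max 1 u; set m' := Num.max 1 u'.
have m0 : 0 < m by exact: max1_gt0.
have m'0 : 0 < m' by exact: max1_gt0.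
have mm' : `|m' - m| <= a.
  rewrite ler_distl; move: uu'; rewrite ler_distl => /andP[h1 h2].
  have a0 : 0 <= a by exact: le_trans (normr_ge0 _) nn'.
  rewrite /m /m'; apply/andP; split.
    rewrite lerBlDr ge_max; apply/andP; split.
      by apply: (@le_trans _ _ (Num.max 1 u')); rewrite ?lerDl// le_max lexx.
    have : u <= u' + a by lra.
    by move=> h; apply: (le_trans h); rewrite lerD2r le_max lexx orbT.
  rewrite ge_max; apply/andP; split.
    by apply: (@le_trans _ _ (Num.max 1 u)); rewrite ?lerDl// le_max lexx.
  have : u' <= u + a by lra.
  by move=> h; apply: (le_trans h); rewrite lerD2r le_max lexx orbT.
rewrite (_ : _ - _ = (n - n') / m + (n' / m') * ((m' - m) / m)); last first.
  by field; rewrite !gt_eqF.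
have q1 : `|n' / m'| <= 1.
  rewrite ger0_norm ?divr_ge0 ?(ltW m'0)// ler_pdivrMr// mul1r.
  by apply: (le_trans n'u'); rewrite /m' le_max lexx orbT.
have mi : 0 <= m^-1 by rewrite invr_ge0 ltW.
apply: (le_trans (ler_normD _ _)).
rewrite !(normrM _ (m^-1)) normrM (normrM _ (m^-1)) (ger0_norm mi).
rewrite mulr2n mulrDl !mul1r; apply: lerD; first by rewrite ler_wpM2r.
rewrite -[leRHS]mul1r; apply: ler_pM => //.
  by rewrite mulr_ge0.
by rewrite ler_wpM2r.
Qed.

Lemma mass_le_sum tau S : (forall g, 0 <= tau g) -> mass tau S <= \sum_(g <- S) tau g.
Proof.
move=> t0; rewrite /mass; elim: S => [|g S IH] /=; first by rewrite !big_nil.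
rewrite big_cons; case: ifP => _; last by rewrite big_cons lerD2l.
by apply: (le_trans IH); rewrite lerDr.
Qed.

Lemma mass_subset tau S C : (forall g, 0 <= tau g) -> {subset S <= C} ->
  mass tau S <= mass tau C.
Proof.
move=> t0 SC; rewrite /mass.
have e : perm_eq (undup S) [seq g <- undup C | g \in S].
  apply: uniq_perm; rewrite ?filter_uniq ?undup_uniq// => g.
  rewrite mem_undup mem_filter mem_undup; case: (boolP (g \in S)) => //= /SC ->//.
rewrite (perm_big _ e) /= big_filter big_mkcond; apply: ler_sum => g _.
by case: ifP.
Qed.

Lemma mass_filter_dist tau C S : (forall g, 0 <= tau g) ->
  mass tau S - mass tau (seq.filter [predC C] S) <= \sum_(g <- C) tau g.
Proof.
move=> t0; rewrite /mass -filter_undup big_filter.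
rewrite [X in X - _](bigID (mem C)) /= addrK.
rewrite -big_filter filter_undup; apply: le_trans (mass_le_sum C t0).
by apply: mass_subset => // g; rewrite mem_filter => /andP[].
Qed.

Lemma mass_filter_le tau (p : pred T) S : (forall g, 0 <= tau g) ->
  mass tau (seq.filter p S) <= mass tau S.
Proof. by move=> t0; apply: mass_subset => // g; rewrite mem_filter => /andP[]. Qed.

Lemma wavg_filter_dist tau f C S : (forall g, 0 <= tau g) ->
  (forall g, 0 <= f g <= 1) ->
  `|wavg tau f S - wavg tau f (seq.filter [predC C] S)| <=
  2 * \sum_(g <- C) tau g.
Proof.
move=> t0 f01; have f0 g : 0 <= f g by have /andP[] := f01 g.
have f1 g : f g <= 1 by have /andP[] := f01 g.
have tf0 g : 0 <= tau g * f g by rewrite mulr_ge0.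
have tft g : tau g * f g <= tau g by rewrite ler_piMr.
set K := \sum_(g <- C) tau g.
have K0 : 0 <= K by apply: sumr_ge0 => g _.
have h1 : `|mass (fun g => tau g * f g) S -
   mass (fun g => tau g * f g) (seq.filter [predC C] S)| <= K.
  rewrite ger0_norm; last by rewrite subr_ge0 mass_filter_le.
  by apply: (le_trans (mass_filter_dist C S tf0)); apply: ler_sum.
have h2 : `|mass tau S - mass tau (seq.filter [predC C] S)| <= K.
  rewrite ger0_norm; last by rewrite subr_ge0 mass_filter_le.
  exact: mass_filter_dist.
have h3 : 0 <= mass (fun g => tau g * f g) (seq.filter [predC C] S) <=
   mass tau (seq.filter [predC C] S).
  by rewrite mass_ge0//= mass_le.
apply: (le_trans (ratio_close h3 h1 h2)).
rewrite ler_wpM2l// ler_pdivrMr ?max1_gt0//.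
by rewrite ler_peMr// le_max lexx.
Qed.

Lemma wavg_close tau tau' f (k : R) S : 0 <= k -> (forall g, 0 <= tau g) ->
  (forall g, 0 <= tau' g) -> (forall g, `|tau g - tau' g| <= k * tau g) ->
  (forall g, 0 <= f g <= 1) -> `|wavg tau f S - wavg tau' f S| <= 2 * k.
Proof.
move=> k0 t0 t'0 tt' f01; have f0 g : 0 <= f g by have /andP[] := f01 g.
have f1 g : f g <= 1 by have /andP[] := f01 g.
have h2 : `|mass tau S - mass tau' S| <= k * mass tau S.
  rewrite /mass -sumrB mulr_sumr; apply: (le_trans (ler_norm_sum _ _ _)).
  exact: ler_sum.
have h1 : `|mass (fun g => tau g * f g) S - mass (fun g => tau' g * f g) S| <=
   k * mass tau S.
  rewrite /mass -sumrB mulr_sumr; apply: (le_trans (ler_norm_sum _ _ _)).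
  apply: ler_sum => g _; rewrite -mulrBl normrM (ger0_norm (f0 g)).
  by apply: le_trans (tt' g); rewrite ler_piMr.
have h3 : 0 <= mass (fun g => tau' g * f g) S <= mass tau' S.
  rewrite mass_ge0 ?mass_le// => g; [by rewrite ler_piMr|by rewrite mulr_ge0].
apply: (le_trans (ratio_close h3 h1 h2)).
rewrite ler_wpM2l// -mulrA ler_piMr// ler_pdivrMr ?max1_gt0// mul1r.
by rewrite le_max lexx orbT.
Qed.

Lemma wavg_one_ge tau S g : (forall h, 0 <= tau h) -> tau g = 1 -> g \in S ->
  wavg tau (fun=> 1) S = 1.
Proof.
move=> t0 tg gS; rewrite /wavg (_ : (fun h => tau h * 1) = tau); last first.
  by apply/funext => h; rewrite mulr1.
have m1 : 1 <= mass tau S.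
  rewrite -tg (_ : tau g = mass tau [:: g]); last by rewrite /mass big_seq1.
  by apply: mass_subset => // h; rewrite inE => /eqP ->.
by rewrite max_r// divff// gt_eqF// (lt_le_trans ltr01).
Qed.

Lemma wavg_map (p : T -> T) tau f S : injective p ->
  wavg tau f (map p S) = wavg (tau \o p) (f \o p) S.
Proof.
by move=> pi; rewrite /wavg /mass undup_map_inj// !big_map.
Qed.

Lemma wavg_symmetric tau f : symmetric (wavg tau f).
Proof.
move=> S S' SS'; rewrite /wavg /mass.
have e : perm_eq (undup S) (undup S') by apply: perm_undup => x; exact: perm_mem.
by rewrite !(perm_big _ e).
Qed.

End WeightedAverage.

Section Length.
Context {G : groupType}.

(** A substitute for the word length when no finite generating set is given. The ball [B m.+1]
    contains [E m.+1] times [B m]; if [s] is in [E m], the length of [s g] is thus at most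
    [max(m, l g) + 1]. *)
Lemma length_ex : countable [set: G] -> exists l : G -> nat,
  (forall n, finite_set [set g | (l g <= n)%N]) /\
  (forall s, exists C, forall g, (l (s * g)%g <= l g + C)%N).
Proof.
move=> /exhaustion_ex[E EP].
pose B := fix B n := if n is m.+1 then
  B m ++ E m.+1 ++ [seq (s * b)%g | s <- E m.+1, b <- B m] else E 0%N.
have Bmono m n : (m <= n)%N -> {subset B m <= B n}.
  elim: n => [|n IH]; first by rewrite leqn0 => /eqP ->.
  rewrite leq_eqVlt => /predU1P[->//|]; rewrite ltnS => /IH h g /h gB.
  by rewrite /= mem_cat gB.
have Bcover g : exists n, g \in B n.
  have [n gE] := exhaustion_cover EP g; exists n.
  by case: n gE => [//|n] gE; rewrite /= !mem_cat gE orbT.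
pose l g := ex_minn (Bcover g).
have lP g : g \in B (l g) by rewrite /l; case: ex_minnP.
have lmin g n : g \in B n -> (l g <= n)%N by rewrite /l; case: ex_minnP => m _; apply.
exists l; split.
  move=> n; apply: (@sub_finite_set _ _ [set` B n]); last exact: finite_seq.
  by move=> g /= gn; exact: Bmono gn _ (lP g).
move=> s; have [m sE] := exhaustion_cover EP s; exists m.+1 => g.
apply: leq_trans (lmin _ (maxn m (l g)).+1 _) _; last first.
  by rewrite addnS ltnS geq_max leq_addl leq_addr.
rewrite /= !mem_cat; apply/orP; right; apply/orP; right; apply/allpairsP.
exists (s, g); split=> //=.
  by apply: (exhaustion_mono EP _ sE); rewrite (leq_trans (leq_maxl m (l g))).
by apply: Bmono (lP g); exact: leq_maxr.
Qed.

End Length.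

Section SlowWeights.
Context {R : realType} {G : groupType}.

Lemma expr1D_le (a : R) n : 0 <= a <= 1 -> (1 + a) ^+ n <= 1 + 3 ^+ n * a.
Proof.
move=> /andP[a0 a1]; elim: n => [|n IH]; first by rewrite !expr0; lra.
rewrite !exprS; apply: (le_trans (ler_wpM2l _ IH)); first by rewrite addr_ge0.
have p1 : 1 <= 3 ^+ n :> R by apply: exprn_ege1; rewrite ler1n.
set p := 3 ^+ n in p1 *.
rewrite -subr_ge0 (_ : _ - _ = a * ((p - 1) + p * (1 - a))); last by ring.
rewrite mulr_ge0// addr_ge0 ?subr_ge0// mulr_ge0 ?subr_ge0//.
exact: le_trans p1.
Qed.

Lemma bernoulli_ineq (a : R) n : 0 <= a -> 1 + n%:R * a <= (1 + a) ^+ n.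
Proof.
move=> a0; elim: n => [|n IH]; first by rewrite expr0 mul0r addr0.
rewrite exprS; apply: le_trans (ler_wpM2l _ IH); last by rewrite addr_ge0.
rewrite -natr1; set m : R := n%:R; have m0 : 0 <= m by rewrite ler0n.
rewrite -subr_ge0 (_ : _ - _ = m * a ^+ 2); last by ring.
by rewrite mulr_ge0// sqr_ge0.
Qed.

Lemma ratio_dist (x y k : R) : 0 < x -> 0 < k -> y <= x * (1 + k) ->
  x <= y * (1 + k) -> `|x - y| <= k * x.
Proof.
move=> x0 k0 yx xy; rewrite ler_distl; apply/andP; split.
  by rewrite lerBlDr; move: yx; rewrite mulrDr mulr1 mulrC.
have [yx'|xy'] := leP y x; last by rewrite (le_trans (ltW xy'))// lerDl mulr_ge0 ?ltW.
apply: (le_trans xy); rewrite mulrDr mulr1 lerD2l mulrC.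
by rewrite ler_wpM2l// ltW.
Qed.

Lemma seq_bound (T : eqType) (f : T -> nat) (S : seq T) :
  exists m, forall g, g \in S -> (f g <= m)%N.
Proof.
elim: S => [|g S [m h]]; first by exists 0%N.
exists (maxn (f g) m) => x; rewrite inE => /predU1P[->|/h xm]; first exact: leq_maxl.
by rewrite (leq_trans xm)// leq_maxr.
Qed.

Lemma dist_inner m N q x : (x <= m)%N -> (N <= ((m + N) - x) + (x - q))%N.
Proof. lia. Qed.

Lemma dist_outer r q N x : (q + N < x)%N -> (N <= (r - x) + (x - q))%N.
Proof. lia. Qed.

Lemma dist_lipschitz r q C x y : (y <= x + C)%N -> (x <= y + C)%N ->
  ((r - y) + (y - q) <= (r - x) + (x - q) + C)%N.
Proof. lia. Qed.

(* The weight decays geometrically, at a rate close to 1, with the distance from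
   [l g] to an interval [r, q] that contains the lengths of the elements of [A]. *)
Lemma slow_weight_ex (K F : seq G) (k e : R) : countable [set: G] -> 0 < k -> 0 < e ->
  exists F' : seq G, forall A : seq G, (forall g, g \in A -> g \notin F') ->
  exists tau : G -> R, [/\ (forall g, 0 <= tau g),
    (forall g, g \in A -> tau g = 1),
    \sum_(g <- F) tau g <= e,
    (forall d : R, 0 < d -> finite_set [set g | d <= tau g]) &
    (forall s g, s \in K -> `|tau g - tau (s * g)%g| <= k * tau g)].
Proof.
move=> /length_ex[l [lfin lshift]] k0 e0.
pose C0 s := sval (cid (lshift s)).
have C0P s g : (l (s * g)%g <= l g + C0 s)%N by rewrite /C0; case: cid => ? /= h; exact: h.
have [C1 hC1] := seq_bound C0 K.
have [C2 hC2] := seq_bound (fun s => C0 s^-1%g) K.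
pose C := maxn C1 C2.
(* [C] bounds the change of length under left multiplication by elements of [K], in both directions.
   The rate [a] is chosen so that [(1 + a) ^+ C <= 1 + k]. *)
pose b : R := Num.min 1 k; have b0 : 0 < b by rewrite lt_min ltr01.
pose a : R := b / 3 ^+ C.
have p1 : 1 <= 3 ^+ C :> R by apply: exprn_ege1; rewrite ler1n.
have p0 : 0 < 3 ^+ C :> R by exact: lt_le_trans p1.
have a0 : 0 < a by rewrite divr_gt0.
have a1 : a <= 1.
  rewrite ler_pdivrMr// mul1r; apply: le_trans p1; by rewrite ge_min lexx.
have aC : (1 + a) ^+ C <= 1 + k.
  apply: (le_trans (@expr1D_le a C _)); first by rewrite ltW.
  rewrite lerD2l /a mulrC -mulrA mulVf ?gt_eqF// mulr1.
  by rewrite ge_min lexx orbT.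
pose th : R := (1 + a)^-1.
have q1 : 1 <= 1 + a by rewrite lerDl ltW.
have q0 : 0 < 1 + a by exact: lt_le_trans q1.
have th0 : 0 < th by rewrite invr_gt0.
have th1 : th <= 1 by rewrite invf_le1.
have thN (d : R) : 0 < d -> exists N, forall n, (N <= n)%N -> th ^+ n < d.
  move=> d0; exists (Num.bound (d^-1 / a)) => n Nn.
  rewrite /th exprVn invf_plt ?posrE ?exprn_gt0//.
  apply: lt_le_trans (bernoulli_ineq n (ltW a0)).
  rewrite -ltrBlDl; apply: (@lt_le_trans _ _ d^-1); first by rewrite ltrBlDr ltrDl.
  rewrite -ler_pdivrMr//; apply: ltW; apply: lt_le_trans (archi_boundP _) _.
    by rewrite divr_ge0// ?invr_ge0// ltW.
  by rewrite ler_nat.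
have [m hm] := seq_bound l F.
have F1 : 0 < (size F).+1%:R :> R by [].
have [N hN] := thN _ (divr_gt0 e0 F1).
(* On [F] the length is at most [m], hence at distance at least [N] below [r]; elements outside the
   ball [F'] of radius [r] have length above [r]. *)
pose r := (m + N)%N.
have /finite_seqP[F' F'E] := lfin r; exists F' => A AF'.
have [q hq] := seq_bound l (1%g :: A).
pose q' := maxn r q.
have rq' : (r <= q')%N by exact: leq_maxl.
pose n g := ((r - l g) + (l g - q'))%N.
exists (fun g => th ^+ n g); split.
- by move=> g; rewrite exprn_ge0// ltW.
- move=> g gA; have lr : (r < l g)%N.
    rewrite ltnNge; apply/negP => h; have := AF' g gA; apply/negP; rewrite negbK.
    by have : [set g | (l g <= r)%N] g by []; rewrite F'E.
  have lq : (l g <= q')%N.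
    by apply: leq_trans (hq g _) (leq_maxr _ _); rewrite inE gA orbT.
  by rewrite /n (eqP (ltnW lr)) (eqP lq) expr0.
- apply: (@le_trans _ _ (\sum_(g <- F) e / (size F).+1%:R)).
    rewrite big_seq [leRHS]big_seq; apply: ler_sum => g gF.
    by apply: ltW; apply: hN; exact: dist_inner (hm g gF).
  rewrite big_const_seq count_predT iter_addr_0 -[_ *+ size F]mulr_natr -[leLHS]mulrA.
  by rewrite ler_piMr ?(ltW e0)// mulrC ler_pdivrMr// mul1r ler_nat.
- move=> d d0; have [N' hN'] := thN d d0.
  apply: sub_finite_set (lfin (q' + N')%N) => g /= dg.
  rewrite leqNgt; apply/negP => h.
  have : th ^+ n g < d by apply: hN'; exact: dist_outer h.
  by rewrite ltNge dg.
move=> s g sK.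
have h1 : (l (s * g)%g <= l g + C)%N.
  by apply: leq_trans (C0P s g) _; rewrite leq_add2l (leq_trans (hC1 s sK))// leq_maxl.
have h2 : (l g <= l (s * g)%g + C)%N.
  have := C0P s^-1%g (s * g)%g; rewrite mulKg => h; apply: leq_trans h _.
  by rewrite leq_add2l (leq_trans (hC2 s sK))// leq_maxr.
have n1 : (n (s * g)%g <= n g + C)%N by exact: dist_lipschitz h1 h2.
have n2 : (n g <= n (s * g)%g + C)%N by exact: dist_lipschitz h2 h1.
have thle i j : (i <= j)%N -> th ^+ j <= th ^+ i.
  by move=> ij; apply: ler_wiXn2l => //; exact: ltW.
have thC : th ^+ C * (1 + a) ^+ C = 1 by rewrite -exprMn mulVf ?expr1n// gt_eqF.
set x := th ^+ n g; set y := th ^+ n (s * g)%g.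
have x0 : 0 < x by rewrite exprn_gt0.
have y0 : 0 < y by rewrite exprn_gt0.
have e1 : x * th ^+ C <= y by rewrite -exprD; exact: thle.
have e2 : y * th ^+ C <= x by rewrite -exprD; exact: thle.
have e3 : y <= x * (1 + k).
  rewrite -[leLHS]mulr1 -[X in _ * X <= _]thC mulrA; apply: ler_pM => //.
  - by rewrite mulr_ge0 ?exprn_ge0// ltW.
  - by rewrite exprn_ge0// ltW.
have e4 : x <= y * (1 + k).
  rewrite -[leLHS]mulr1 -[X in _ * X <= _]thC mulrA; apply: ler_pM => //.
  - by rewrite mulr_ge0 ?exprn_ge0// ltW.
  - by rewrite exprn_ge0// ltW.
exact: (ratio_dist x0 k0 e3 e4).
Qed.

End SlowWeights.

(** * Stability of the spectral sample under multiplication and translation *)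

Section SpectralStability.
Context {R : realType} {d0 : measure_display} {X0 : measurableType d0}.
Context {G : groupType}.
Let X := power_space X0 G.
Variables (mu0 : probability X0 R) (mu : probability X R).
Hypothesis mu_power : is_power_measure mu0 mu.
Context {L : groupType}.
Hypothesis cL : countable [set: L].
Implicit Types (u v w : X -> L) (D S F : seq G) (psi : seq G -> R).

Local Notation sh := (@bernoulli_shift d0 X0 G).
Local Notation sp w D psi := (spec (agree mu w) D pred0 psi).

Lemma mp_shift t : measure_preserving mu mu (sh t).
Proof.
exact: (mp_relabel mu_power (b := fun s => (t^-1 * s)%g) (b' := fun s => (t * s)%g)
  (fun s => mulVKg t s)).
Qed.

Lemma shiftM s t x : sh (s * t)%g x = sh s (sh t x).
Proof. by apply/funext => g; rewrite /bernoulli_shift invgM mulgA. Qed.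

Lemma shift1 x : sh 1%g x = x.
Proof. by apply/funext => g; rewrite /bernoulli_shift invg1 mul1g. Qed.

Lemma shiftK t : cancel (sh t) (sh t^-1%g).
Proof. by move=> x; rewrite -shiftM mulVg shift1. Qed.

Lemma shiftVK t : cancel (sh t^-1%g) (sh t).
Proof. by move=> x; rewrite -shiftM mulgV shift1. Qed.

Lemma dmeasurable_shift w t : dmeasurable w -> dmeasurable (fun x => w (sh t x)).
Proof. by move=> mw; apply: (dmeasurable_comp mw); exact: (mp_shift t).1. Qed.

Lemma dmeasurable_mul d (T : measurableType d) (u' v' : T -> L) :
  dmeasurable u' -> dmeasurable v' -> dmeasurable (fun x => u' x * v' x)%g.
Proof. exact: dmeasurable_op2. Qed.

Lemma agree_shift w t (A : pred G) : dmeasurable w ->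
  agree mu (fun x => w (sh t x)) A = agree mu w (fun g => A (t^-1 * g)%g).
Proof.
exact: (agree_relabel mu_power (b := fun s => (t^-1 * s)%g)
  (b' := fun s => (t * s)%g) (fun s => mulVKg t s) A cL).
Qed.

(** A factor that the resampling does not touch cancels on both sides. This is the use made of the
    group structure on the values. *)
Lemma agree_mulr F w v (A : pred G) : determined F v -> (forall g, g \in F -> ~~ A g) ->
  agree mu (fun x => w x * v x)%g A = agree mu w A.
Proof.
move=> dv FA; rewrite /agree; congr pr; apply/seteqP; split=> z /=;
  rewrite (determined_resample _ _ dv FA); last by move=> ->.
exact: mulIg.
Qed.

Lemma agree_mull F w v (A : pred G) : determined F v -> (forall g, g \in F -> ~~ A g) ->
  agree mu (fun x => v x * w x)%g A = agree mu w A.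
Proof.
move=> dv FA; rewrite /agree; congr pr; apply/seteqP; split=> z /=;
  rewrite (determined_resample _ _ dv FA); last by move=> ->.
exact: mulgI.
Qed.

(** As a functional of [psi] the left side is positive and of mass 1, hence contractive for the
    uniform norm. *)
Lemma spec_agree_psi_close w D psi psi' (k : R) : dmeasurable w ->
  (forall S, `|psi S - psi' S| <= k) -> `|sp w D psi - sp w D psi'| <= k.
Proof.
have one psi1 psi2 : dmeasurable w -> (forall S, `|psi1 S - psi2 S| <= k) ->
    sp w D psi2 <= sp w D psi1 + k.
  move=> mw h.
  have := @spec_agree_ge0 _ _ _ _ _ _ mu_power _ cL w D
    (fun S => 1 * (-1 * psi2 S + psi1 S) + k) (2 * k) mw.
  rewrite !spec_lin spec_cst agree0 mulr1 !mul1r mulN1r => h'.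
  rewrite -subr_ge0 (_ : _ - _ = - sp w D psi2 + sp w D psi1 + k); last by ring.
  apply: h' => S; have := h S; rewrite mul1r mulN1r ler_distl; lra.
move=> mw h; rewrite ler_distl; apply/andP; split.
  by rewrite lerBlDr; exact: one.
by apply: one => // S; rewrite distrC.
Qed.

(** Samples of functions that rarely differ are close in total variation, uniformly in [D]. The sums
    of squared norms are needed here, since a term by term estimate of the recursion grows
    exponentially with [D]. *)
Lemma spec_agree_tv (r : R) : 0 < r -> exists2 d : R, 0 < d &
  forall w v D psi, dmeasurable w -> dmeasurable v -> (forall S, 0 <= psi S <= 1) ->
  pr mu [set x | w x <> v x] <= d -> `|sp w D psi - sp v D psi| <= r.
Proof.
move=> r0; pose e := r / 2; have e0 : 0 < e by rewrite divr_gt0.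
pose c : R := (1 + e^-1) * 2.
have c0 : 0 < c by rewrite mulr_gt0// addr_gt0// invr_gt0.
exists (e / c); first by rewrite divr_gt0.
have one w v D psi : dmeasurable w -> dmeasurable v -> (forall S, 0 <= psi S <= 1) ->
    pr mu [set x | w x <> v x] <= e / c -> sp w D psi <= sp v D psi + r.
  move=> mw mv p01 h; apply: (le_trans (spec_agree_close mu_power cL D mw mv e0 p01)).
  rewrite mul1r mulr1 mulrA -/c -addrA lerD2l [leRHS]splitr -/e lerD2l.
  by rewrite mulrC -ler_pdivlMr.
move=> w v D psi mw mv p01 h; rewrite ler_distl; apply/andP; split; last exact: one.
rewrite lerBlDr; apply: one => //; move: h; congr (pr mu _ <= _).
by apply/seteqP; split=> x /= hx xe; apply: hx; rewrite xe.
Qed.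

(** Off [F] the two samples have the same law, because [spec] only evaluates [agree] on sets of
    sampled coordinates; and [psi] hardly depends on the part inside [F]. *)
Lemma spec_agree_eq_off F w1 w2 D psi (k : R) : dmeasurable w1 -> dmeasurable w2 ->
  (forall A : pred G, (forall g, g \in F -> ~~ A g) -> agree mu w1 A = agree mu w2 A) ->
  (forall S, `|psi S - psi (seq.filter [predC F] S)| <= k) ->
  `|sp w1 D psi - sp w2 D psi| <= k + k.
Proof.
move=> mw1 mw2 w12 hk.
have h w : dmeasurable w ->
    `|sp w D psi - sp w (seq.filter [predC F] D) psi| <= k.
  by move=> mw; rewrite -spec_filter; exact: spec_agree_psi_close.
have e : sp w1 (seq.filter [predC F] D) psi = sp w2 (seq.filter [predC F] D) psi.
  apply: spec_ext => B hB; apply: w12 => g gF; apply/negP => /hB /=.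
  by rewrite mem_filter /= gF.
rewrite (_ : _ - _ = (sp w1 D psi - sp w1 (seq.filter [predC F] D) psi) -
   (sp w2 D psi - sp w2 (seq.filter [predC F] D) psi)); last by rewrite e; ring.
by apply: (le_trans (ler_normB _ _)); apply: lerD; exact: h.
Qed.

(** After approximating [u] by a function of the coordinates in [F], its translate by [t] only
    involves those in [t F]. As this set moves to infinity with [t], weights that vanish at infinity
    do not see it. *)
Lemma spec_agree_mulr u (r : R) : dmeasurable u -> 0 < r ->
  exists F, forall t w D psi (k : R), dmeasurable w -> (forall S, 0 <= psi S <= 1) ->
  (forall S, `|psi S - psi (seq.filter [predC [seq (t * g)%g | g <- F]] S)| <= k) ->
  `|sp (fun x => w x * u (sh t^-1 x))%g D psi - sp w D psi| <= r + (k + k).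
Proof.
move=> mu' r0; have [d d_gt0 hd] := spec_agree_tv r0.
have [F [v [mv dv uv]]] := determined_approx mu_power cL mu' d_gt0.
exists F => t w D psi k mw p01 hk.
have mut := dmeasurable_shift t^-1%g mu'; have mvt := dmeasurable_shift t^-1%g mv.
have dvt : determined [seq (t * g)%g | g <- F] (fun x => v (sh t^-1%g x)).
  move=> x y xy; apply: dv => g gF; rewrite /bernoulli_shift invgK.
  by apply: xy; exact: map_f.
rewrite (_ : _ - _ = (sp (fun x => w x * u (sh t^-1 x))%g D psi -
   sp (fun x => w x * v (sh t^-1 x))%g D psi) +
   (sp (fun x => w x * v (sh t^-1 x))%g D psi - sp w D psi)); last by ring.
apply: (le_trans (ler_normD _ _)); apply: lerD.
  apply: hd => //; [exact: dmeasurable_mul|exact: dmeasurable_mul|].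
  have mS := measurable_neq_dmeasurable cL mu' mv.
  apply: le_trans uv; rewrite -(mp_pr (mp_shift t^-1%g) mS); apply: pr_le.
  - by apply: measurable_neq_dmeasurable => //; exact: dmeasurable_mul.
  - exact: measurable_preimage (mp_shift t^-1%g).1 mS.
  - by move=> x /=; apply: contra_not => ->.
apply: (spec_agree_eq_off D _ mw _ hk); first exact: dmeasurable_mul.
by move=> A hA; exact: (agree_mulr w dvt hA).
Qed.

(** Here the set to be discarded stays in place, which is why the weights will be chosen small on
    it. *)
Lemma spec_agree_mull u (r : R) : dmeasurable u -> 0 < r ->
  exists F, forall w D psi (k : R), dmeasurable w -> (forall S, 0 <= psi S <= 1) ->
  (forall S, `|psi S - psi (seq.filter [predC F] S)| <= k) ->
  `|sp (fun x => u x * w x)%g D psi - sp w D psi| <= r + (k + k).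
Proof.
move=> mu' r0; have [d d_gt0 hd] := spec_agree_tv r0.
have [F [v [mv dv uv]]] := determined_approx mu_power cL mu' d_gt0.
exists F => w D psi k mw p01 hk.
rewrite (_ : _ - _ = (sp (fun x => u x * w x)%g D psi -
   sp (fun x => v x * w x)%g D psi) +
   (sp (fun x => v x * w x)%g D psi - sp w D psi)); last by ring.
apply: (le_trans (ler_normD _ _)); apply: lerD.
  apply: hd => //; [exact: dmeasurable_mul|exact: dmeasurable_mul|].
  apply: le_trans uv; apply: pr_le.
  - by apply: measurable_neq_dmeasurable => //; exact: dmeasurable_mul.
  - exact: measurable_neq_dmeasurable.
  - by move=> x /=; apply: contra_not => ->.
apply: (spec_agree_eq_off D _ mw _ hk); first exact: dmeasurable_mul.
by move=> A hA; exact: (agree_mull w dv hA).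
Qed.

(** Up to probability [r] the sample stays in a fixed finite set, so enlarging [D] further has
    little effect. This replaces the construction of the sample in all of [G]. *)
Lemma spec_agree_stable w (r : R) : dmeasurable w -> 0 < r ->
  exists D0, uniq D0 /\ forall D psi, uniq D -> {subset D0 <= D} -> symmetric psi ->
  (forall S, 0 <= psi S <= 1) -> `|sp w D psi - sp w D0 psi| <= r.
Proof.
move=> mw r0; have [F hF] := disagree_small mu_power cL mw r0.
exists (undup F); split; first exact: undup_uniq.
move=> D psi uD FD psym p01.
pose psi1 S := psi (seq.filter (mem F) S).
(* The indicator that the sample leaves [F]; its expectation is an influence of a set disjoint from
   [F]. *)
pose ind S : R := 1 - (~~ has [predC F] S)%:R.
have e : sp w (undup F) psi = sp w D psi1.
  rewrite /psi1 spec_filter; apply: spec_perm => //.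
  apply: uniq_perm; rewrite ?undup_uniq ?filter_uniq// => g.
  rewrite mem_filter mem_undup /=; case: (boolP (g \in F)) => //= gF.
  by rewrite FD// mem_undup.
have p1 S : psi S <= psi1 S + ind S /\ psi1 S <= psi S + ind S.
  have /andP[a0 a1] := p01 S; have /andP[b0 b1] := p01 (seq.filter (mem F) S).
  rewrite /ind /psi1; case: (boolP (has [predC F] S)) => hS /=; first by split; lra.
  have -> : seq.filter (mem F) S = S.
    apply/all_filterP/allP => g gS /=; apply/negPn/negP => gF.
    by move/hasPn : hS => /(_ g gS) /=; rewrite gF.
  by split; lra.
have ir : sp w D ind <= r.
  rewrite (_ : ind = (fun S => -1 * (~~ has [predC F] S)%:R + 1)); last first.
    by apply/funext => S; rewrite /ind mulN1r addrC.
  rewrite spec_lin spec_cst agree0 spec_avoid mulN1r mul1r addrC.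
  rewrite -(disagreeE mu_power cL _ mw); apply: hF => g gF /=.
  by rewrite gF andbF.
have i01 S : 0 <= ind S <= 1.
  by rewrite /ind; case: has => /=; rewrite ?subr0 ?subrr ler01 ?lexx.
have one psi2 psi3 : (forall S, 0 <= psi2 S <= 1) -> (forall S, 0 <= psi3 S <= 1) ->
    (forall S, psi2 S <= psi3 S + ind S) -> sp w D psi2 <= sp w D psi3 + r.
  move=> p2 p3 h.
  have := @spec_agree_ge0 _ _ _ _ _ _ mu_power _ cL w D
    (fun S => -1 * psi2 S + (1 * psi3 S + ind S)) 2 mw.
  rewrite !spec_lin !mul1r mulN1r => h'.
  have : 0 <= - sp w D psi2 + (sp w D psi3 + sp w D ind).
    apply: h' => S; have := h S; have := p2 S; have := p3 S; have := i01 S; lra.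
  rewrite addrC subr_ge0 => /le_trans; apply; by rewrite lerD2l.
have p01' S : 0 <= psi1 S <= 1 by exact: p01.
rewrite e ler_distl; apply/andP; split.
  by rewrite lerBlDr; apply: one => // S; case: (p1 S).
by apply: one => // S; case: (p1 S).
Qed.

End SpectralStability.

(** * The influence of sets near infinity *)

Lemma dist_chain3 (R : realDomainType) (a a' b b' r1 r2 r3 : R) :
  `|a - a'| <= r1 -> `|a' - b'| <= r2 -> `|b - b'| <= r3 ->
  `|a - b| <= r1 + r2 + r3.
Proof.
move=> h1 h2 h3; rewrite (_ : a - b = (a - a') + (a' - b') - (b - b')); last by ring.
apply: (le_trans (ler_normB _ _)); apply: lerD => //.
by apply: (le_trans (ler_normD _ _)); exact: lerD.
Qed.

Lemma seven_sixteenths (R : realFieldType) (e : R) : 0 < e ->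
  e / 16 + (e / 16 + (2 * (e / 16) + 2 * (e / 16))) + e / 16 < e.
Proof. lra. Qed.

Section WeightedMean.
Context {R : realType} {d0 : measure_display} {X0 : measurableType d0}.
Context {G : groupType}.
Let X := power_space X0 G.
Variables (mu0 : probability X0 R) (mu : probability X R).
Hypothesis mu_power : is_power_measure mu0 mu.
Context {L : groupType}.
Hypothesis cL : countable [set: L].
Implicit Types (u v w : X -> L) (D S F : seq G) (psi : seq G -> R) (f : G -> R).

Local Notation sh := (@bernoulli_shift d0 X0 G).
Local Notation sp w D psi := (spec (agree mu w) D pred0 psi).

Variable E : nat -> seq G.
Hypothesis EP : exhaustion E.

(** The ultralimit makes this linear in bounded [psi]. For symmetric [psi] with values in [0,1] it
    is a limit along all finite sets, by [spec_lim_close]. *)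
Definition spec_lim w psi : R := ulim (fun n => sp w (E n) psi).

Lemma spec_agree_bound w D psi (B : R) : dmeasurable w ->
  (forall S, `|psi S| <= B) -> `|sp w D psi| <= B.
Proof.
move=> mw pB; rewrite -[sp w D psi]subr0 -(mul0r (agree mu w pred0)).
rewrite -(spec_cst (agree mu w) D pred0 0).
by apply: (spec_agree_psi_close mu_power) => // S; rewrite subr0.
Qed.

Lemma bdd_spec w psi (B : R) : dmeasurable w -> (forall S, `|psi S| <= B) ->
  bdd_fun (fun n => sp w (E n) psi).
Proof. by move=> mw pB; exists B => n; exact: spec_agree_bound. Qed.

Lemma norm_le1 psi : (forall S, 0 <= psi S <= 1) -> forall S, `|psi S| <= 1.
Proof. by move=> p01 S; have /andP[p0 p1] := p01 S; rewrite ger0_norm. Qed.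

Lemma spec_lim_close w (r : R) : dmeasurable w -> 0 < r ->
  exists D0, forall D psi, uniq D -> {subset D0 <= D} -> symmetric psi ->
  (forall S, 0 <= psi S <= 1) -> `|spec_lim w psi - sp w D psi| <= r.
Proof.
move=> mw r0; have r2 : 0 < r / 2 by rewrite divr_gt0.
have [D0 [uD0 hD0]] := spec_agree_stable mu_power cL mw r2.
exists D0 => D psi uD D0D psym p01.
have [N hN] := exhaustion_seq EP D0.
have h1 : `|spec_lim w psi - sp w D0 psi| <= r / 2.
  apply: (@ulim_dist_near _ _ _ _ N).
    by apply: (bdd_spec mw) => S; exact: norm_le1.
  move=> n Nn; apply: hD0 => //; first exact: exhaustion_uniq.
  by move=> g /hN; exact: (exhaustion_mono EP Nn).
have h2 := hD0 D psi uD D0D psym p01.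
rewrite (_ : _ - _ = (spec_lim w psi - sp w D0 psi) - (sp w D psi - sp w D0 psi)); last by ring.
by rewrite [leRHS]splitr; apply: (le_trans (ler_normB _ _)); exact: lerD.
Qed.

Lemma wavg_bound (tau f : G -> R) (B : R) S : (forall g, 0 <= tau g) ->
  (forall g, `|f g| <= B) -> `|wavg tau f S| <= B.
Proof.
move=> t0 fB; have m0 := max1_gt0 (mass tau S).
rewrite /wavg normrM normfV (gtr0_norm m0) ler_pdivrMr//.
have B0 : 0 <= B by exact: le_trans (normr_ge0 _) (fB 1%g).
apply: (@le_trans _ _ (B * mass tau S)); last first.
  by rewrite ler_wpM2l// le_max lexx orbT.
rewrite /mass mulr_sumr; apply: (le_trans (ler_norm_sum _ _ _)).
by apply: ler_sum => g _; rewrite normrM (ger0_norm (t0 g)) mulrC ler_wpM2r.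
Qed.

Section Cocycle.
Variable w : G -> X -> L.

(* [w t x] stands for [c (t, t^-1 x)], where [c] is a cocycle in the usual sense. *)
Definition is_cocycle : Prop := (forall t, dmeasurable (w t)) /\
  forall s t x, w (s * t)%g x = (w s x * w t (sh s^-1 x))%g.

Hypothesis wP : is_cocycle.

Let mw t : dmeasurable (w t). Proof. exact: wP.1. Qed.

Let wM s t : w (s * t)%g = (fun x => w s x * w t (sh s^-1 x))%g.
Proof. by apply/funext => x; exact: wP.2. Qed.

Variable tau : G -> R.
Hypothesis tau0 : forall g, 0 <= tau g.
Hypothesis tau_c0 : forall d : R, 0 < d -> finite_set [set g | d <= tau g].

Definition weighted f (t : G) : R := spec_lim (w t) (wavg tau f).

Lemma weighted_lin (c : R) f f' : bdd_fun f -> bdd_fun f' ->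
  weighted (fun g => c * f g + f' g) = (fun t => c * weighted f t + weighted f' t).
Proof.
move=> [B fB] [B' fB']; apply/funext => t; rewrite /weighted /spec_lim -ulim_lin.
- congr ulim; apply/funext => n; rewrite -spec_lin; congr spec.
  by apply/funext => S; exact: wavg_lin.
- by apply: (@bdd_spec _ _ B) => // S; exact: wavg_bound.
- by apply: (@bdd_spec _ _ B') => // S; exact: wavg_bound.
Qed.

Lemma weighted_ge0 f t : bdd_fun f -> (forall g, 0 <= f g) -> 0 <= weighted f t.
Proof.
move=> [B fB] f0; apply: (@ulim_ge_near _ _ _ 0%N).
  by apply: (@bdd_spec _ _ B) => // S; exact: wavg_bound.
move=> n _; apply: (@spec_agree_ge0 _ _ _ _ _ _ mu_power _ cL _ _ _ B) => // S.
have := wavg_bound S tau0 fB; rewrite ler_norml => /andP[_ ->]; rewrite andbT.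
rewrite divr_ge0//; first by apply: mass_ge0 => g; rewrite mulr_ge0.
exact: ltW (max1_gt0 _).
Qed.

Lemma weighted_bound f (B : R) t : (forall g, `|f g| <= B) -> `|weighted f t| <= B.
Proof.
move=> fB; rewrite -[weighted f t]subr0; apply: (@ulim_dist_near _ _ _ _ 0%N).
  by apply: (@bdd_spec _ _ B) => // S; exact: wavg_bound.
move=> n _; rewrite subr0; apply: (spec_agree_bound _ (mw t)) => S; exact: wavg_bound.
Qed.

Let wavg_ok f : (forall g, 0 <= f g <= 1) ->
  symmetric (wavg tau f) /\ forall S, 0 <= wavg tau f S <= 1.
Proof. by move=> f01; split; [exact: wavg_symmetric|move=> S; exact: wavg01]. Qed.

(** Passing from [w s] to [w (s t)] multiplies by the translate of [w t], which essentially depends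
    on the coordinates in [s F]; the weights there are small for all but finitely many [s]. *)
Lemma weighted_slow01 f : (forall g, 0 <= f g <= 1) -> slowly_varying (weighted f).
Proof.
move=> f01; have [psym p01] := wavg_ok f01.
split; first by exists 1 => t; apply: weighted_bound => g;
  have /andP[f0 f1] := f01 g; rewrite ger0_norm.
move=> t e e0; have r0 : 0 < e / 16 by rewrite divr_gt0.
have [F hF] := spec_agree_mulr mu_power cL (mw t) r0.
have q0 : 0 < e / 16 / (size F).+1%:R by rewrite divr_gt0.
apply: (@sub_finite_set _ _ (\bigcup_(h in [set` F])
  [set s | e / 16 / (size F).+1%:R <= tau (s * h)%g])); last first.
  apply: bigcup_finite; first exact: finite_seq.
  move=> h _; apply: (@finite_preimage _ _ [set g | e / 16 / (size F).+1%:R <= tau g]).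
    by move=> x y _ _; exact: mulIg.
  exact: tau_c0.
move=> s /= es; apply: contrapT => hs.
have small h : h \in F -> tau (s * h)%g <= e / 16 / (size F).+1%:R.
  move=> hF'; rewrite leNgt; apply/negP => h'; apply: hs; exists h => //=.
  exact: ltW.
have sum_small : \sum_(g <- [seq (s * h)%g | h <- F]) tau g <= e / 16.
  rewrite big_map; apply: (@le_trans _ _ (\sum_(h <- F) e / 16 / (size F).+1%:R)).
    by rewrite big_seq [leRHS]big_seq; apply: ler_sum => h; exact: small.
  rewrite big_const_seq count_predT iter_addr_0 -[_ *+ size F]mulr_natr -[leLHS]mulrA.
  by rewrite ler_piMr ?(ltW r0)// mulrC ler_pdivrMr// mul1r ler_nat.
have [D1 h1] := spec_lim_close (mw s) r0.
have [D2 h2] := spec_lim_close (mw (s * t)%g) r0.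
have [N hN] := exhaustion_seq EP (D1 ++ D2).
have uN := exhaustion_uniq EP N.
have {}h1 : `|weighted f s - sp (w s) (E N) (wavg tau f)| <= e / 16.
  by apply: h1 => // g gD; apply: hN; rewrite mem_cat gD.
have {}h2 : `|weighted f (s * t)%g - sp (w (s * t)%g) (E N) (wavg tau f)| <= e / 16.
  by apply: h2 => // g gD; apply: hN; rewrite mem_cat gD orbT.
have h3 := hF s (w s) (E N) (wavg tau f) (2 * (e / 16)) (mw s) p01.
rewrite -wM in h3.
have {}h3 : `|sp (w (s * t)%g) (E N) (wavg tau f) - sp (w s) (E N) (wavg tau f)|
    <= e / 16 + (2 * (e / 16) + 2 * (e / 16)).
  apply: h3 => S; apply: (le_trans (wavg_filter_dist _ S tau0 f01)).
  by rewrite ler_wpM2l.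
move: es; apply/negP; rewrite -ltNge; rewrite distrC in h3.
by apply: (le_lt_trans (dist_chain3 h1 h3 h2)); exact: seven_sixteenths.
Qed.

End Cocycle.

End WeightedMean.

Lemma dist_chain5 (R : realDomainType) (a b c d e f r1 r2 r3 r4 r5 : R) :
  `|a - b| <= r1 -> `|b - c| <= r2 -> `|c - d| <= r3 -> `|d - e| <= r4 ->
  `|f - e| <= r5 -> `|a - f| <= r1 + r2 + r3 + r4 + r5.
Proof.
move=> h1 h2 h3 h4 h5.
rewrite (_ : a - f = (a - b) + (b - c) + (c - d) + (d - e) - (f - e)); last by ring.
apply: (le_trans (ler_normB _ _)); apply: lerD => //.
do 3 (apply: (le_trans (ler_normD _ _)); apply: lerD => //).
Qed.

Lemma sum_fractions_le (R : realFieldType) (k : R) : 0 < k ->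
  k / 16 + 0 + (k / 16 + (2 * (k / 16) + 2 * (k / 16))) + 2 * (k / 16) + k / 16 <= k.
Proof. lra. Qed.

(** * Almost equivariance and the mean influence *)

Section Star.
Context {R : realType} {d0 : measure_display} {X0 : measurableType d0}.
Context {G : groupType}.
Hypothesis cG : countable [set: G].
Let X := power_space X0 G.
Variables (mu0 : probability X0 R) (mu : probability X R).
Hypothesis mu_power : is_power_measure mu0 mu.
Context {L : groupType}.
Hypothesis cL : countable [set: L].
Implicit Types (u v : X -> L) (D S F : seq G) (psi : seq G -> R) (f : G -> R).

Local Notation sh := (@bernoulli_shift d0 X0 G).
Local Notation sp w D psi := (spec (agree mu w) D pred0 psi).

Lemma disagree_mulr_le u v (A : pred G) : dmeasurable u -> dmeasurable v ->
  `|disagree mu (fun x => u x * v x)%g A - disagree mu u A| <= disagree mu v A.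
Proof.
move=> mu' mv; have muv := dmeasurable_mul cL mu' mv.
have m1 := measurable_disagree mu_power cL A mu'.
have m2 := measurable_disagree mu_power cL A mv.
have m3 := measurable_disagree mu_power cL A muv.
rewrite ler_distl lerBlDr; apply/andP; split; rewrite /disagree.
  apply: le_trans (prU_le _ m3 m2); apply: pr_le => //; first exact: measurableU.
  move=> z /= h; have [e|ne] := pselect (v (resample A z.1 z.2) = v z.1); last by right.
  by left => h'; apply: h; move: h'; rewrite e; exact: mulIg.
apply: le_trans (prU_le _ m1 m2); apply: pr_le => //; first exact: measurableU.
move=> z /= h; have [e|ne] := pselect (v (resample A z.1 z.2) = v z.1); last by right.
by left => h'; apply: h; rewrite e h'.
Qed.

Lemma disagree_shift u t (A : pred G) : dmeasurable u ->
  disagree mu (fun x => u (sh t x)) A = disagree mu u (fun g => A (t^-1 * g)%g).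
Proof.
move=> mu'; rewrite !(disagreeE mu_power cL)//; last exact: (dmeasurable_shift mu_power).
by congr (1 - _); exact: (agree_shift mu_power).
Qed.

Lemma finite_not_disjoint (F A : seq G) :
  finite_set [set t : G | ~ (forall g, g \in F -> (t * g)%g \notin A)].
Proof.
apply: (@sub_finite_set _ _ [set` [seq (a * g^-1)%g | a <- A, g <- F]]); last exact: finite_seq.
move=> t /= h; apply/negPn/negP => ht; apply: h => g gF; apply/negP => tA.
move/negP : ht; apply; apply/allpairsP; exists ((t * g)%g, g); split=> //=.
by rewrite mulgK.
Qed.

Variable w : G -> X -> L.
Hypothesis wP : is_cocycle w.

Let mw t : dmeasurable (w t). Proof. exact: wP.1. Qed.

Let wM s t : w (s * t)%g = (fun x => w s x * w t (sh s^-1 x))%g.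
Proof. by apply/funext => x; exact: wP.2. Qed.

(** The translate of [w t] by [s] is hardly influenced by [A] once [s F] misses [A], where [F] is a
    finite set carrying most of [w t]; only finitely many [s] fail this. *)
Lemma disagree_slow (A : seq G) :
  slowly_varying (fun t => disagree mu (w t) (fun g => g \in A)).
Proof.
split.
  exists 1 => t; rewrite ger0_norm ?disagree_ge0//.
  exact: (disagree_le1 mu_power cL).
move=> t e e0; have e2 : 0 < e / 2 by rewrite divr_gt0.
have [F hF] := disagree_small mu_power cL (mw t) e2.
apply: sub_finite_set (finite_not_disjoint F A) => s /= es hs.
move: es; apply/negP; rewrite -ltNge wM distrC.
have h : disagree mu (fun x => w t (sh s^-1 x))%g (fun g => g \in A) <= e / 2.
  rewrite disagree_shift//; apply: hF => g gF; rewrite invgK; exact: hs.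
apply: le_lt_trans (le_trans (disagree_mulr_le _ (mw s) _) h) _.
  by apply: (dmeasurable_shift mu_power).
by rewrite ltr_pdivrMr// ltr_pMr// ltr1n.
Qed.

Section Weights.
Variable E : nat -> seq G.
Hypothesis EP : exhaustion E.
Variable tau : G -> R.
Hypothesis tau0 : forall g, 0 <= tau g.
Hypothesis tau_c0 : forall d : R, 0 < d -> finite_set [set g | d <= tau g].

Let weight f := weighted mu E w tau f.

Lemma weighted_slow f : bdd_fun f -> slowly_varying (weight f).
Proof.
move=> [B fB]; pose A := `|B| + 1.
have A0 : 0 < A by rewrite /A ltr_wpDl.
pose h g := (2 * A)^-1 * f g + 2^-1.
have h01 g : 0 <= h g <= 1.
  have : `|f g| <= A by apply: (le_trans (fB g)); rewrite /A (le_trans (ler_norm _))// lerDl.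
  rewrite ler_norml => /andP[l u].
  rewrite /h invfM -mulrA [A^-1 * _]mulrC.
  have l' : -1 <= f g / A by rewrite ler_pdivlMr// mulN1r.
  have u' : f g / A <= 1 by rewrite ler_pdivrMr// mul1r.
  by apply/andP; split; lra.
have fE : f = (fun g => (2 * A) * h g + (- A) * 1).
  apply/funext => g; rewrite /h mulrDr mulVKf ?gt_eqF ?mulr_gt0// mulr1.
  by rewrite mulrAC divff ?mul1r ?addrK.
have f1 : bdd_fun (fun _ : G => 1 : R) by exact: bdd_cst.
have f0 : bdd_fun (fun _ : G => 0 : R) by exact: bdd_cst.
have w1 : slowly_varying (weight (fun=> 1)).
  by apply: (weighted_slow01 mu_power cL EP wP tau0 tau_c0) => // g; rewrite ler01 lexx.
have w0 : slowly_varying (weight (fun=> 0)).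
  by apply: (weighted_slow01 mu_power cL EP wP tau0 tau_c0) => // g; rewrite ler01 lexx.
have e : weight f = (fun t => 2 * A * weight h t + (- A * weight (fun=> 1) t + weight (fun=> 0) t)).
  have e1 := weighted_lin mu_power cL E wP tau0 (- A) f1 f0.
  have e2 := weighted_lin mu_power cL E wP tau0 (2 * A) (bdd01 h01) (bdd_lin (- A) f1 f0).
  rewrite -/(weight _) in e1; rewrite -/(weight _) in e2.
  apply/funext => t; rewrite -[X in _ = _ + X](congr1 (fun q => q t) e1).
  rewrite -[RHS](congr1 (fun q => q t) e2); congr (weight _ t).
  by rewrite [LHS]fE; apply/funext => g; rewrite addr0.
rewrite e; apply: slowly_varying_lin; last exact: slowly_varying_lin.
exact: (weighted_slow01 mu_power cL EP wP tau0 tau_c0).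
Qed.

Lemma weighted_shift f s (k : R) : 0 < k -> (forall g, 0 <= f g <= 1) ->
  (forall F, (forall D psi (v : X -> L) (k' : R), dmeasurable v ->
     (forall S, 0 <= psi S <= 1) ->
     (forall S, `|psi S - psi (seq.filter [predC F] S)| <= k') ->
     `|sp (fun x => w s x * v x)%g D psi - sp v D psi| <= k / 16 + (k' + k')) ->
   \sum_(g <- F) tau g <= k / 16 ->
   (forall g, `|tau g - tau (s * g)%g| <= k / 16 * tau g) ->
  forall t, `|weight f (s * t)%g - weight (fun g => f (s * g)%g) t| <= k).
Proof.
move=> k0 f01 F hF tauF taus t; have r0 : 0 < k / 16 by rewrite divr_gt0.
have fs01 g : 0 <= f (s * g)%g <= 1 by exact: f01.
have [D1 h1] := spec_lim_close mu_power cL EP (mw (s * t)%g) r0.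
have [D2 h2] := spec_lim_close mu_power cL EP (mw t) r0.
have [N hN] := exhaustion_seq EP ([seq (s^-1 * g)%g | g <- D1] ++ D2).
pose D' := E N; pose D := [seq (s * g)%g | g <- D'].
have uD' : uniq D' by exact: exhaustion_uniq.
have uD : uniq D by rewrite map_inj_uniq//; exact: mulgI.
have D1D : {subset D1 <= D}.
  move=> g gD; rewrite -(mulVKg s g); apply: map_f; apply: hN.
  by rewrite mem_cat map_f.
have D2D : {subset D2 <= D'} by move=> g gD; apply: hN; rewrite mem_cat gD orbT.
have wt : dmeasurable (fun x => w t (sh s^-1 x)) by exact: (dmeasurable_shift mu_power).
have {}h1 : `|weight f (s * t)%g - sp (w (s * t)%g) D (wavg tau f)| <= k / 16.
  by apply: h1 => // [|S]; [exact: wavg_symmetric|exact: wavg01].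
have {}h2 : `|weight (fun g => f (s * g)%g) t -
    sp (w t) D' (wavg tau (fun g => f (s * g)%g))| <= k / 16.
  by apply: h2 => // [|S]; [exact: wavg_symmetric|exact: wavg01].
have h3 : `|sp (w (s * t)%g) D (wavg tau f) -
    sp (fun x => w t (sh s^-1 x)) D (wavg tau f)| <= k / 16 + (2 * (k / 16) + 2 * (k / 16)).
  rewrite wM; apply: hF => // S; first exact: wavg01.
  apply: (le_trans (wavg_filter_dist F S tau0 f01)); by rewrite ler_wpM2l.
have h4 : sp (fun x => w t (sh s^-1 x)) D (wavg tau f) =
    sp (w t) D' (wavg (tau \o *%g s) (fun g => f (s * g)%g)).
  rewrite /D (spec_map (s := agree mu (w t)) (f := fun g => (s * g)%g)).
  - congr spec; apply/funext => S; rewrite /= wavg_map//; exact: mulgI.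
  - exact: mulgI.
  - by move=> B; rewrite (agree_shift mu_power cL)// invgK.
have h5 : `|sp (w t) D' (wavg (tau \o *%g s) (fun g => f (s * g)%g)) -
    sp (w t) D' (wavg tau (fun g => f (s * g)%g))| <= 2 * (k / 16).
  apply: (spec_agree_psi_close mu_power cL) => // S; rewrite distrC.
  by apply: wavg_close => // [|g]; [exact: ltW|exact: tau0].
(* A trivial link, so that the estimates fit [dist_chain5]. *)
have h6 : `|sp (w (s * t)%g) D (wavg tau f) - sp (w (s * t)%g) D (wavg tau f)| <= 0.
  by rewrite subrr normr0.
rewrite h4 in h3.
exact: le_trans (dist_chain5 h1 h6 h3 h5 h2) (sum_fractions_le k0).
Qed.

End Weights.

Variable ph : (G -> R) -> R.
Hypothesis phP : invariant_mean ph.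

(* If the averaged influence did not vanish at infinity, the weighted averages over
   the spectral samples, averaged by [ph], would be almost invariant means on [G]. *)
Lemma mean_disagree_small (e : R) : ~ amenable R G -> 0 < e ->
  exists F : seq G, forall A : seq G, (forall g, g \in A -> g \notin F) ->
  ph (fun t => disagree mu (w t) (fun g => g \in A)) <= e.
Proof.
move=> nam e0; apply: contrapT => hne; apply: nam.
have {}hne F : exists A : seq G, (forall g, g \in A -> g \notin F) /\
    e < ph (fun t => disagree mu (w t) (fun g => g \in A)).
  apply: contrapT => h; apply: hne; exists F => A AF.
  by rewrite leNgt; apply/negP => hA; apply: h; exists A.
have [E EP] := exhaustion_ex cG.
apply: (amenable_of_almost_means cG e0) => K k k0.
have r0 : 0 < k / 16 by rewrite divr_gt0.
have hFs s : exists F, forall v D psi (k' : R), dmeasurable v ->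
     (forall S, 0 <= psi S <= 1) ->
     (forall S, `|psi S - psi (seq.filter [predC F] S)| <= k') ->
     `|sp (fun x => w s x * v x)%g D psi - sp v D psi| <= k / 16 + (k' + k').
  exact: (spec_agree_mull mu_power cL (mw s) r0).
pose Fs s := sval (cid (hFs s)).
have FsP s v D psi (k' : R) : dmeasurable v -> (forall S, 0 <= psi S <= 1) ->
     (forall S, `|psi S - psi (seq.filter [predC (Fs s)] S)| <= k') ->
     `|sp (fun x => w s x * v x)%g D psi - sp v D psi| <= k / 16 + (k' + k').
  by rewrite /Fs; case: cid => ? /= h; exact: h.
(* One weight serves all of [K]: it is small on the sets attached to every [w s] with [s] in [K],
   and equal to 1 on a set [A] further away whose mean influence exceeds [e]. *)
have [F' hF'] := slow_weight_ex K (flatten [seq Fs s | s <- K]) cG r0 r0.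
have [A [AF' Ae]] := hne F'.
have [tau [tau0 tauA tauF tau_c0 tauK]] := hF' A AF'.
have bd1 : bdd_fun (fun _ : G => 1 : R) by exact: bdd_cst.
exists (fun f => ph (weighted mu E w tau f)); split.
- move=> a f g bf bg; rewrite (weighted_lin mu_power cL E wP tau0)//.
  by apply: (mean_lin phP); exact: weighted_slow.
- move=> f bf f0; apply: (mean_ge0 phP); first exact: weighted_slow.
  by move=> t; exact: (weighted_ge0 mu_power cL E wP tau0).
- have s1 := weighted_slow EP tau0 tau_c0 bd1.
  apply/andP; split.
    apply: (le_trans (ltW Ae)); apply: (mean_le phP) => //; first exact: disagree_slow.
    move=> t; have [N hN] := exhaustion_seq EP A.
    apply: (@ulim_ge_near _ _ _ N).
      apply: (@bdd_spec _ _ _ _ _ _ mu_power _ cL E _ _ 1 (mw t)) => S.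
      by apply: wavg_bound => // g; rewrite normr1.
    move=> n Nn.
    (* The influence of [A] is the probability that the sample meets [A]; on that event the average
       of 1 equals 1, because [tau] is 1 on [A]. The mass is therefore at least [e]. *)
    have -> : disagree mu (w t) (fun g => g \in A) =
        sp (w t) (E n) (fun S => -1 * (~~ has (mem A) S)%:R + 1).
      rewrite spec_lin spec_cst agree0 spec_avoid mulN1r mul1r addrC.
      rewrite (disagreeE mu_power cL)//; congr (1 - agree _ _ _).
      apply/funext => g /=; case: (boolP (g \in A)) => gA; last by rewrite andbF.
      by rewrite andbT (exhaustion_mono EP Nn (hN g gA)).
    set ind := (X in spec _ _ _ X <= _).
    have lin := spec_lin (agree mu (w t)) (-1) (E n) pred0 ind (wavg tau (fun=> 1)).
    rewrite mulN1r addrC in lin; rewrite -subr_ge0 -lin /ind.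
    apply: (@spec_agree_ge0 _ _ _ _ _ _ mu_power _ cL _ _ _ 1) => // S.
    have /andP[a0 a1] : 0 <= wavg tau (fun=> 1) S <= 1.
      by apply: wavg01 => // g; rewrite ler01 lexx.
    case: (boolP (has (mem A) S)) => /= hS; last first.
      by rewrite mulr1 addNr mulr0 add0r a0 a1.
    move/hasP : hS => [g gS gA]; rewrite (wavg_one_ge tau0 (tauA g gA) gS).
    by rewrite mulr0 add0r mulr1 addNr lexx ler01.
  rewrite -[leRHS](mean_cst phP); apply: (mean_le phP) => //.
    exact: slowly_varying_cst.
  move=> t; apply: (le_trans (ler_norm _)); apply: (weighted_bound mu_power cL E wP tau0).
  by move=> g; rewrite normr1.
move=> f s f01 sK.
have bf := bdd01 f01; have bfs : bdd_fun (fun g => f (s * g)%g) by exact: bdd01.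
have sf := weighted_slow EP tau0 tau_c0 bf.
have sfs := weighted_slow EP tau0 tau_c0 bfs.
rewrite -(mean_shift phP s sf).
have sfS := slowly_varying_shift s sf.
apply: (mean_dist_cst phP sfs sfS) => t; rewrite distrC.
apply: (weighted_shift EP tau0 k0 f01 (F := Fs s)).
- by move=> D psi v k' mv; exact: FsP.
- apply: le_trans tauF; elim: K sK {hF' F' AF' tauK} => // s' K IH; rewrite inE.
  move=> /predU1P[->|sK] /=; rewrite big_cat /=.
    by rewrite lerDl; apply: sumr_ge0 => g _.
  by apply: (le_trans (IH sK)); rewrite lerDr; apply: sumr_ge0 => g _.
- by move=> g; exact: tauK.
Qed.

End Star.

(** * Mixing *)

Section Vanishing.
Context {R : realType} {G : choiceType}.
Implicit Types f g : G -> R.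

Definition vanishing f : Prop := forall e : R, 0 < e -> finite_set [set t | e <= `|f t|].

Lemma vanishing_le f g : (forall t, `|f t| <= `|g t|) -> vanishing g -> vanishing f.
Proof.
move=> fg vg e e0; apply: sub_finite_set (vg e e0) => t /= h.
exact: le_trans h (fg t).
Qed.

Lemma vanishingD f g : vanishing f -> vanishing g -> vanishing (fun t => f t + g t).
Proof.
move=> vf vg e e0; have e2 : 0 < e / 2 by rewrite divr_gt0.
apply: (@sub_finite_set _ _ ([set t | e / 2 <= `|f t|] `|` [set t | e / 2 <= `|g t|])).
  move=> t /= h; apply/orP; rewrite -implyNb -ltNge; apply/implyP => h1.
  rewrite leNgt; apply/negP => h2; move: h; apply/negP; rewrite -ltNge.
  by apply: (le_lt_trans (ler_normD _ _)); rewrite [ltRHS]splitr ltrD.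
by rewrite finite_setU; split; [exact: vf|exact: vg].
Qed.

Lemma vanishingMl f g (B : R) : (forall t, `|f t| <= B) -> vanishing g ->
  vanishing (fun t => f t * g t).
Proof.
move=> fB vg e e0; have B1 : 0 < `|B| + 1 by rewrite ltr_wpDl.
apply: sub_finite_set (vg (e / (`|B| + 1)) (divr_gt0 e0 B1)) => t /= h.
rewrite ler_pdivrMr// mulrC; apply: (le_trans h); rewrite normrM ler_wpM2r//.
by apply: (le_trans (fB t)); apply: (le_trans (ler_norm _)); rewrite lerDl.
Qed.

Section Dynkin.
Context d (T : measurableType d) (P : probability T R).
Variable (Gs : set (set T)).
Hypotheses (GsE : @measurable _ T = <<s Gs >>) (GsI : setI_closed Gs).
Variable F : G -> set T -> R.
Hypothesis FU : forall t A B, measurable A -> measurable B -> A `&` B = set0 ->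
  F t (A `|` B) = F t A + F t B.
Hypothesis FP : forall t A, measurable A -> `|F t A| <= pr P A.
Hypothesis FT : forall t, F t setT = 0.
Hypothesis FG : forall A, Gs A -> vanishing (F^~ A).

(** The Dynkin argument for a family of set functions. Domination by [P], uniform in [t], controls
    the tails of countable unions, and vanishing on the whole space gives complements. *)
Lemma vanishing_dynkin A : measurable A -> vanishing (F^~ A).
Proof.
have F0 t : F t set0 = 0.
  by apply/eqP; rewrite -normr_le0 -(pr0 P); exact: FP.
move=> mA; have : <<s Gs >> A by rewrite -GsE.
apply: (@dynkin_induction _ T Gs (fun A => vanishing (F^~ A))) => //.
- move=> e e0; rewrite (_ : [set _ | _] = set0)//.
  by apply/seteqP; split=> // t /=; rewrite FT normr0 leNgt e0.
- move=> B mB vB; apply: vanishing_le (vB) => t.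
  have : F t (B `|` ~` B) = F t B + F t (~` B).
    by apply: FU => //; [exact: measurableC|exact: setICr].
  rewrite setUv FT => /eqP; rewrite eq_sym addrC addr_eq0 => /eqP ->.
  by rewrite normrN.
move=> B mB tB vB e e0; have e2 : 0 < e / 2 by rewrite divr_gt0.
have [N hN] := pr_bigcup_approx P mB e2.
pose U n := \big[setU/set0]_(k < n) B k.
have mU n : measurable (U n) by apply: bigsetU_measurable.
have vU n : vanishing (F^~ (U n)).
  elim: n => [|n IH].
    move=> r r0; rewrite (_ : [set _ | _] = set0)//.
    by apply/seteqP; split=> // t /=; rewrite /U big_ord0 F0 normr0 leNgt r0.
  have e' t : F t (U n.+1) = F t (U n) + F t (B n).
    rewrite /U big_ord_recr /= FU//; first exact: mU.
    apply/seteqP; split=> // x [h Bx].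
    have UE : U n = \bigcup_(k < n) B k by rewrite bigcup_mkord.
    have : U n x by [].
    rewrite UE => -[k kn Bkx]; move/trivIsetP : tB => /(_ k n I I).
    rewrite neq_ltn kn => /(_ isT) => /seteqP[/(_ x)] h' _.
    by apply: h'.
  rewrite (_ : F^~ (U n.+1) = (fun t => F t (U n) + F t (B n))); last exact/funext.
  exact: vanishingD.
have mV : measurable (\bigcup_n B n `\` U N).
  by apply: measurableD => //; exact: bigcupT_measurable.
have UsB : U N `<=` \bigcup_n B n by exact: bigsetU_bigcup.
have UV : \bigcup_n B n = U N `|` (\bigcup_n B n `\` U N).
  apply/seteqP; split=> x; last by move=> [/UsB|[]].
  by move=> h; have [|nU] := pselect (U N x); [left|right].
apply: sub_finite_set (vU N _ e2) => t /= h.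
rewrite leNgt; apply/negP => h'; move: h; apply/negP; rewrite -ltNge UV FU//; last first.
  by apply/seteqP; split=> // x [? []].
apply: (le_lt_trans (ler_normD _ _)); rewrite [ltRHS]splitr; apply: ltr_leD => //.
exact: le_trans (FP t mV) hN.
Qed.

End Dynkin.
End Vanishing.

Section Mixing.
Context {R : realType} {G : choiceType}.

Definition mixing d (T : measurableType d) (P : probability T R) (a : G -> T -> T) : Prop :=
  forall A B, measurable A -> measurable B ->
  vanishing (fun t => pr P (A `&` a t @^-1` B) - pr P A * pr P B).

Section Defect.
Context d (T : measurableType d) (P : probability T R).
Variable a : G -> T -> T.
Hypothesis aP : forall t, measure_preserving P P (a t).

Let ma t A : measurable A -> measurable (a t @^-1` A).
Proof. exact: measurable_preimage (aP t).1. Qed.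

Let defect t A B := pr P (A `&` a t @^-1` B) - pr P A * pr P B.

Lemma abs_sub_le (x y z : R) : 0 <= x <= z -> 0 <= y <= z -> `|x - y| <= z.
Proof. by rewrite ler_norml => /andP[? ?] /andP[? ?]; apply/andP; split; lra. Qed.

Let defect_bound t A B : measurable A -> measurable B ->
  `|defect t A B| <= pr P A /\ `|defect t A B| <= pr P B.
Proof.
move=> mA mB; have mB' := ma t mB.
have hA := pr_le1 P mA; have hB := pr_le1 P mB.
have [h1 h2] : pr P (A `&` a t @^-1` B) <= pr P A /\ pr P (A `&` a t @^-1` B) <= pr P B.
  split; first by apply: pr_le => //; exact: measurableI.
  by rewrite -(mp_pr (aP t) mB); apply: pr_le => //; exact: measurableI.
split; apply: abs_sub_le; rewrite ?pr_ge0//=.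
  by rewrite mulr_ge0 ?pr_ge0//= ler_piMr// pr_ge0.
by rewrite mulr_ge0 ?pr_ge0//= ler_piMl// pr_ge0.
Qed.

Let defectUr t A B B' : measurable A -> measurable B -> measurable B' ->
  B `&` B' = set0 -> defect t A (B `|` B') = defect t A B + defect t A B'.
Proof.
move=> mA mB mB' BB'; rewrite /defect preimage_setU setIUr !prU//.
- by ring.
- by apply: measurableI => //; exact: ma.
- by apply: measurableI => //; exact: ma.
- by rewrite setIACA setIid -preimage_setI BB' preimage_set0 setI0.
Qed.

Let defectUl t A A' B : measurable A -> measurable A' -> measurable B ->
  A `&` A' = set0 -> defect t (A `|` A') B = defect t A B + defect t A' B.
Proof.
move=> mA mA' mB AA'; rewrite /defect setIUl !prU//.
- by ring.
- by apply: measurableI => //; exact: ma.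
- by apply: measurableI => //; exact: ma.
- by rewrite setIACA AA' set0I.
Qed.

(** The defect of independence is additive and dominated in each variable, so the Dynkin argument
    runs in one variable at a time. *)
Lemma mixing_pi_system (Gs : set (set T)) : @measurable _ T = <<s Gs >> ->
  setI_closed Gs ->
  (forall A B, Gs A -> Gs B ->
    vanishing (fun t => pr P (A `&` a t @^-1` B) - pr P A * pr P B)) ->
  mixing P a.
Proof.
move=> GE GI hG.
have mG A : Gs A -> measurable A by move=> GA; rewrite GE; exact: sub_sigma_algebra.
have step1 A B : Gs A -> measurable B -> vanishing (fun t => defect t A B).
  move=> GA mB; have mA := mG A GA.
  apply: (@vanishing_dynkin _ _ _ _ P Gs GE GI (fun t B => defect t A B)) => //.
  - by move=> t B1 B2 m1 m2; exact: defectUr.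
  - by move=> t B1 m1; case: (defect_bound t mA m1).
  - by move=> t; rewrite /defect preimage_setT setIT prT mulr1 subrr.
  - by move=> B1 GB1; exact: hG.
move=> A B mA mB.
apply: (@vanishing_dynkin _ _ _ _ P Gs GE GI (fun t A => defect t A B)) => //.
- by move=> t A1 A2 m1 m2; exact: defectUl.
- by move=> t A1 m1; case: (defect_bound t m1 mB).
- by move=> t; rewrite /defect setTI prT mul1r (mp_pr (aP t) mB) subrr.
- by move=> A1 GA1; exact: step1.
Qed.

(** Mixing along [N] forces the measure of [A] to equal its square. *)
Lemma mixing_zero_one (N : set G) A : mixing P a -> infinite_set N -> measurable A ->
  (forall t, N t -> pr P (A `&` a t @^-1` A) = pr P A) -> pr P A = 0 \/ pr P A = 1.
Proof.
move=> mix iN mA hA.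
have : pr P A - pr P A * pr P A = 0.
  apply/eqP; rewrite -normr_le0 leNgt; apply/negP => h; apply: iN.
  apply: sub_finite_set (mix A A mA mA _ h) => t Nt /=.
  by rewrite hA.
rewrite -{1}[pr P A]mulr1 -mulrBr => /eqP; rewrite mulf_eq0 subr_eq0.
by move=> /orP[/eqP ->|/eqP <-]; [left|right].
Qed.

End Defect.

Lemma mp_product d1 d2 d3 d4 (T1 : measurableType d1) (T2 : measurableType d2)
    (T3 : measurableType d3) (T4 : measurableType d4) (P1 : probability T1 R)
    (P2 : probability T2 R) (P3 : probability T3 R) (P4 : probability T4 R)
    (f : T1 -> T3) (g : T2 -> T4) :
  measure_preserving P1 P3 f -> measure_preserving P2 P4 g ->
  measure_preserving (product_prob P1 P2) (product_prob P3 P4) (fun z => (f z.1, g z.2)).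
Proof.
move=> [mf fP] [mg gP]; apply: mp_rect.
  by apply: measurable_fun_pair; apply: measurableT_comp.
move=> A B mA mB.
rewrite (_ : _ @^-1` _ = (f @^-1` A) `*` (g @^-1` B))//.
by rewrite product_probE ?fP ?gP//; exact: measurable_preimage.
Qed.

Lemma mixing_product d d' (T : measurableType d) (T' : measurableType d')
    (P : probability T R) (Q : probability T' R) (a : G -> T -> T) (b : G -> T' -> T') :
  (forall t, measure_preserving P P (a t)) ->
  (forall t, measure_preserving Q Q (b t)) ->
  mixing P a -> mixing Q b ->
  mixing (product_prob P Q) (fun t z => (a t z.1, b t z.2)).
Proof.
move=> aP bP mixa mixb.
have mpab t : measure_preserving (product_prob P Q) (product_prob P Q)
    (fun z => (a t z.1, b t z.2)) by exact: mp_product.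
apply: (mixing_pi_system mpab (Gs := [set A `*` B | A in measurable & B in measurable])).
- exact: measurable_prod_measurableType.
- move=> _ _ [A mA [B mB <-]] [A' mA' [B' mB' <-]].
  exists (A `&` A'); first exact: measurableI.
  by exists (B `&` B'); [exact: measurableI|rewrite setXI].
move=> _ _ [A mA [B mB <-]] [A' mA' [B' mB' <-]].
have ma t : measurable (a t @^-1` A') by exact: measurable_preimage (aP t).1 mA'.
have mb t : measurable (b t @^-1` B') by exact: measurable_preimage (bP t).1 mB'.
have e t : pr (product_prob P Q) ((A `*` B) `&` (fun z => (a t z.1, b t z.2)) @^-1` (A' `*` B')) -
    pr (product_prob P Q) (A `*` B) * pr (product_prob P Q) (A' `*` B') =
    pr Q (B `&` b t @^-1` B') * (pr P (A `&` a t @^-1` A') - pr P A * pr P A') +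
    (pr P A * pr P A') * (pr Q (B `&` b t @^-1` B') - pr Q B * pr Q B').
  rewrite (_ : _ `&` _ = (A `&` a t @^-1` A') `*` (B `&` b t @^-1` B')); last first.
    by rewrite setXI.
  rewrite !pr_rect//; [by ring|exact: measurableI|exact: measurableI].
rewrite (_ : (fun t => _) = (fun t => pr Q (B `&` b t @^-1` B') * (pr P (A `&` a t @^-1` A') - pr P A * pr P A') +
    (pr P A * pr P A') * (pr Q (B `&` b t @^-1` B') - pr Q B * pr Q B'))); last exact/funext.
apply: vanishingD.
  apply: (@vanishingMl _ _ _ _ 1); last exact: mixa.
  by move=> t; rewrite ger0_norm ?pr_ge0// pr_le1//; exact: measurableI.
apply: (@vanishingMl _ _ _ _ 1); last exact: mixb.
move=> t; rewrite ger0_norm ?mulr_ge0 ?pr_ge0//.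
by rewrite mulr_ile1 ?pr_ge0 ?pr_le1.
Qed.

End Mixing.

Section BernoulliMixing.
Context {R : realType} {d0 : measure_display} {X0 : measurableType d0}.
Context {G : groupType}.
Let X := power_space X0 G.
Variables (mu0 : probability X0 R) (mu : probability X R).
Hypothesis mu_power : is_power_measure mu0 mu.
Let mu2 := product_prob mu mu.

Local Notation sh := (@bernoulli_shift d0 X0 G).

(** Off a finite set of [t] the two cylinders involve disjoint sets of coordinates. Their
    independence is read off by resampling the coordinates of the second one. *)
Lemma bernoulli_mixing : mixing mu sh.
Proof.
apply: (mixing_pi_system (fun t => mp_shift mu_power t) (Gs := cylinders)).
- exact: cylinders_generate.
- exact: cylinders_setI.
move=> _ _ [F [A [mA ->]]] [F' [A' [mA' ->]]] e e0.
apply: (@sub_finite_set _ _ [set` [seq (g * f^-1)%g | g <- F', f <- F]]); last exact: finite_seq.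
move=> t /= h; apply/negPn/negP => ht.
have disj g : g \in F' -> (t^-1 * g)%g \notin F.
  move=> gF'; apply/negP => gF; move/negP : ht; apply; apply/allpairsP.
  by exists (g, (t^-1 * g)%g); split=> //=; rewrite invgM invgK mulVKg.
move: h; rewrite leNgt => /negP; apply.
pose D : pred G := fun f => (t * f)%g \in F'.
have mC := measurable_cylinder F mA; have mC' := measurable_cylinder F' mA'.
have mC2 : measurable (sh t @^-1` cylinder F' A').
  exact: measurable_preimage (mp_shift mu_power t).1 mC'.
have mI : measurable (cylinder F A `&` sh t @^-1` cylinder F' A') by exact: measurableI.
rewrite -(mp_pr (mp_resample mu_power D) mI).
rewrite (_ : _ @^-1` _ = cylinder F A `*` (sh t @^-1` cylinder F' A')); last first.
  apply/seteqP; split=> -[x y] /= [h1 h2]; split.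
  - move=> i iF; have := h1 i iF; rewrite /resample /D.
    case: ifP => // tiF; have := disj _ tiF; by rewrite mulKg iF.
  - move=> i iF; have := h2 i iF; rewrite /bernoulli_shift /resample /D mulVKg.
    by have -> : i \in F' by [].
  - move=> i iF; have := h1 i iF; rewrite /resample /D.
    case: ifP => // tiF; have := disj _ tiF; by rewrite mulKg iF.
  - move=> i iF; have := h2 i iF; rewrite /bernoulli_shift /resample /D mulVKg.
    by have -> : i \in F' by [].
rewrite pr_rect// (mp_pr (mp_shift mu_power t) mC') subrr normr0//.
Qed.

End BernoulliMixing.

(** * Intertwining cocycles *)

Section DominatedDensity.
Context {R : realType} d (T : measurableType d) (P : probability T R).
Variable m : set T -> R.
Hypothesis m_bound : forall E, measurable E -> 0 <= m E <= pr P E.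
Hypothesis mU : forall E F, measurable E -> measurable F -> E `&` F = set0 ->
  m (E `|` F) = m E + m F.

(** [m] is only controlled on measurable sets; the absolute value makes the set function nonnegative
    on all sets, as the structure of measures demands. *)
Let nu (E : set T) : \bar R := (`|m E|)%:E.

Let nuE E : measurable E -> nu E = (m E)%:E.
Proof. by move=> mE; rewrite /nu ger0_norm//; case/andP: (m_bound mE). Qed.

Let m0 : m set0 = 0.
Proof.
have /andP[h1 h2] := m_bound (@measurable0 _ T).
by apply/eqP; rewrite eq_le h1 -(pr0 P) h2.
Qed.

Let nu0 : nu set0 = 0%E.
Proof. by rewrite nuE// m0. Qed.

Let nu_ge0 E : (0 <= nu E)%E.
Proof. by rewrite /nu lee_fin. Qed.

(** In the application [m] is an ultralimit of means, hence a priori only finitely additive.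
    Domination by [P] supplies the missing continuity. *)
Let nu_sigma_additive : semi_sigma_additive nu.
Proof.
move=> F mF tF mUF.
pose U n := \big[setU/set0]_(k < n) F k.
have mUn n : measurable (U n) by apply: bigsetU_measurable.
have e n : (\sum_(0 <= i < n) nu (F i))%E = (m (U n))%:E.
  elim: n => [|n IH]; first by rewrite big_geq// /U big_ord0 m0.
  rewrite big_nat_recr//= IH nuE// -EFinD; congr EFin.
  rewrite /U big_ord_recr /= mU//; first exact: mUn.
  rewrite -bigcup_mkord; apply/seteqP; split=> // x [[k /= kn Fkx] Fnx].
  move/trivIsetP : tF => /(_ k n I I); rewrite neq_ltn kn => /(_ isT) /seteqP[h _].
  by apply: (h x).
rewrite nuE// (_ : (fun n => _) = EFin \o (m \o U)); last exact/funext.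
apply/cvg_EFin; first by near=> n.
apply/cvgrPdist_le => r r0.
have [N hN] := pr_bigcup_approx P mF r0.
exists N => // n /= Nn.
have UF : U n `<=` \bigcup_k F k by exact: bigsetU_bigcup.
have mD : measurable (\bigcup_k F k `\` U n) by exact: measurableD.
have UE : \bigcup_k F k = U n `|` (\bigcup_k F k `\` U n).
  by rewrite setDUK.
rewrite {1}UE mU//; last by apply/seteqP; split=> // x [? []].
have /andP[h1 h2] := m_bound mD.
rewrite addrAC subrr add0r ger0_norm//; apply: (le_trans h2); apply: le_trans hN.
apply: pr_le => //; first by apply: measurableD => //; exact: mUn.
by apply: setDS; exact: subset_bigsetU.
Unshelve. all: by end_near. Qed.

HB.instance Definition _ := isMeasure.Build _ _ _ nu nu0 nu_ge0 nu_sigma_additive.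

Let nu_fin : fin_num_fun nu.
Proof. by []. Qed.

HB.instance Definition _ := @Measure_isFinite.Build _ T R nu nu_fin.

Let nuP : nu `<< P.
Proof.
move=> A A0 B mB BA; rewrite nuE//; have /andP[h1 h2] := m_bound mB.
have B0 : pr P B = 0 by rewrite /pr (A0 _ mB BA).
by congr EFin; apply/eqP; rewrite eq_le h1 -B0 h2.
Qed.

(** Radon-Nikodym. Only comparisons of the density with constants are recorded, which keeps extended
    reals and integrals out of what follows. *)
Lemma dominated_density : exists f : T -> R, measurable_fun setT f /\
  forall E (c : R), measurable E -> 0 <= c ->
    ((forall x, E x -> c <= f x) -> c * pr P E <= m E) /\
    ((forall x, E x -> f x <= c) -> m E <= c * pr P E).
Proof.
pose F := Radon_Nikodym_SigmaFinite.f nu P.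
have F0 x : (0 <= F x)%E by exact: Radon_Nikodym_SigmaFinite.f_ge0.
have Ff x : F x \is a fin_num by exact: Radon_Nikodym_SigmaFinite.f_fin_num.
have mF : measurable_fun setT F.
  by have /integrableP[] := Radon_Nikodym_SigmaFinite.f_integrable nuP.
have FE x : F x = (fine (F x))%:E by rewrite fineK.
exists (fine \o F); split.
  by apply: measurableT_comp => //; exact: measurable_fine.
move=> E c mE c0.
have iE := Radon_Nikodym_SigmaFinite.f_integral nuP mE.
have mFE : measurable_fun E F by exact: measurable_funTS.
have cE : ((c * pr P E)%:E = \int[P]_(x in E) c%:E)%E.
  by rewrite integral_cst// EFinM prE.
split=> h; rewrite -lee_fin -(nuE mE) cE iE; apply: ge0_le_integral => //.
- by move=> x Ex; rewrite -/(F x) FE lee_fin; exact: h.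
- by move=> x Ex; rewrite -/(F x) FE lee_fin; exact: h.
Qed.

End DominatedDensity.

Section Selection.
Context {d : measure_display} {T : measurableType d}.
Context {L : choiceType}.
Hypothesis cL : countable [set: L].

(** The selected value is the first one, in an enumeration of [L], whose set contains the point,
    with default [l0]. *)
Lemma measurable_selection (U : L -> set T) (l0 : L) : (forall l, measurable (U l)) ->
  exists2 v : T -> L, dmeasurable v & forall x, (exists l, U l x) -> U (v x) x.
Proof.
move=> mU; have /countable_injP[i iinj] := cL.
have {}iinj l l' : i l = i l' -> l = l' by apply: iinj; rewrite inE.
pose first l := U l `&` [set x | forall l', (i l' < i l)%N -> ~ U l' x].
have first_uniq x l l' : first l x -> first l' x -> l = l'.
  move=> [Ul hl] [Ul' hl']; apply: iinj; apply/eqP; rewrite eqn_leq.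
  by apply/andP; split; rewrite leqNgt; apply/negP => h; [exact: (hl _ h)|exact: (hl' _ h)].
have first_ex x : (exists l, U l x) -> exists l, first l x.
  move=> [l Ul]; have [n] := ubnP (i l); elim: n => // n IH in l Ul *; rewrite ltnS => il.
  have [h|] := pselect (first l x); first by exists l.
  move=> nf; have [l' [l'l Ul']] : exists l', (i l' < i l)%N /\ U l' x.
    apply: contrapT => h; apply: nf; split=> // l' l'l Ul'; apply: h; by exists l'.
  exact: (IH l' Ul' (leq_trans l'l il)).
have mfirst l : measurable (first l).
  apply: measurableI => //.
  rewrite (_ : [set x | _] =
    ~` (\bigcup_l' (if (i l' < i l)%N then U l' else set0))); last first.
    apply/seteqP; split=> x h; first by move=> [l' _]; case: ifP => // l'l; exact: h.
    by move=> l' l'l Ul'; apply: h; exists l' => //; rewrite l'l.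
  apply: measurableC; apply: countable_bigcupT_measurable => // l'.
  by case: ifP.
pose v x := xget l0 [set l | first l x].
exists v; last first.
  move=> x Ux; have [l fl] := first_ex x Ux.
  by have [] : first (v x) x by apply: (xgetPex l0 (P := [set l | first l x])); exists l.
move=> l.
rewrite (_ : _ @^-1` _ = first l `|`
  (~` (\bigcup_l' U l') `&` [set _ | l = l0])); last first.
  apply/seteqP; split=> x /=.
    move=> vx; have [ex|nex] := pselect (exists l', first l' x).
      by left; rewrite -vx; exact: (xgetPex l0 (P := [set l | first l x])).
    right; split; last by rewrite -vx /v xgetPN// => l' fl'; apply: nex; exists l'.
    by move=> [l' _ Ul']; apply: nex; apply: first_ex; exists l'.
  move=> [fl|[nU ->]].
    have : first (v x) x by apply: (xgetPex l0 (P := [set l | first l x])); exists l.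
    by move/first_uniq; apply.
  by rewrite /v xgetPN// => l' [Ul' _]; apply: nU; exists l'.
apply: measurableU => //; apply: measurableI.
  by apply: measurableC; apply: countable_bigcupT_measurable.
exact: measurable_prop.
Qed.

End Selection.

Section AlmostEverywhere.
Context {R : realType} {d : measure_display} {T : measurableType d}.
Variable P : probability T R.
Implicit Types S : set T.

Lemma ae_pr0 S : measurable S -> pr P S = 0 -> {ae P, forall x, ~ S x}.
Proof.
move=> mS S0; exists S; split=> //; last by move=> x /= /contrapT.
by rewrite -prE// S0.
Qed.

Lemma pr0_ae S : measurable S -> {ae P, forall x, ~ S x} -> pr P S = 0.
Proof.
move=> mS [N [mN N0 SN]]; apply: (pr_eq0_le mS mN) => [x Sx|].
  by apply: SN => /=; apply.
by rewrite /pr N0.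
Qed.

Lemma ae_countable (L : Type) (Q : L -> T -> Prop) : countable [set: L] ->
  (forall l, {ae P, forall x, Q l x}) -> {ae P, forall x, forall l, Q l x}.
Proof.
move=> /countable_injP[i iinj] h.
have {}iinj l l' : i l = i l' -> l = l' by apply: iinj; rewrite inE.
have : {ae P, forall x, forall n l, i l = n -> Q l x}.
  apply/ae_foralln => n; have [[l ln]|nl] := pselect (exists l, i l = n).
    by apply: filterS (h l) => x Ql l' l'n; rewrite (iinj l' l) ?ln.
  by apply: nearW => x l ln; exfalso; apply: nl; exists l.
by apply: filterS => x Qx l; exact: Qx.
Qed.

End AlmostEverywhere.

Lemma ae_mp (R : realType) d d' (T : measurableType d) (T' : measurableType d')
    (P : probability T R) (Q : probability T' R) (h : T -> T') (S : T' -> Prop) :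
  measure_preserving P Q h -> {ae Q, forall y, S y} -> {ae P, forall x, S (h x)}.
Proof.
move=> [mh hP] [N [mN N0 SN]]; exists (h @^-1` N); split.
- exact: measurable_preimage.
- by rewrite hP.
- by move=> x /= nS; exact: SN.
Qed.

Lemma two_thirds_overlap (R : realFieldType) (p q r : R) :
  2 / 3 * p <= q -> 2 / 3 * p <= r -> q + r <= p -> 0 <= p -> p = 0.
Proof. lra. Qed.

Lemma two_thirds_small (R : realFieldType) (p q r : R) :
  q <= 2 / 3 * p -> p <= 1 -> r <= 0 -> ~ 3 / 4 <= r + q.
Proof. lra. Qed.

Section Intertwiner.
Context {R : realType} {G L : groupType}.
Hypotheses (cG : countable [set: G]) (iG : infinite_set [set: G]).
Hypothesis cL : countable [set: L].
Context d (T : measurableType d) (P : probability T R).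
Variable a : G -> T -> T.
Hypothesis aP : forall t, measure_preserving P P (a t).
Hypothesis aK : forall t, cancel (a t) (a t^-1%g).
Hypothesis mixa : mixing P a.
Variables (w v : G -> T -> L).
Hypotheses (mw : forall t, dmeasurable (w t)) (mv : forall t, dmeasurable (v t)).
Variable m : L -> set T -> R.
Hypothesis m_bound : forall l E, measurable E -> 0 <= m l E <= pr P E.
Hypothesis mU : forall l E F, measurable E -> measurable F -> E `&` F = set0 ->
  m l (E `|` F) = m l E + m l F.
Hypothesis m_le : forall l l' E, measurable E -> l <> l' -> m l E + m l' E <= pr P E.
Hypothesis m_shift : forall t l a1 b1 E, measurable E ->
  (forall z, E z -> w t z = a1 /\ v t z = b1) ->
  m (a1 * l * b1^-1)%g E = m l (a t @^-1` E).
Hypothesis m_large : 3 / 4 <= m 1%g setT.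

(* The density of [m l] exceeds 2/3 for at most one [l], which depends equivariantly
   on the point; by mixing this [l] exists almost everywhere. *)
Lemma intertwiner_ex : exists2 xi : T -> L, dmeasurable xi &
  forall t, {ae P, forall z, (w t z * xi (a t^-1%g z) = xi z * v t z)%g}.
Proof.
have /choice[f hf] : forall l, exists f : T -> R, measurable_fun setT f /\
  forall E (c : R), measurable E -> 0 <= c ->
    ((forall x, E x -> c <= f x) -> c * pr P E <= m l E) /\
    ((forall x, E x -> f x <= c) -> m l E <= c * pr P E).
  by move=> l; apply: dominated_density; [exact: m_bound|exact: mU].
(* A threshold above 1/2 makes the sets [U l] almost disjoint, and one below 3/4 makes [U 1]
   non-null. *)
pose c : R := 2 / 3; have c0 : 0 <= c by rewrite /c; lra.
pose U l := [set x | c < f l x].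
have mf l : measurable_fun setT (f l) by case: (hf l).
have mUc l (r : R) : measurable [set x | r < f l x].
  rewrite (_ : [set x | _] = f l @^-1` `]r, +oo[%classic).
    exact: measurable_preimage.
  by apply/seteqP; split=> x /=; rewrite in_itv /= andbT.
have mUl l : measurable (U l) by exact: mUc.
have hge l E r : measurable E -> 0 <= r -> (forall x, E x -> r <= f l x) -> r * pr P E <= m l E.
  by move=> mE r0 h; have [/(_ h)] := (hf l).2 E r mE r0.
have hle l E r : measurable E -> 0 <= r -> (forall x, E x -> f l x <= r) -> m l E <= r * pr P E.
  by move=> mE r0 h; have [_ /(_ h)] := (hf l).2 E r mE r0.
have disj l l' : l <> l' -> {ae P, forall z, ~ (U l `&` U l') z}.
  move=> ll'; have mI : measurable (U l `&` U l') by exact: measurableI.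
  apply: ae_pr0 => //; have h1 : c * pr P (U l `&` U l') <= m l (U l `&` U l').
    by apply: hge => // x [/ltW].
  have h2 : c * pr P (U l `&` U l') <= m l' (U l `&` U l').
    by apply: hge => // x [_ /ltW].
  have h3 := m_le mI ll'; have h4 := pr_ge0 P (U l `&` U l').
  exact: two_thirds_overlap h1 h2 h3 h4.
have U1 : 0 < pr P (U 1%g).
  rewrite lt_neqAle pr_ge0 andbT; apply/eqP => h0.
  have h1 : m 1%g (~` U 1%g) <= c * pr P (~` U 1%g).
    apply: hle => //; first exact: measurableC.
    by move=> x /= /negP; rewrite -leNgt.
  have h2 := pr_le1 P (measurableC (mUl 1%g)).
  have /andP[_ h3] := m_bound 1%g (mUl 1%g).
  have h4 : m 1%g setT = m 1%g (U 1%g) + m 1%g (~` U 1%g).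
    by rewrite -mU ?setUv//; [exact: measurableC|exact: setICr].
  by move: m_large; rewrite h4 => h5; rewrite -h0 in h3; exact: two_thirds_small h1 h2 h3 h5.
have null t l a1 b1 (S : set T) : S = [set z | w t z = a1 /\ v t z = b1 /\
    U l (a t^-1%g z) /\ ~ U (a1 * l * b1^-1)%g z] ->
    measurable S /\ pr P S = 0.
  move=> SE; have mS : measurable S.
    rewrite SE; apply: measurableI; first exact: mw.
    apply: measurableI; first exact: mv.
    apply: measurableI; last exact: measurableC.
    by apply: (measurable_preimage _ (mUl l)); exact: (aP t^-1%g).1.
  split=> //.
  (* The strict inequality is cut into gaps [1/(n+1)]: on each slice the bounds for [m] at
     corresponding elements, by [c] from above and by [c + 1/(n+1)] from below, contradict [m_shift]
     unless the slice is null. *)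
  pose Sn (n : nat) := S `&` (a t^-1%g @^-1` [set x | c + n.+1%:R^-1 < f l x]).
  have mSn n : measurable (Sn n).
    by apply: measurableI => //; apply: (measurable_preimage _ (mUc l _)); exact: (aP t^-1%g).1.
  have Sn0 n : pr P (Sn n) = 0.
    have n0 : 0 < n.+1%:R^-1 :> R by rewrite invr_gt0.
    have h1 : m (a1 * l * b1^-1)%g (Sn n) <= c * pr P (Sn n).
      apply: hle => // z [+ _]; rewrite SE => -[_ [_ [_ /= h]]].
      by rewrite leNgt; apply/negP.
    have mA : measurable (a t @^-1` Sn n) by apply: measurable_preimage => //; exact: (aP t).1.
    have h2 : (c + n.+1%:R^-1) * pr P (a t @^-1` Sn n) <= m l (a t @^-1` Sn n).
      apply: hge => //; first by rewrite addr_ge0// ltW.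
      by move=> z [_ /=]; rewrite aK => /ltW.
    rewrite (mp_pr (aP t) (mSn n)) -(@m_shift t l a1 b1) in h2 => //; last first.
      by move=> z [+ _]; rewrite SE => -[? [? _]].
    have := le_trans h2 h1; rewrite mulrDl gerDl => h3.
    by apply/eqP; rewrite eq_le pr_ge0 andbT; rewrite pmulr_rle0 in h3.
  apply: pr0_ae => //.
  apply: (filterS _ (ae_countable (countableP [set: nat]) (fun n => ae_pr0 (mSn n) (Sn0 n)))).
  move=> z h Sz; have : U l (a t^-1%g z) by move: Sz; rewrite SE => -[_ [_ []]].
  rewrite /U /= => lt; have [n hn] := ltr_add_invr lt.
  exact: (h n).
have stepU : {ae P, forall z, forall t a1 b1 l, w t z = a1 -> v t z = b1 ->
    U l (a t^-1%g z) -> U (a1 * l * b1^-1)%g z}.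
  apply: (ae_countable cG) => t; apply: (ae_countable cL) => a1.
  apply: (ae_countable cL) => b1; apply: (ae_countable cL) => l.
  have [mS S0] := null t l a1 b1 _ erefl.
  apply: filterS (ae_pr0 mS S0) => z /= h h1 h2 h3; apply: contrapT => h4.
  by apply: h.
pose O := \bigcup_l U l; have mO : measurable O by exact: countable_bigcupT_measurable.
have Oinv t : pr P (O `&` a t @^-1` O) = pr P O.
  have mO' : measurable (a t @^-1` O) by apply: measurable_preimage => //; exact: (aP t).1.
  rewrite [RHS](prDI P mO mO') [X in _ = X + _](_ : _ = 0) ?add0r//.
  apply: pr0_ae; first exact: measurableD.
  apply: filterS (ae_mp (aP t) stepU) => z h [[l _ Ul] nO]; apply: nO.
  exists (w t (a t z) * l * (v t (a t z))^-1)%g => //.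
  by apply: (h t) => //; rewrite aK.
have O1 : {ae P, forall z, O z}.
  have O1 : pr P O = 1.
    have [h0|] := mixing_zero_one mixa iG mO (fun t _ => Oinv t); last by [].
    move: U1; rewrite ltNge -h0; case/negP; apply: pr_le => //.
    by move=> z Uz; exists 1%g.
  apply: filterS (ae_pr0 (measurableC mO) _) => [z /contrapT//|].
  by rewrite prC// O1 subrr.
have [xi mxi hxi] := measurable_selection cL 1%g mUl.
have Uxi : {ae P, forall z, U (xi z) z}.
  by apply: filterS O1 => z [l _ Ul]; apply: hxi; exists l.
have D : {ae P, forall z, forall l l', U l z -> U l' z -> l = l'}.
  apply: (ae_countable cL) => l; apply: (ae_countable cL) => l'.
  have [->|/eqP ll'] := eqVneq l l'; first by apply: nearW.
  by apply: filterS (disj l l' ll') => z h h1 h2; exfalso; apply: h.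
exists xi => // t.
near=> z.
have h1 : U (xi z) z by near: z.
have h2 : U (xi (a t^-1%g z)) (a t^-1%g z).
  by near: z; exact: (ae_mp (aP t^-1%g) Uxi).
have h3 : U (w t z * xi (a t^-1%g z) * (v t z)^-1)%g z.
  by move: h2; near: z; apply: filterS stepU => z h; exact: h.
have : xi z = (w t z * xi (a t^-1%g z) * (v t z)^-1)%g.
  by move: h1 h3; near: z; apply: filterS D => z h h1 h2; exact: h.
by move=> ->; rewrite mulgVK.
Unshelve. all: by end_near. Qed.

End Intertwiner.

Section Sections.
Context {R : realType} d d' (T : measurableType d) (T' : measurableType d').
Variables (P : probability T R) (Q : probability T' R).

Lemma pr_sections (S : set (T * T')) : measurable S ->
  pr (product_prob P Q) S = expect P (fun x => pr Q [set y | S (x, y)]).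
Proof.
move=> mS; rewrite -expect_indic// expect_product; last exact: bm_indic.
congr expect; apply/funext => x; rewrite -expect_indic//.
exact: (measurable_preimage (pair1_measurable x) mS).
Qed.

Lemma pr_sections_le (S : set (T * T')) (c : R) : measurable S ->
  (forall x, pr Q [set y | S (x, y)] <= c) -> pr (product_prob P Q) S <= c.
Proof.
move=> mS h; rewrite -expect_indic// expect_product; last exact: bm_indic.
rewrite -[leRHS](expect_cst P); apply: expect_le => //.
- exact: (bm_expect P Q (bm_indic mS)).
- exact: bm_cst.
move=> x; apply: le_trans (h x); rewrite -expect_indic//.
exact: (measurable_preimage (pair1_measurable x) mS).
Qed.

End Sections.

Lemma pr_level_dist (R : realType) d (T : measurableType d) (P : probability T R)
    (L : choiceType) (u u' : T -> L) (E : set T) (l : L) : countable [set: L] ->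
  measurable E -> dmeasurable u -> dmeasurable u' ->
  `|pr P (E `&` u @^-1` [set l]) - pr P (E `&` u' @^-1` [set l])| <=
  pr P [set x | u x <> u' x].
Proof.
move=> cL mE mu mu'.
have m1 : measurable (E `&` u @^-1` [set l]) by exact: measurableI.
have m2 : measurable (E `&` u' @^-1` [set l]) by exact: measurableI.
have mN := measurable_neq_dmeasurable cL mu mu'.
rewrite ler_distl lerBlDr; apply/andP; split.
  apply: le_trans (prU_le _ m1 mN); apply: pr_le => //; first exact: measurableU.
  move=> x [Ex /= ul]; have [e|ne] := pselect (u x = u' x); last by right.
  by left; split=> //=; rewrite e.
apply: le_trans (prU_le _ m2 mN); apply: pr_le => //; first exact: measurableU.
move=> x [Ex /= ul]; have [e|ne] := pselect (u x = u' x); last by right.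
by left; split=> //=; rewrite -e.
Qed.

(** * Mean laws of the quotients between a configuration and a resampled one *)

Section Coupling.
Context {R : realType} {d0 : measure_display} {X0 : measurableType d0}.
Context {G : groupType}.
Let X := power_space X0 G.
Variables (mu0 : probability X0 R) (mu : probability X R).
Hypothesis mu_power : is_power_measure mu0 mu.
Context {L : groupType}.
Hypothesis cL : countable [set: L].
Variable w : G -> X -> L.
Hypothesis wP : is_cocycle w.
Variable ph : (G -> R) -> R.
Hypothesis phP : invariant_mean ph.

Local Notation sh := (@bernoulli_shift d0 X0 G).
Let mu2 := product_prob mu mu.
Let Z := (X * (X * X))%type.
Let PZ : probability Z R := product_prob mu mu2.

Let mw t : dmeasurable (w t). Proof. exact: wP.1. Qed.

Let wM s t x : w (s * t)%g x = (w s x * w t (sh s^-1 x))%g. Proof. exact: wP.2. Qed.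

(* A point of [Z] consists of marks, a configuration and an independent copy of it. *)
Definition shift3 t (z : Z) : Z := (sh t z.1, (sh t z.2.1, sh t z.2.2)).

Lemma mp_shift3 t : measure_preserving PZ PZ (shift3 t).
Proof.
have mp := mp_shift mu_power t; exact: (mp_product mp (mp_product mp mp)).
Qed.

Lemma mixing_shift3 : mixing PZ shift3.
Proof.
have mp t := mp_shift mu_power t; have mix := bernoulli_mixing mu_power.
have mp2 t := mp_product (mp t) (mp t).
exact: (mixing_product mp mp2 mix (mixing_product mp mp mix mix)).
Qed.

Lemma shift3K t : cancel (shift3 t) (shift3 t^-1%g).
Proof. by case=> p [x y]; rewrite /shift3 /= !shiftK. Qed.

Section Marked.
Variable Ls : set X0.
Hypothesis mLs : measurable Ls.
Implicit Types (B C : pred G) (z : Z) (l : L) (E : set Z).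

Definition marked (p : X) : pred G := fun g => `[< Ls (p g) >].

(** [B] is finite while means are taken; the intertwiner concerns [predT], where the construction
    commutes with the shift. *)
Definition mixed B z : X := resample (fun g => marked z.1 g && B g) z.2.1 z.2.2.

Lemma measurable_mixed B : measurable_fun setT (mixed B).
Proof.
apply: measurable_power => g A mA.
have mc (S : set X0) : measurable S -> measurable ([set x | S (x g)] : set X).
  exact: measurable_coord.
have m1 S : measurable S -> measurable [set z : Z | S (z.1 g)].
  by move=> mS; apply: (measurable_preimage measurable_fst (mc S mS)).
have m21 S : measurable S -> measurable [set z : Z | S (z.2.1 g)].
  move=> mS; apply: (measurable_preimage (measurableT_comp measurable_fst measurable_snd) (mc S mS)).
have m22 S : measurable S -> measurable [set z : Z | S (z.2.2 g)].
  move=> mS; apply: (measurable_preimage (measurableT_comp measurable_snd measurable_snd) (mc S mS)).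
have [Bg|nBg] := boolP (B g); last first.
  rewrite (_ : [set z | _] = [set z : Z | A (z.2.1 g)]); first exact: m21.
  by apply/seteqP; split=> z; rewrite /mixed /resample /= (negbTE nBg) andbF.
rewrite (_ : [set z | _] = ([set z : Z | Ls (z.1 g)] `&` [set z : Z | A (z.2.2 g)]) `|`
  ([set z : Z | (~` Ls) (z.1 g)] `&` [set z : Z | A (z.2.1 g)])); last first.
  apply/seteqP; split=> z /=; rewrite /mixed /resample /marked Bg andbT.
    by case: asboolP => h h'; [left|right].
  by case: asboolP => h [[h1 h2]|[h1 h2]].
apply: measurableU; apply: measurableI; [exact: m1|exact: m22| |exact: m21].
by apply: m1; exact: measurableC.
Qed.

Lemma mixed_pred0 z : mixed pred0 z = z.2.1.
Proof. by apply/funext => g; rewrite /mixed /resample andbF. Qed.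

Lemma shift_mixed t B z :
  sh t (mixed B z) = mixed (fun g => B (t^-1 * g)%g) (shift3 t z).
Proof. by []. Qed.

Lemma dmeasurable_mixed (u : X -> L) B : dmeasurable u ->
  dmeasurable (fun z => u (mixed B z)).
Proof. by move=> mu'; apply: (dmeasurable_comp mu'); exact: measurable_mixed. Qed.

Lemma dmeasurable_middle (u : X -> L) : dmeasurable u ->
  dmeasurable (fun z : Z => u z.2.1).
Proof.
move=> mu'; apply: (dmeasurable_comp mu').
exact: (measurableT_comp measurable_fst measurable_snd).
Qed.

(** For fixed marks this is [disagree_union], and the marked part of [C] has at most the influence
    of [C]. *)
Lemma mixed_disagree (u : X -> L) B C : dmeasurable u -> (forall g, B g -> ~~ C g) ->
  pr PZ [set z | u (mixed (fun g => B g || C g) z) <> u (mixed B z)] <=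
  disagree mu u C.
Proof.
move=> mu' BC; apply: pr_sections_le.
  by apply: measurable_neq_dmeasurable => //; exact: dmeasurable_mixed.
move=> p /=.
have e := @disagree_union _ _ _ _ _ _ mu_power _ cL u (fun g => marked p g && B g)
  (fun g => marked p g && C g).
rewrite [X in pr _ X](_ : _ = [set z | u (resample (fun g => marked p g && B g ||
   marked p g && C g) z.1 z.2) <> u (resample (fun g => marked p g && B g) z.1 z.2)]).
  rewrite e// => [|g /andP[_ /BC Cg]]; last by rewrite negb_and Cg orbT.
  rewrite !(disagreeE mu_power cL)// lerD2l lerN2.
  by apply: (agree_mono mu_power cL mu') => g /andP[].
by apply/seteqP; split=> -[x y] /=; rewrite /mixed /=;
  rewrite (_ : (fun g => marked p g && (B g || C g)) =
    (fun g => marked p g && B g || marked p g && C g))//;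
  apply/funext => g; rewrite andb_orr.
Qed.

Lemma mixed_disagree0 (u : X -> L) C : dmeasurable u ->
  pr PZ [set z | u (mixed C z) <> u z.2.1] <= disagree mu u C.
Proof.
move=> mu'; have h0 g : pred0 g -> ~~ C g by [].
rewrite (_ : [set z | _] =
  [set z | u (mixed (fun g => pred0 g || C g) z) <> u (mixed pred0 z)]).
  exact: mixed_disagree mu' h0.
by apply/seteqP; split=> z /=; rewrite mixed_pred0.
Qed.

Definition quotient s B z : L := (w s z.2.1 * (w s (mixed B z))^-1)%g.

Lemma dmeasurable_quotient s B : dmeasurable (quotient s B).
Proof.
apply: (dmeasurable_op2 cL cL (fun a b => a * b^-1)%g).
  exact: dmeasurable_middle.
exact: dmeasurable_mixed.
Qed.

(** The mass at [l] of the law of the quotient, localized to [E]. Keeping track of [E] makes it a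
    set function whose mean has a density. *)
Definition coupling B l E s : R := pr PZ (E `&` quotient s B @^-1` [set l]).

Lemma coupling_ge0 B l E s : 0 <= coupling B l E s.
Proof. exact: pr_ge0. Qed.

Lemma coupling_le B l E s : measurable E -> coupling B l E s <= pr PZ E.
Proof.
move=> mE; apply: pr_le => //.
by apply: measurableI => //; exact: dmeasurable_quotient.
Qed.

(* This fails for infinite [B], hence the limit over an exhaustion below. *)
Lemma coupling_slow (B : seq G) l E : measurable E ->
  slowly_varying (coupling (mem B) l E).
Proof.
move=> mE; split.
  exists 1 => s; rewrite ger0_norm; last exact: coupling_ge0.
  by apply: (le_trans (coupling_le (mem B) l s mE)); exact: pr_le1.
move=> t e e0; have e2 : 0 < e / 2 by rewrite divr_gt0.
have [F hF] := disagree_small mu_power cL (mw t) e2.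
apply: sub_finite_set (finite_not_disjoint F B) => s /= es hs.
move: es; apply/negP; rewrite -ltNge.
apply: (le_lt_trans (pr_level_dist PZ l cL mE (dmeasurable_quotient s (mem B))
  (dmeasurable_quotient (s * t)%g (mem B)))).
have mws : dmeasurable (fun x => w t (sh s^-1 x)) by exact: (dmeasurable_shift mu_power).
apply: (@le_lt_trans _ _ (disagree mu (fun x => w t (sh s^-1 x)) (mem B))).
  apply: le_trans (mixed_disagree0 (mem B) mws); apply: pr_le.
  - by apply: measurable_neq_dmeasurable => //; exact: dmeasurable_quotient.
  - apply: measurable_neq_dmeasurable => //; first exact: (dmeasurable_mixed _ mws).
    exact: (dmeasurable_middle mws).
  move=> z /= h wz; apply: h; rewrite /quotient !wM wz invgM.
  by rewrite mulgA mulgK.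
rewrite (disagree_shift mu_power cL)//.
apply: (@le_lt_trans _ _ (e / 2)).
  by apply: hF => g gF; rewrite invgK; exact: hs.
by rewrite ltr_pdivrMr// ltr_pMr// ltr1n.
Qed.

Variable En : nat -> seq G.
Hypothesis EP : exhaustion En.

Definition limit_coupling l E : R := ulim (fun n => ph (coupling (mem (En n)) l E)).

Lemma mean_coupling_bound (B : seq G) l E : measurable E ->
  0 <= ph (coupling (mem B) l E) <= pr PZ E.
Proof.
move=> mE; have sl := coupling_slow B l mE.
apply/andP; split; first by apply: (mean_ge0 phP sl) => s; exact: coupling_ge0.
rewrite -(mean_cst phP (pr PZ E)).
apply: (mean_le phP sl (slowly_varying_cst _)) => s; exact: coupling_le.
Qed.

Lemma bdd_mean_coupling l E : measurable E ->
  bdd_fun (fun n => ph (coupling (mem (En n)) l E)).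
Proof.
move=> mE; exists (pr PZ E) => n.
by have /andP[h1 h2] := mean_coupling_bound (En n) l mE; rewrite ger0_norm.
Qed.

Lemma limit_coupling_bound l E : measurable E -> 0 <= limit_coupling l E <= pr PZ E.
Proof.
move=> mE; have b := bdd_mean_coupling l mE; apply/andP; split.
  apply: (@ulim_ge_near _ _ _ 0%N b) => n _.
  by have /andP[] := mean_coupling_bound (En n) l mE.
apply: (@ulim_le_near _ _ _ 0%N b) => n _.
by have /andP[] := mean_coupling_bound (En n) l mE.
Qed.

Lemma limit_couplingU l E F : measurable E -> measurable F -> E `&` F = set0 ->
  limit_coupling l (E `|` F) = limit_coupling l E + limit_coupling l F.
Proof.
move=> mE mF EF; have bE := bdd_mean_coupling l mE; have bF := bdd_mean_coupling l mF.
rewrite -[X in X + _]mul1r -ulim_lin//; congr ulim; apply/funext => n.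
have sE := coupling_slow (En n) l mE; have sF := coupling_slow (En n) l mF.
rewrite -(mean_lin phP)//; congr ph; apply/funext => s.
have mq := dmeasurable_quotient s (mem (En n)) l.
rewrite mul1r /coupling setIUl prU//; [exact: measurableI|exact: measurableI|].
by rewrite setIACA setIid EF set0I.
Qed.

Lemma limit_coupling_le l l' E : measurable E -> l <> l' ->
  limit_coupling l E + limit_coupling l' E <= pr PZ E.
Proof.
move=> mE ll'; have b1 := bdd_mean_coupling l mE; have b2 := bdd_mean_coupling l' mE.
rewrite -[X in X + _]mul1r -ulim_lin//.
apply: (@ulim_le_near _ _ _ 0%N); first exact: bdd_lin.
move=> n _; have s1 := coupling_slow (En n) l mE; have s2 := coupling_slow (En n) l' mE.
rewrite -(mean_lin phP)// -(mean_cst phP (pr PZ E)).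
apply: (mean_le phP (slowly_varying_lin 1 s1 s2) (slowly_varying_cst _)) => s.
 have m1 := dmeasurable_quotient s (mem (En n)) l.
have m2 := dmeasurable_quotient s (mem (En n)) l'.
rewrite mul1r /coupling -prU; [|exact: measurableI|exact: measurableI|].
  apply: pr_le => //; first by apply: measurableU; exact: measurableI.
  by move=> z [] [].
by apply/seteqP; split=> // z [[_ /= h1] [_ /= h2]]; apply: ll'; rewrite -h1.
Qed.

(** Replacing [B] by [En n] resamples additional coordinates outside [F]; the probability that this
    changes [w s] has mean at most [e] over [s]. *)
Lemma limit_coupling_close (F : seq G) (e : R) :
  (forall A : seq G, (forall g, g \in A -> g \notin F) ->
    ph (fun t => disagree mu (w t) (fun g => g \in A)) <= e) ->
  forall (B : seq G) l E, {subset F <= B} -> measurable E ->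
  `|limit_coupling l E - ph (coupling (mem B) l E)| <= e.
Proof.
move=> hF B l E FB mE; have [N hN] := exhaustion_seq EP B.
apply: (@ulim_dist_near _ _ _ _ N); first exact: bdd_mean_coupling.
move=> n Nn; pose A := seq.filter (predC (mem B)) (En n).
have sA := disagree_slow mu_power cL wP A.
apply: (mean_dist_le phP _ _ sA).
- exact: coupling_slow.
- exact: coupling_slow.
- by apply: hF => g; rewrite mem_filter => /andP[/= gB _]; apply: contra gB; exact: FB.
move=> s; rewrite /coupling.
have e1 : mem (En n) = (fun g => (mem B) g || (g \in A)) :> (G -> bool).
  apply/funext => g; rewrite mem_filter /=.
  case: (boolP (g \in B)) => //= gB.
  exact: (exhaustion_mono EP Nn (hN g gB)).
apply: (le_trans (pr_level_dist PZ l cL mE (dmeasurable_quotient s (mem (En n)))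
  (dmeasurable_quotient s (mem B)))).
have BA g : (mem B) g -> ~~ (g \in A) by rewrite mem_filter /= => ->.
apply: le_trans (mixed_disagree (mw s) BA); apply: pr_le.
- by apply: measurable_neq_dmeasurable => //; exact: dmeasurable_quotient.
- by apply: measurable_neq_dmeasurable => //; exact: (dmeasurable_mixed _ (mw s)).
by move=> z /= h e'; apply: h; rewrite /quotient e1 e'.
Qed.

End Marked.

End Coupling.

Lemma eq_of_dist3 (R : realFieldType) (a b : R) :
  (forall e, 0 < e -> `|a - b| <= 3 * e) -> a = b.
Proof.
move=> h; apply/eqP; rewrite -subr_eq0 -normr_le0 leNgt; apply/negP => ab.
have := h (`|a - b| / 4) (divr_gt0 ab (ltr0n _ 4)).
by rewrite leNgt; apply/negP; rewrite negbK; move: ab; set x := `|_|; lra.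
Qed.

Lemma sixteenths (R : realFieldType) (m p : R) :
  7 / 8 <= p -> `|m - p| <= 1 / 16 -> 3 / 4 <= m.
Proof. by move=> h; rewrite ler_distl => /andP[h1 _]; lra. Qed.

(** * Intertwiners for the resampling of coordinates with rare marks *)

Section Interpolation.
Context {R : realType} {d0 : measure_display} {X0 : measurableType d0}.
Context {G : groupType}.
Let X := power_space X0 G.
Variables (mu0 : probability X0 R) (mu : probability X R).
Hypothesis mu_power : is_power_measure mu0 mu.
Context {L : groupType}.
Hypothesis cL : countable [set: L].
Variable w : G -> X -> L.
Hypothesis wP : is_cocycle w.

Local Notation sh := (@bernoulli_shift d0 X0 G).
Let mu2 := product_prob mu mu.
Let Z := (X * (X * X))%type.
Let PZ : probability Z R := product_prob mu mu2.

Let mw t : dmeasurable (w t). Proof. exact: wP.1. Qed.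

Let wM s t x : w (s * t)%g x = (w s x * w t (sh s^-1 x))%g. Proof. exact: wP.2. Qed.

Lemma pr_coord g (A : set X0) : measurable A -> pr mu [set x | A (x g)] = pr mu0 A.
Proof.
move=> mA; have := mu_power [fset g]%fset (fun=> mA).
rewrite big_seq_fset1 => h; rewrite /pr -h; congr (fine (mu _)).
apply/seteqP; split=> x /=; last by apply; rewrite inE.
by move=> h' i; rewrite inE => /eqP ->.
Qed.

(** The pullbacks of the cocycle along two equivariant maps from [Z] to [X], the original
    configuration and the mixed one, are cohomologous. *)
Definition interpolated (Ls : set X0) : Prop :=
  exists2 xi : Z -> L, dmeasurable xi & forall t, {ae PZ, forall z,
    (w t z.2.1 * xi (shift3 t^-1%g z) = xi z * w t (mixed Ls predT z))%g}.

Section Small.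
Hypothesis cG : countable [set: G].
Hypothesis iG : infinite_set [set: G].
Variable ph : (G -> R) -> R.
Hypothesis phP : invariant_mean ph.
Hypothesis nam : ~ amenable R G.
Variable En : nat -> seq G.
Hypothesis EP : exhaustion En.

Section OneSet.
Variable Ls : set X0.
Hypothesis mLs : measurable Ls.

Local Notation m := (limit_coupling mu w ph Ls En).

(** The cocycle identity writes the quotient at [t s] as the quotient at [s] of the point moved by
    [t^-1], multiplied on both sides by values of [w t] that are constant on [E]; invariance of the
    mean absorbs [t]. For finite [B] one value of [w t] is taken at a slightly wrong point. *)
Lemma limit_coupling_shift t (l a1 b1 : L) (E : set Z) : measurable E ->
  (forall z, E z -> w t z.2.1 = a1 /\ w t (mixed Ls predT z) = b1) ->
  m (a1 * l * b1^-1)%g E = m l (shift3 t @^-1` E).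
Proof.
move=> mE hE; apply: eq_of_dist3 => e e0.
have [F hF] := mean_disagree_small cG mu_power cL wP phP nam e0.
have [F' hF'] := disagree_small mu_power cL (mw t) e0.
(* [F] makes the mean over [B] close to the limit, its translate does the same for [B' = t^-1 B],
   and [F'] makes [w t] insensitive to the coordinates outside [B]. *)
pose B := F ++ F' ++ [seq (t * g)%g | g <- F].
pose B' := [seq (t^-1 * g)%g | g <- B].
have FB : {subset F <= B} by move=> g gF; rewrite mem_cat gF.
have FB' : {subset F <= B'}.
  by move=> g gF; rewrite -(mulKg t g); apply: map_f; rewrite !mem_cat map_f ?orbT.
have B'E : (mem B' : pred G) = (fun g => (mem B) (t * g)%g).
  by apply/funext => g /=; rewrite -{1}(mulKg t g) mem_map//; exact: mulgI.
have F'B : {subset F' <= B} by move=> g gF'; rewrite !mem_cat gF' orbT.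
clearbody B'; clearbody B.
have mp := mp_shift3 mu_power t.
have mE' : measurable (shift3 t @^-1` E) := measurable_preimage mp.1 mE.
have h1 := limit_coupling_close mu_power cL wP phP mLs EP hF (a1 * l * b1^-1)%g FB mE.
have h2 := limit_coupling_close mu_power cL wP phP mLs EP hF l FB' mE'.
have s1 := coupling_slow mu_power cL wP mLs B (a1 * l * b1^-1)%g mE.
have s2 := coupling_slow mu_power cL wP mLs B' l mE'.
have s1t := slowly_varying_shift t s1.
rewrite (_ : 3 * e = e + e + e); last by ring.
apply: (dist_chain3 h1 _ h2).
apply: (eq_ind _ (fun r => `|r - _| <= e) _ _ (mean_shift phP t s1)).
apply: (mean_dist_cst phP s1t s2) => s.
pose u z := quotient w Ls (t * s)%g (mem B) z.
(* The quotient [u], with [w t] evaluated at the fully mixed point instead of the one mixed over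
   [B]. *)
pose u' (z : Z) : L := (w t z.2.1 * w s (sh t^-1 z.2.1) *
   (w t (mixed Ls predT z) * w s (sh t^-1 (mixed Ls (mem B) z)))^-1)%g.
have mshift v : dmeasurable v -> dmeasurable (fun x : X => v (sh t^-1 x) : L).
  by move=> mv; exact: (dmeasurable_shift mu_power).
have mu1 : dmeasurable u by exact: (dmeasurable_quotient cL wP mLs).
have mu' : dmeasurable u'.
  apply: (dmeasurable_op2 cL cL (fun a b => a * b^-1)%g).
    apply: (dmeasurable_mul cL); first exact: (dmeasurable_middle (mw t)).
    exact: (dmeasurable_middle (mshift _ (mw s))).
  apply: (dmeasurable_mul cL); first exact: (dmeasurable_mixed mLs predT (mw t)).
  exact: (dmeasurable_mixed mLs (mem B) (mshift _ (mw s))).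
have e1 : coupling mu w Ls (mem B') l (shift3 t @^-1` E) s =
    pr PZ (E `&` u' @^-1` [set (a1 * l * b1^-1)%g]).
  rewrite -[RHS](mp_pr mp); last exact: measurableI.
  rewrite /coupling preimage_setI; congr pr; apply/seteqP; split=> z [Ez] /=.
    move=> h; split=> //; have [e2 e3] := hE _ Ez.
    rewrite /u' e2 e3 shift_mixed invgK /shift3 /= !shiftK -B'E -h /quotient.
    by rewrite invgM !mulgA; case: z {Ez h e2 e3} => p [x y].
  move=> h; split=> //; have [e2 e3] := hE _ Ez.
  move: h; rewrite /u' e2 e3 shift_mixed invgK /shift3 /= !shiftK -B'E /quotient.
  rewrite invgM !mulgA => /mulIg; rewrite -!mulgA => /mulgI.
  by case: z {Ez e2 e3} => p [x y].
rewrite e1; apply: (le_trans (pr_level_dist PZ _ cL mE mu1 mu')).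
have nB g : (mem B) g -> ~~ (predC (mem B)) g by move=> /= ->.
have e4 : predT = (fun g => (mem B) g || (predC (mem B)) g) :> pred G.
  by apply/funext => g /=; rewrite orbN.
apply: (@le_trans _ _ (disagree mu (w t) (predC (mem B)))); last first.
  by apply: hF' => g gF' /=; rewrite negbK; exact: F'B.
apply: le_trans (mixed_disagree mu_power cL mLs (mw t) nB); apply: pr_le.
- exact: measurable_neq_dmeasurable.
- exact: (measurable_neq_dmeasurable cL
    (dmeasurable_mixed mLs (fun g => (mem B) g || (predC (mem B)) g) (mw t))
    (dmeasurable_mixed mLs (mem B) (mw t))).
move=> z /= h h'; apply: h; rewrite /u /quotient !wM.
have e5 := etrans (congr1 (fun P => w t (mixed Ls P z)) e4) h'.
exact: (congr1 (fun q => (w t z.2.1 * w s (sh t^-1 z.2.1) *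
  (q * w s (sh t^-1 (mixed Ls (mem B) z)))^-1)%g) (esym e5)).
Qed.

(** If no coordinate in [F] carries a mark, mixing over [F] does nothing and the quotient is 1. A
    union bound gives this event probability at least 7/8, and passing to the limit costs 1/16. *)
Lemma limit_coupling_large (F : seq G) :
  (forall A : seq G, (forall g, g \in A -> g \notin F) ->
    ph (fun t => disagree mu (w t) (fun g => g \in A)) <= 1 / 16) ->
  (size F)%:R * pr mu0 Ls <= 1 / 8 -> 3 / 4 <= m 1%g setT.
Proof.
move=> hF sF; have FF : {subset F <= F} by [].
have := limit_coupling_close mu_power cL wP phP mLs EP hF 1%g FF measurableT.
apply: sixteenths; rewrite -(mean_cst phP (7 / 8)).
have sF' := coupling_slow mu_power cL wP mLs F 1%g measurableT.
apply: (mean_le phP (slowly_varying_cst _) sF') => s.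
 pose M := \big[setU/set0]_(g <- F) [set p : X | Ls (p g)].
have mM : measurable M by apply: bigsetU_measurable => g _; exact: measurable_coord.
have pM : pr mu M <= 1 / 8.
  apply: le_trans sF; apply: (le_trans (pr_bigU_le _ _ _)).
    by move=> g; exact: measurable_coord.
  rewrite (eq_bigr (fun=> pr mu0 Ls)); last by move=> g _; exact: pr_coord.
  by rewrite big_const_seq count_predT iter_addr_0 mulr_natl.
have mS := measurableX (measurableC mM) (@measurableT _ (X * X)%type).
have : pr PZ (~` M `*` setT) = 1 - pr mu M by rewrite pr_rect// ?prT ?mulr1 ?prC//; exact: measurableC.
move=> e; apply: (@le_trans _ _ (pr PZ (~` M `*` setT))).
  rewrite e; move: pM; set x := pr mu M; lra.
rewrite /coupling setTI; apply: pr_le => //; first exact: (dmeasurable_quotient cL wP mLs).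
move=> [p [x y]] [/= nM _]; rewrite /quotient (_ : mixed _ _ _ = x) ?mulgV//.
apply/funext => g; rewrite /mixed /resample /marked /=.
case: asboolP => //= Lg; case: (boolP (g \in F)) => // gF.
by exfalso; apply: nM; rewrite /M -bigcup_seq; exists g.
Qed.

End OneSet.

Lemma interpolated_small : exists2 r : R, 0 < r &
  forall Ls, measurable Ls -> pr mu0 Ls <= r -> interpolated Ls.
Proof.
have e0 : 0 < 1 / 16 :> R by rewrite divr_gt0.
have [F hF] := mean_disagree_small cG mu_power cL wP phP nam e0.
have F0 : 0 < (size F).+1%:R :> R by [].
exists (1 / 8 / (size F).+1%:R); first by rewrite !divr_gt0.
move=> Ls mLs hr; apply: (intertwiner_ex cG iG cL (mp_shift3 mu_power) shift3K
  (mixing_shift3 mu_power) _ _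
  (limit_coupling_bound mu_power cL wP phP mLs En)
  (limit_couplingU mu_power cL wP phP mLs En)
  (fun l l' => @limit_coupling_le _ _ _ _ _ _ mu_power _ cL _ wP _ phP _ mLs En l l')
  (limit_coupling_shift mLs)).
- by move=> t; exact: (dmeasurable_middle (mw t)).
- by move=> t; exact: (dmeasurable_mixed mLs predT (mw t)).
apply: (limit_coupling_large mLs hF); move: hr; rewrite ler_pdivlMr// mulrC.
apply: le_trans; rewrite ler_wpM2r ?pr_ge0// ler_nat; exact: leqnSn.
Qed.

End Small.
End Interpolation.

(** * Untwisting *)

Section MoreProduct.
Context {R : realType}.

Lemma ae_sections d d' (T : measurableType d) (T' : measurableType d')
    (P : probability T R) (Q : probability T' R) (S : T * T' -> Prop) :
  {ae product_prob P Q, forall z, S z} ->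
  {ae P, forall x, {ae Q, forall y, S (x, y)}}.
Proof.
move=> [N [mN N0 SN]].
pose f x := pr Q [set y | N (x, y)].
have mNx x : measurable [set y | N (x, y)].
  exact: (measurable_preimage (pair1_measurable x) mN).
have bf : bounded_measurable f.
  rewrite (_ : f = fun x => expect Q (fun y => \1_N (x, y))).
    exact: (bm_expect P Q (bm_indic mN)).
  by apply/funext => x; rewrite /f -expect_indic.
have f0 : expect P f = 0 by rewrite -(pr_sections P Q mN) /pr N0.
have mS (n : nat) : measurable [set x | n.+1%:R^-1 < f x].
  rewrite (_ : [set x | _] = f @^-1` `]n.+1%:R^-1, +oo[%classic).
    by apply: measurable_preimage => //; case: bf.
  by apply/seteqP; split=> x /=; rewrite in_itv /= andbT.
have S0 (n : nat) : pr P [set x | n.+1%:R^-1 < f x] = 0.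
  have n0 : 0 < n.+1%:R^-1 :> R by rewrite invr_gt0.
  have bi : bounded_measurable (fun x => n.+1%:R^-1 * \1_[set x | n.+1%:R^-1 < f x] x : R).
    by apply: bm_mul; [exact: bm_cst|exact: bm_indic].
  have : expect P (fun x => n.+1%:R^-1 * \1_[set x | n.+1%:R^-1 < f x] x) <= expect P f.
    apply: expect_le => // x; rewrite indicE; case: (boolP (_ \in _)).
      by rewrite inE /= mulr1 => /ltW.
    by move=> _; rewrite mulr0 pr_ge0.
  rewrite expectZ ?expect_indic//; last exact: bm_indic.
  rewrite f0 pmulr_rle0// => h; apply/eqP; by rewrite eq_le h pr_ge0.
apply: filterS (ae_countable (countableP [set: nat]) (fun n => ae_pr0 (mS n) (S0 n))).
move=> x h; have fx0 : pr Q [set y | N (x, y)] = 0.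
  apply/eqP; rewrite eq_le pr_ge0 andbT leNgt; apply/negP => fx.
  have [n hn] := ltr_add_invr fx; apply: (h n); move: hn; by rewrite add0r.
apply: filterS (ae_pr0 (mNx x) fx0) => y /= nN; apply: contrapT => nS.
by apply: nN; exact: SN.
Qed.

Lemma ae_ex d (T : measurableType d) (P : probability T R) (S : T -> Prop) :
  {ae P, forall x, S x} -> exists x, S x.
Proof.
move=> [N [mN N0 SN]]; apply: contrapT => nS.
have : pr P setT <= pr P N by apply: pr_le => // x _; apply: SN => /= Sx; apply: nS; exists x.
by rewrite prT /pr N0 /= ler10.
Qed.

Section Projections.
Context d d' (T : measurableType d) (T' : measurableType d').
Variables (P : probability T R) (Q : probability T' R).

Lemma mp_fst : measure_preserving (product_prob P Q) P fst.
Proof.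
split=> [|A mA]; first exact: measurable_fst.
rewrite (_ : _ @^-1` _ = A `*` setT); last by apply/seteqP; split=> z //= [].
by rewrite product_probE// probability_setT mule1.
Qed.

Lemma mp_snd : measure_preserving (product_prob P Q) Q snd.
Proof.
split=> [|A mA]; first exact: measurable_snd.
rewrite (_ : _ @^-1` _ = setT `*` A); last by apply/seteqP; split=> z //= [].
by rewrite product_probE// probability_setT mul1e.
Qed.

Lemma mp_swap_factors :
  measure_preserving (product_prob P Q) (product_prob Q P) (fun z => (z.2, z.1)).
Proof.
apply: mp_rect.
  by apply: measurable_fun_pair; [exact: measurable_snd|exact: measurable_fst].
move=> A B mA mB; rewrite (_ : _ @^-1` _ = B `*` A); last first.
  by apply/seteqP; split=> -[x y] /= [].
by rewrite product_probE// muleC.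
Qed.

Lemma mp_fibered (h : T * T' -> T') : measurable_fun setT h ->
  (forall x, measure_preserving Q Q (fun y => h (x, y))) ->
  measure_preserving (product_prob P Q) (product_prob P Q) (fun z => (z.1, h z)).
Proof.
move=> mh hQ; apply: mp_rect.
  by apply: measurable_fun_pair => //; exact: measurable_fst.
move=> A B mA mB.
have mS : measurable ((fun z => (z.1, h z)) @^-1` (A `*` B)).
  apply: measurable_preimage; last exact: measurableX.
  by apply: measurable_fun_pair => //; exact: measurable_fst.
rewrite -prE// -(prE P mA) -(prE Q mB) -EFinM; congr EFin.
rewrite pr_sections// -(expect_indic P mA) mulrC -expectZ; last exact: bm_indic.
congr expect; apply/funext => x /=; rewrite indicE.
have [xA|xA] := pselect (A x).
  rewrite mem_set// mulr1 -(mp_pr (hQ x) mB); congr pr.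
  by apply/seteqP; split=> y /=; [case|split].
rewrite memNset// mulr0 (_ : [set y | _] = set0) ?pr0//.
by apply/seteqP; split=> y //= [].
Qed.

End Projections.

Section Rearrange.
Context d1 d2 d3 d4 (T1 : measurableType d1) (T2 : measurableType d2)
  (T3 : measurableType d3) (T4 : measurableType d4).
Variables (P1 : probability T1 R) (P2 : probability T2 R) (P3 : probability T3 R)
  (P4 : probability T4 R).

Let rectangles d d' (T : measurableType d) (T' : measurableType d') :
  @measurable _ (T * T')%type = <<s [set A `*` B | A in measurable & B in measurable] >>.
Proof. exact: measurable_prod_measurableType. Qed.

Let rectanglesT d d' (T : measurableType d) (T' : measurableType d') :
  [set A `*` B | A in @measurable _ T & B in @measurable _ T'] setT.
Proof. by exists setT => //; exists setT => //; exact: setXTT. Qed.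

Let rectanglesI d d' (T : measurableType d) (T' : measurableType d') :
  setI_closed [set A `*` B | A in @measurable _ T & B in @measurable _ T'].
Proof.
move=> _ _ [A mA [B mB <-]] [A' mA' [B' mB' <-]].
exists (A `&` A'); first exact: measurableI.
by exists (B `&` B'); [exact: measurableI|rewrite setXI].
Qed.

Lemma mp_interchange : measure_preserving
  (product_prob (product_prob P1 P2) (product_prob P3 P4))
  (product_prob (product_prob P1 P3) (product_prob P2 P4))
  (fun z => ((z.1.1, z.2.1), (z.1.2, z.2.2))).
Proof.
have mf d d' (T : measurableType d) (T' : measurableType d') := @measurable_fst _ _ T T'.
have ms d d' (T : measurableType d) (T' : measurableType d') := @measurable_snd _ _ T T'.
apply: (@mp_pi_system _ _ _ _ _ _ _
  [set A `*` B | A in [set A1 `*` A3 | A1 in measurable & A3 in measurable] &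
   B in [set A2 `*` A4 | A2 in measurable & A4 in measurable]]).
- by apply: prod_pi_system; [exact: rectangles|exact: rectangles|
    exact: rectanglesT|exact: rectanglesT].
- move=> _ _ [A rA [B rB <-]] [A' rA' [B' rB' <-]].
  exists (A `&` A'); first exact: rectanglesI.
  by exists (B `&` B'); [exact: rectanglesI|rewrite setXI].
- apply: measurable_fun_pair; apply: measurable_fun_pair;
    exact: measurableT_comp.
move=> _ [_ [A mA [C mC <-]] [_ [B mB [D mD <-]] <-]].
rewrite (_ : _ @^-1` _ = (A `*` B) `*` (C `*` D)); last first.
  by apply/seteqP; split=> -[[? ?] [? ?]] /= [[? ?] [? ?]].
rewrite !product_probE//; do ?exact: measurableX.
by rewrite muleACA.
Qed.

Lemma mp_rotate : measure_preserving
  (product_prob (product_prob P1 P3) P2) (product_prob P1 (product_prob P2 P3))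
  (fun z => (z.1.1, (z.2, z.1.2))).
Proof.
have mf d d' (T : measurableType d) (T' : measurableType d') := @measurable_fst _ _ T T'.
have ms d d' (T : measurableType d) (T' : measurableType d') := @measurable_snd _ _ T T'.
apply: (@mp_pi_system _ _ _ _ _ _ _
  [set A `*` B | A in measurable & B in [set A2 `*` A3 | A2 in measurable & A3 in measurable]]).
- apply: prod_pi_system; [|exact: rectangles| |exact: rectanglesT] => //.
  by rewrite sigma_algebra_id//; exact: sigma_algebra_measurable.
- move=> _ _ [A rA [B rB <-]] [A' rA' [B' rB' <-]].
  exists (A `&` A'); first exact: measurableI.
  by exists (B `&` B'); [exact: rectanglesI|rewrite setXI].
- apply: measurable_fun_pair; first exact: measurableT_comp.
  by apply: measurable_fun_pair => //; exact: measurableT_comp.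
move=> _ [A mA [_ [B mB [C mC <-]] <-]].
rewrite (_ : _ @^-1` _ = (A `*` C) `*` B); last first.
  by apply/seteqP; split=> -[[? ?] ?] /=; [move=> [? [? ?]]|move=> [[? ?] ?]].
rewrite !product_probE//; do ?exact: measurableX.
by rewrite -muleA; congr (_ * _)%E; rewrite muleC.
Qed.

End Rearrange.
End MoreProduct.

(** * Finite covers of a diffuse space by small sets *)

Section SmallCover.
Context {R : realType} {d : measure_display} {T : measurableType d}.

(** Countable separation of points makes singletons and coincidence sets of measurable maps
    measurable, and lets a diffuse measure be cut into small pieces. *)
Definition separated_by (C : nat -> set T) : Prop :=
  (forall n, measurable (C n)) /\ forall x y, x <> y -> exists n, C n x /\ ~ C n y.

Lemma standard_separated : standard_borel R T -> exists C, separated_by C.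
Proof.
move=> [M [f [hM [B cB [Bo Bb]] [g fK gK] mf]]].
have /pfcard_geP[B0|/unsquash i] := cB.
  exists (fun=> set0); split=> // x y _; exfalso.
  have [U [BU _] _] := Bb (f x) setT filterT.
  by move: BU; rewrite B0.
exists (fun n => f @^-1` (i n)); split=> [n|x y xy].
  apply/mf; rewrite image_preimage; last first.
    by apply/seteqP; split=> // z _; exists (g z).
  by apply: sub_sigma_algebra; apply: Bo; exact: funS.
have fxy : f x != f y by apply/eqP => /(can_inj fK).
move: hM; rewrite open_hausdorff => /(_ _ _ fxy)[[U V] /= [xU yV] [oU oV /eqP UV]].
rewrite !inE in xU yV.
have [W /= [BW Wx] WU] := Bb (f x) U (open_nbhs_nbhs (conj oU xU)).
have [n _ nW] := 'surj_i BW; exists n; rewrite /preimage /= nW; split=> // Wy.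
have UVy : (U `&` V) (f y) by split=> //; exact: WU.
by rewrite UV in UVy.
Qed.

(** The intersections of finitely many [C k] containing [x] shrink to the null set [[set x]], so one
    of them is small. There are countably many such intersections, and finitely many of the small
    ones cover all but a small remainder. *)
Lemma small_cover (P : probability T R) (C : nat -> set T) (r : R) :
  separated_by C -> diffuse P -> 0 < r -> exists s : seq (set T),
  [/\ forall A, List.In A s -> measurable A, forall A, List.In A s -> pr P A <= r &
      forall x, exists2 A, List.In A s & A x].
Proof.
move=> [mC sepC] dP r0.
pose D (l : seq nat) := \big[setI/setT]_(k <- l) C k.
have mD l : measurable (D l).
  by rewrite /D; elim/big_ind: _ => //; exact: measurableI.
pose E n : set T := if choice.unpickle n is Some l then
   if pr P (D l) <= r then D l else set0 else set0.
have mE n : measurable (E n) by rewrite /E; case: choice.unpickle => // l; case: ifP.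
have EP n : pr P (E n) <= r.
  have h0 : pr P set0 <= r by rewrite pr0; exact: ltW.
  by rewrite /E; case: choice.unpickle => // l; case: ifP.
have Ecov x : (\bigcup_n E n) x.
  pose F k := if pselect (C k x) then ~` C k else set0.
  have mF k : measurable (F k).
    by rewrite /F; case: pselect => ?; [exact: measurableC (mC k)|exact: measurable0].
  have [N hN] := pr_bigcup_approx P mF r0.
  pose l := seq.filter (fun k => `[< C k x >]) (iota 0 N).
  have Dx : D l x.
    rewrite /D /l -bigcap_seq => k /=; rewrite mem_filter => /andP[/asboolP //].
  have px0 : pr P [set x] = 0 by rewrite /pr dP.
  have mx : measurable [set x].
    rewrite (_ : [set x] = ~` \bigcup_k F k).
      by apply: measurableC; exact: bigcupT_measurable.
    apply/seteqP; split=> y /=.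
      by move=> -> [k _]; rewrite /F; case: pselect.
    move=> nF; apply: contrapT => yx; have [k [Cx nCy]] := sepC x y (fun e => yx (esym e)).
    by apply: nF; exists k => //; rewrite /F; case: pselect.
  have hD : pr P (D l) <= r.
    have : D l `<=` [set x] `|` (\bigcup_k F k `\` \big[setU/set0]_(k < N) F k).
      move=> y Dy; have [->|yx] := pselect (y = x); [by left|right; split].
        have [k [Cx nCy]] := sepC x y (fun e => yx (esym e)).
        by exists k => //; rewrite /F; case: pselect.
      rewrite -bigcup_mkord => -[k /= kN]; rewrite /F; case: pselect => // Cx; apply.
      move: Dy; rewrite /D /l -bigcap_seq; apply => /=.
      by rewrite mem_filter mem_iota /= kN andbT; apply/asboolP.
    have mU : measurable (\bigcup_k F k `\` \big[setU/set0]_(k < N) F k).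
      by apply: measurableD; [exact: bigcupT_measurable|exact: bigsetU_measurable].
    move=> sub; apply: (le_trans (pr_le P (mD l) (measurableU _ _ mx mU) sub)).
    by apply: (le_trans (prU_le P mx mU)); rewrite px0 add0r.
  by exists (choice.pickle l) => //; rewrite /E choice.pickleK hD.
have [N hN] := pr_bigcup_approx P mE r0.
have mrest : measurable (\bigcup_k E k `\` \big[setU/set0]_(k < N) E k).
  by apply: measurableD; [exact: bigcupT_measurable|exact: bigsetU_measurable].
(* The remainder of the countable cover, of measure at most [r], serves as one more piece. *)
exists ((\bigcup_k E k `\` \big[setU/set0]_(k < N) E k) :: [seq E k | k <- iota 0 N]).
have inE' A : List.In A [seq E k | k <- iota 0 N] -> exists k, A = E k.
  by elim: (iota 0 N) => //= k s IH [<-|/IH//]; exists k.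
split.
- by move=> A [<-//|/inE'[k ->]].
- by move=> A [<-//|/inE'[k ->]].
move=> x; have [[k kN Ex]|nE] := pselect (exists2 k, (k < N)%N & E k x).
  exists (E k) => //; right.
  have : k \in iota 0 N by rewrite mem_iota.
  elim: (iota 0 N) => //= k' s IH; rewrite inE => /predU1P[->|/IH ?]; by [left|right].
exists (\bigcup_k E k `\` \big[setU/set0]_(k < N) E k); first by left.
split; first exact: Ecov.
by rewrite -bigcup_mkord => -[k /= kN Ex]; apply: nE; exists k.
Qed.

End SmallCover.

(** * Composition of intertwiners *)

Section InterpolationUnion.
Context {R : realType} {d0 : measure_display} {X0 : measurableType d0}.
Context {G : groupType}.
Let X := power_space X0 G.
Variables (mu0 : probability X0 R) (mu : probability X R).
Hypothesis mu_power : is_power_measure mu0 mu.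
Context {L : groupType}.
Hypothesis cL : countable [set: L].
Variable w : G -> X -> L.

Let mu2 := product_prob mu mu.
Let Z := (X * (X * X))%type.
Let PZ : probability Z R := product_prob mu mu2.

(** Exchanging, where [mixed] overwrites, gives a measure preserving map of [Z], along which
    intertwiners can be pulled back. *)
Definition partial_swap (Ls : set X0) (z : Z) : Z := (z.1, swap (marked Ls z.1) z.2).

Lemma mp_partial_swap Ls : measurable Ls -> measure_preserving PZ PZ (partial_swap Ls).
Proof.
move=> mLs.
have e : (fun z : Z => swap (marked Ls z.1) z.2) =
    (fun z => (mixed Ls predT z, mixed Ls predT (z.1, (z.2.2, z.2.1)))).
  by apply/funext => -[p [x y]]; congr pair; apply/funext => g;
    rewrite /mixed /resample /= andbT.
have mpx p : measure_preserving mu2 mu2 (fun y => swap (marked Ls (p, y).1) (p, y).2).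
  exact: (mp_swap mu_power (marked Ls p)).
have mh : measurable_fun setT (fun z : Z => swap (marked Ls z.1) z.2).
  rewrite e; apply: measurable_fun_pair; first exact: measurable_mixed.
  apply: (measurableT_comp (measurable_mixed mLs predT)).
  apply: measurable_fun_pair; first exact: measurable_fst.
  by apply: measurable_fun_pair; apply: measurableT_comp.
exact: (mp_fibered mu mh mpx).
Qed.

(** The intertwiner for [A] leads to the point mixed over [A]; the one for [B], pulled back along
    the exchange over [A], continues from there. By disjointness the exchange leaves the coordinates
    marked by [B] unchanged in both configurations. *)
Lemma interpolatedU (A B : set X0) : measurable A -> measurable B -> A `&` B = set0 ->
  interpolated mu w A -> interpolated mu w B -> interpolated mu w (A `|` B).
Proof.
move=> mA mB AB [xi mxi hxi] [xj mxj hxj].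
have mp := mp_partial_swap mA.
exists (fun z => xi z * xj (partial_swap A z))%g.
  by apply: (dmeasurable_mul cL) => //; exact: (dmeasurable_comp mxj mp.1).
move=> t; apply: filterS (filterI (hxi t) (ae_mp mp (hxj t))) => z [/= h1 h2].
have e1 : (partial_swap A z).2.1 = mixed A predT z.
  by apply/funext => g; rewrite /mixed /resample /= andbT.
have e2 : mixed B predT (partial_swap A z) = mixed (A `|` B) predT z.
  apply/funext => g; rewrite /mixed /partial_swap /swap /resample /marked /= !andbT.
  case: (asboolP ((A `|` B) (z.1 g))) => [[h|h]|h].
  - have nB : ~ B (z.1 g) by move=> h'; have : (A `&` B) (z.1 g) by []; rewrite AB.
    by rewrite asboolF// asboolT.
  - have nA : ~ A (z.1 g) by move=> h'; have : (A `&` B) (z.1 g) by []; rewrite AB.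
    by rewrite asboolT// asboolF.
  - by rewrite !asboolF// => h'; apply: h; [left|right].
rewrite mulgA h1 -!mulgA; congr (_ * _)%g.
by rewrite -e2 -h2 -e1.
Qed.

Lemma interpolated_full (r : R) (C : nat -> set X0) : separated_by C -> diffuse mu0 ->
  0 < r -> (forall Ls, measurable Ls -> pr mu0 Ls <= r -> interpolated mu w Ls) ->
  interpolated mu w setT.
Proof.
move=> sepC dmu r0 small.
have [s [ms ps cs]] := small_cover sepC dmu r0.
pose U (s' : seq (set X0)) := \big[setU/set0]_(A <- s') A.
have -> : setT = U s.
  apply/seteqP; split=> // x _; have [A As Ax] := cs x.
  rewrite /U; elim: s As {ms ps cs} => //= B s IH [->|/IH h]; rewrite big_cons.
    by left.
  by right.
suff [] : measurable (U s) /\ interpolated mu w (U s) by [].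
elim: s ms ps {cs} => [|A s IH] ms ps.
  rewrite /U big_nil; split=> //; apply: small => //; rewrite pr0; exact: ltW.
have [mU iU] := IH (fun B h => ms B (or_intror h)) (fun B h => ps B (or_intror h)).
have mA : measurable A by apply: ms; left.
have mD : measurable (A `\` U s) by exact: measurableD.
rewrite /U big_cons -/(U s); split; first exact: measurableU.
rewrite (_ : A `|` U s = U s `|` (A `\` U s)); last first.
  apply/seteqP; split=> x; last by move=> [h|[h _]]; [right|left].
  by move=> h; have [Ux|nU] := pselect (U s x); [left|right; split=> //; case: h].
apply: interpolatedU => //; first by apply/seteqP; split=> // x [? []].
apply: small => //; apply: le_trans (ps A (or_introl erefl)).
by apply: pr_le => // x [].
Qed.

End InterpolationUnion.

(** [u1] cancels between the first two equations and [u3] between the last two; what remains says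
    that the two ratios are conjugate by [A]. *)
Lemma ratio_conj (L : groupType) (A B u1 u3 p1 p2 p3 p4 q1 q2 q3 q4 : L) :
  (A * q1 = p1 * u1 -> B * q2 = p2 * u1 -> A * q3 = p3 * u3 -> B * q4 = p4 * u3 ->
  p1 * p2^-1 * (p3 * p4^-1)^-1 = 1 -> q1 * q2^-1 * (q3 * q4^-1)^-1 = 1)%g.
Proof.
have e (c x1 x2 y1 y2 : L) : (A * y1 = x1 * c -> B * y2 = x2 * c ->
    y1 * y2^-1 = A^-1 * (x1 * x2^-1) * B)%g.
  move=> h1 h2; have -> : y1 = (A^-1 * (x1 * c))%g by rewrite -h1 mulKg.
  have -> : y2 = (B^-1 * (x2 * c))%g by rewrite -h2 mulKg.
  by rewrite !invgM invgK !mulgA mulgK.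
move=> h1 h2 h3 h4 h; rewrite (e _ _ _ _ _ h1 h2) (e _ _ _ _ _ h3 h4).
have -> : (p1 * p2^-1 = p3 * p4^-1)%g.
  by rewrite -[LHS](mulgVK (p3 * p4^-1)%g) h mul1g.
by rewrite mulgV.
Qed.

Section Untwisting.
Context {R : realType} {G L : groupType}.
Hypothesis iG : infinite_set [set: G].
Hypothesis cL : countable [set: L].
Context d d' (X : measurableType d) (Q : measurableType d').
Variables (P : probability X R) (PQ : probability Q R).
Variables (a : G -> X -> X) (b : G -> Q -> Q).
Hypothesis aP : forall t, measure_preserving P P (a t).
Hypothesis bP : forall t, measure_preserving PQ PQ (b t).
Hypotheses (mixa : mixing P a) (mixb : mixing PQ b).
Variables (w : G -> X -> L) (u : G -> Q -> L) (zeta : Q * X -> L).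
Hypothesis mzeta : dmeasurable zeta.
Hypothesis zetaP : forall t, {ae product_prob PQ P, forall z,
  (w t z.2 * zeta (b t^-1%g z.1, a t^-1%g z.2) = zeta z * u t z.1)%g}.

Let W := ((Q * Q) * (X * X))%type.
Let PW : probability W R := product_prob (product_prob PQ PQ) (product_prob P P).
Let c t (z : W) : W := ((b t z.1.1, b t z.1.2), (a t z.2.1, a t z.2.2)).

(* [ratio] is trivial when [zeta] is a product of functions of the two variables; it
   is conjugated by the action, so that mixing applies to the set where it is 1. *)
Let ratio (z : W) : L := (zeta (z.1.1, z.2.1) * (zeta (z.1.1, z.2.2))^-1 *
  (zeta (z.1.2, z.2.1) * (zeta (z.1.2, z.2.2))^-1)^-1)%g.

Let corner1 := mp_product (mp_fst PQ PQ) (mp_fst P P).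
Let corner2 := mp_product (mp_fst PQ PQ) (mp_snd P P).
Let corner3 := mp_product (mp_snd PQ PQ) (mp_fst P P).
Let corner4 := mp_product (mp_snd PQ PQ) (mp_snd P P).

Lemma dmeasurable_ratio : dmeasurable ratio.
Proof.
apply: (dmeasurable_op2 cL cL (fun a b => a * b^-1)%g);
  apply: (dmeasurable_op2 cL cL (fun a b => a * b^-1)%g).
- exact: (dmeasurable_comp mzeta corner1.1).
- exact: (dmeasurable_comp mzeta corner2.1).
- exact: (dmeasurable_comp mzeta corner3.1).
- exact: (dmeasurable_comp mzeta corner4.1).
Qed.

Lemma ratio_trivial : {ae PW, forall z, ratio z = 1%g}.
Proof.
pose S := ratio @^-1` [set 1%g].
have mS : measurable S by exact: dmeasurable_ratio.
have inv t : {ae PW, forall z, S z -> S (c t^-1%g z)}.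
  apply: filterS (filterI (filterI (ae_mp corner1 (zetaP t)) (ae_mp corner2 (zetaP t)))
    (filterI (ae_mp corner3 (zetaP t)) (ae_mp corner4 (zetaP t)))) => z [[h1 h2] [h3 h4]].
  exact: ratio_conj h1 h2 h3 h4.
have cP t : measure_preserving PW PW (c t).
  exact: (mp_product (mp_product (bP t) (bP t)) (mp_product (aP t) (aP t))).
have mixc : mixing PW c.
  exact: (mixing_product (fun t => mp_product (bP t) (bP t))
    (fun t => mp_product (aP t) (aP t)) (mixing_product bP bP mixb mixb)
    (mixing_product aP aP mixa mixa)).
have Sinv t : pr PW (S `&` c t @^-1` S) = pr PW S.
  have mS' : measurable (c t @^-1` S) by apply: measurable_preimage => //; exact: (cP t).1.
  rewrite [RHS](prDI PW mS mS') [X in _ = X + _](_ : _ = 0) ?add0r//.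
  apply: pr0_ae; first exact: measurableD.
  by apply: filterS (inv t^-1%g) => z; rewrite invgK => h [Sz nS]; apply: nS; exact: h.
have [S0|S1] := mixing_zero_one mixc iG mS (fun t _ => Sinv t); last first.
  apply: filterS (ae_pr0 (measurableC mS) _) => [z /contrapT//|].
  by rewrite prC// S1 subrr.
(* If the ratio were almost never 1, then for some fixed pair [x], [x'] the function [f] would take
   different values at almost all pairs of independent points; a function with countable range
   cannot. *)
exfalso; have aeN := ae_sections (ae_mp (mp_swap_factors _ _) (ae_pr0 mS S0)).
have [[x x'] /= h] := ae_ex aeN.
pose f q := (zeta (q, x) * (zeta (q, x'))^-1)%g.
have mz y : dmeasurable (fun q => zeta (q, y)).
  move=> l; exact: (measurable_preimage (pair2_measurable y) (mzeta l)).
have mf : dmeasurable f.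
  by apply: (dmeasurable_op2 cL cL (fun a b => a * b^-1)%g).
have fN l : {ae PQ, forall q, ~ (f q = l)}.
  apply: ae_pr0; first exact: mf.
  have mE := measurableX (mf l) (mf l).
  have : pr (product_prob PQ PQ) ((f @^-1` [set l]) `*` (f @^-1` [set l])) = 0.
    apply: pr0_ae => //; apply: filterS h => -[q q'] /= h [e1 e2]; apply: h.
    by rewrite /S /ratio /= -/(f q) -/(f q') e1 e2 mulgV.
  by rewrite pr_rect// => /eqP; rewrite mulf_eq0 orbb => /eqP.
have [q hq] := ae_ex (ae_countable cL fN).
exact: (hq (f q)).
Qed.

(** Triviality of the ratio splits [zeta (q, x)] as [v x * k q]. The intertwining relation then
    equates an expression in [x] with one in [q], so both are constant, and [delta t] is the value
    at one good [q]. *)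
Lemma untwist : exists (v : X -> L) (delta : G -> L), dmeasurable v /\
  forall t, {ae P, forall x, (w t x * v (a t^-1%g x) = v x * delta t)%g}.
Proof.
have h := ae_sections (ae_mp (mp_interchange PQ P PQ P) ratio_trivial).
have [[q0 x0] /= {}h] := ae_ex h.
exists (fun x => zeta (q0, x)).
pose k q := ((zeta (q0, x0))^-1 * zeta (q, x0))%g.
have {}h : {ae product_prob PQ P, forall z, zeta z = (zeta (q0, z.2) * k z.1)%g}.
  apply: filterS h => -[q x] /=; rewrite /ratio /= /k => e.
  have {}e : (zeta (q0, x0) * (zeta (q0, x))^-1 = zeta (q, x0) * (zeta (q, x))^-1)%g.
    by rewrite -[LHS](mulgVK (zeta (q, x0) * (zeta (q, x))^-1)%g) e mul1g.
  apply: (mulgI (zeta (q0, x0) * (zeta (q0, x))^-1)%g).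
  by rewrite {1}e mulgVK mulgA mulgVK mulVKg.
clearbody k.
have /choice[delta hd] : forall t, exists l, {ae P, forall x,
    (w t x * zeta (q0, a t^-1%g x) = zeta (q0, x) * l)%g}.
  move=> t; have mp := mp_product (bP t^-1%g) (aP t^-1%g).
  have [q hq] := ae_ex (ae_sections (filterI (filterI h (ae_mp mp h)) (zetaP t))).
  exists (k q * u t q * (k (b t^-1%g q))^-1)%g.
  apply: filterS hq => x /= [[e1 e2] e3].
  move: e3; rewrite e1 e2 /= => e3.
  apply: (mulIg (k (b t^-1 q))).
  by rewrite -[LHS]mulgA e3 !mulgA mulgVK.
by exists delta; split=> // l; exact: (measurable_preimage (pair1_measurable q0) (mzeta l)).
Qed.

End Untwisting.

(** * From orbit equivalence to conjugacy *)

Lemma multiplicative_ex (G H : groupType) (f : G -> H) :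
  {morph f : s t / (s * t)%g} -> exists g : {multiplicative G -> H}, g =1 f.
Proof.
move=> fM.
pose g : {multiplicative G -> H} := HB.pack f (isMultiplicative.Build G H f fM).
by exists g.
Qed.

Section OrbitEquivalence.
Context {R : realType} {G L : groupType}.
Hypotheses (cG : countable [set: G]) (cL : countable [set: L]).
Context d d' (X : measurableType d) (Y : measurableType d').
Variables (mu : probability X R) (nu : probability Y R).
Variables (a : G -> X -> X) (b : L -> Y -> Y).
Hypotheses (aP : pmp_action mu a) (bP : pmp_action nu b).

Lemma pmp_mp d1 (T : measurableType d1) (P : probability T R) (H : groupType)
    (f : H -> T -> T) : pmp_action P f -> forall t, measure_preserving P P (f t).
Proof. by move=> fP t; split; [exact: (pmp_measurable fP)|exact: (pmp_preserving fP)]. Qed.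

Lemma pmp_actK d1 (T : measurableType d1) (P : probability T R) (H : groupType)
    (f : H -> T -> T) : pmp_action P f -> forall t, cancel (f t) (f t^-1%g).
Proof. by move=> fP t x; rewrite -(pmp_actM fP) mulVg (pmp_act1 fP). Qed.

Lemma measurable_eq_separated d1 (T : measurableType d1) (C : nat -> set X) (f g : T -> X) :
  separated_by C -> measurable_fun setT f -> measurable_fun setT g ->
  measurable [set x | f x = g x].
Proof.
move=> [mC sepC] mf mg.
rewrite (_ : [set x | _] = ~` \bigcup_n ((f @^-1` C n) `&` (g @^-1` ~` C n))).
  apply: measurableC; apply: bigcupT_measurable => n; apply: measurableI.
    exact: (measurable_preimage mf (mC n)).
  exact: (measurable_preimage mg (measurableC (mC n))).
apply/seteqP; split=> x /=; first by move=> e [n _ [/= h1 h2]]; apply: h2; rewrite -e.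
by move=> h; apply: contrapT => /sepC[n [h1 h2]]; apply: h; exists n.
Qed.

Variables (C : nat -> set X) (th : X -> Y) (th' : Y -> X).
Hypothesis sepC : separated_by C.
Hypothesis mth : measure_preserving mu nu th.
Hypothesis mth' : measurable_fun setT th'.
Hypothesis thK : {ae mu, forall x, th' (th x) = x}.
Hypothesis th'K : {ae nu, forall y, th (th' y) = y}.
Hypothesis orbP : {ae mu, forall x, th @` act_orbit a x = act_orbit b (th x)}.
Hypothesis b_free : free_action nu b.

Lemma mp_inverse : measure_preserving nu mu th'.
Proof.
split=> // A mA; have mA' := measurable_preimage mth' mA.
rewrite -[LHS](mth.2 _ mA'); have mA2 := measurable_preimage mth.1 mA'.
rewrite -!prE//; congr EFin; apply/eqP; rewrite eq_le; apply/andP.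
have e : {ae mu, forall x, th' (th x) \in A = (x \in A)}.
  by apply: filterS thK => x ->.
have sub (B D : set X) : measurable B -> measurable D ->
    {ae mu, forall x, B x -> D x} -> pr mu B <= pr mu D.
  move=> mB mD BD; rewrite (prDI mu mB mD) (pr0_ae (S := B `\` D)) ?add0r.
  - by apply: pr_le => //; exact: measurableI.
  - exact: measurableD.
  - by apply: filterS BD => x h [/h].
split; apply: sub => //; apply: filterS thK => x /= e' /=.
  by rewrite /preimage /= e'.
by rewrite /preimage /= e'.
Qed.

(** The Zimmer cocycle: freeness makes the element of [L] unique. The identity is wanted at every
    point, so the cocycle is set to 1 off an invariant conull set. *)
Lemma cocycle_ex : exists c : G -> X -> L, [/\ forall t, dmeasurable (c t),
  forall s t x, c (s * t)%g x = (c s (a t x) * c t x)%g &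
  {ae mu, forall x t, th (a t x) = b (c t x) (th x)}].
Proof.
have mb := pmp_mp bP; have ma := pmp_mp aP.
pose S x := [/\ th' (th x) = x, th @` act_orbit a x = act_orbit b (th x),
  forall l, b l (th x) = th x -> l = 1%g & forall l, th (th' (b l (th x))) = b l (th x)].
have aeS : {ae mu, forall x, S x}.
  have h3 : {ae mu, forall x, forall l, b l (th x) = th x -> l = 1%g}.
    exact: (ae_mp mth b_free).
  have h4 : {ae mu, forall x, forall l, th (th' (b l (th x))) = b l (th x)}.
    apply: (ae_countable cL) => l; exact: (ae_mp (mp_comp mth (mb l)) th'K).
  by apply: filterS (filterI (filterI thK orbP) (filterI h3 h4)) => x [[? ?] [? ?]].
have [N [mN N0 SN]] := aeS.
(* The points whose whole orbit avoids the exceptional null set; unlike the complement of [N], this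
   set is invariant. *)
pose Gd := [set x | forall t, ~ N (a t x)].
have GdS x t : Gd x -> S (a t x).
  by move=> Gx; apply: contrapT => nS; apply: (Gx t); exact: SN.
have GdS1 x : Gd x -> S x by move=> /(GdS x 1%g); rewrite (pmp_act1 aP).
have GdM x t : Gd (a t x) <-> Gd x.
  split=> h s; last by rewrite -(pmp_actM aP); exact: h.
  by have := h (s * t^-1)%g; rewrite -(pmp_actM aP) mulgVK.
have mGd : measurable Gd.
  rewrite (_ : Gd = ~` \bigcup_t (a t @^-1` N)).
    apply: measurableC; apply: countable_bigcupT_measurable => // t.
    exact: (measurable_preimage (ma t).1 mN).
  apply/seteqP; split=> x h; first by move=> [t _]; exact: h.
  by move=> t nx; apply: h; exists t.
have aeGd : {ae mu, forall x, Gd x}.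
  have pN0 : pr mu N = 0 by rewrite /pr N0.
  by apply: (ae_countable cG) => t; exact: (ae_mp (ma t) (ae_pr0 mN pN0)).
pose c t x : L := if pselect (Gd x) then xget 1%g [set l | b l (th x) = th (a t x)] else 1%g.
have c_uniq x l l' : Gd x -> b l (th x) = b l' (th x) -> l = l'.
  move=> /GdS1[_ _ fr _] e; apply: (mulgI l'^-1%g); rewrite mulVg; apply: fr.
  by rewrite (pmp_actM bP) e (pmp_actK bP).
have cE x t : Gd x -> b (c t x) (th x) = th (a t x).
  move=> Gx; rewrite /c; case: pselect => // Gx'.
  have [_ orb _ _] := GdS1 x Gx.
  have : act_orbit b (th x) (th (a t x)).
    by rewrite -orb; exists (a t x) => //; exists t.
  move=> [l _ hl].
  exact: (xgetPex 1%g (P := [set l | b l (th x) = th (a t x)]) (ex_intro _ l hl)).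
have c1 x t : ~ Gd x -> c t x = 1%g by rewrite /c; case: pselect.
exists c; split.
- move=> t l.
  (* Applying [th'] turns the defining equation into one between maps to [X], where coincidence sets
     are measurable. *)
  rewrite (_ : _ @^-1` _ = (Gd `&` [set x | a t x = th' (b l (th x))]) `|`
     (~` Gd `&` [set _ | l = 1%g])).
    apply: measurableU; apply: measurableI => //.
    + apply: (measurable_eq_separated sepC); first exact: (ma t).1.
      apply: (measurableT_comp mth'); apply: (measurableT_comp (mb l).1); exact: mth.1.
    + exact: measurableC.
    + exact: measurable_prop.
  apply/seteqP; split=> x /=.
    have [Gx|nG] := pselect (Gd x); last by rewrite c1// => ->; right.
    move=> <-; left; split=> //; have := cE x t Gx => ->.
    by have [-> _ _ _] := GdS x t Gx.
  move=> [[Gx e]|[nG ->]]; last by rewrite c1.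
  apply: (c_uniq x) => //; rewrite cE// e.
  by have [_ _ _ ->] := GdS1 x Gx.
- move=> s t x; have [Gx|nG] := pselect (Gd x); last first.
    by rewrite !c1 ?mulg1// => /GdM.
  have Gtx : Gd (a t x) by apply/GdM.
  by apply: (c_uniq x) => //; rewrite (pmp_actM bP) !cE// (pmp_actM aP).
- by apply: filterS aeGd => x Gx t; rewrite cE.
Qed.

(** * The conjugacy obtained from an untwisted cocycle *)

Section Conjugacy.
Variables (c : G -> X -> L) (v : X -> L) (delta : G -> L).
Hypothesis cP : {ae mu, forall x t, th (a t x) = b (c t x) (th x)}.
Hypothesis cM : forall s t x, c (s * t)%g x = (c s (a t x) * c t x)%g.
Hypothesis mv : dmeasurable v.
Hypothesis vP : forall t, {ae mu, forall x, (c t x * v x = v (a t x) * delta t)%g}.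
Hypothesis mixa : mixing mu a.
Hypothesis iccG : icc G.
Hypothesis dmu : diffuse mu.

Let ma := pmp_mp aP.
Let mb := pmp_mp bP.

(** The orbit equivalence corrected by the transfer function: each point is moved within its orbit
    so that the map becomes equivariant through [delta]. *)
Let vt x := b (v x)^-1%g (th x).

Let good x := [/\ forall l, b l (th x) = th x -> l = 1%g,
  th @` act_orbit a x = act_orbit b (th x),
  forall t, th (a t x) = b (c t x) (th x),
  forall t, th' (th (a t x)) = a t x &
  forall t, (c t x * v x = v (a t x) * delta t)%g].

Let goodP : {ae mu, forall x, good x}.
Proof.
have h1 : {ae mu, forall x, forall l, b l (th x) = th x -> l = 1%g}.
  exact: (ae_mp mth b_free).
have h2 : {ae mu, forall x, forall t, th' (th (a t x)) = a t x}.
  by apply: (ae_countable cG) => t; exact: (ae_mp (ma t) thK).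
have h3 : {ae mu, forall x, forall t, (c t x * v x = v (a t x) * delta t)%g}.
  exact: (ae_countable cG).
by apply: filterS (filterI (filterI (filterI h1 orbP) (filterI cP h2)) h3)
  => x [[[? ?] [? ?]] ?].
Qed.

Let good_thK x : good x -> th' (th x) = x.
Proof. by move=> [_ _ _ /(_ 1%g)]; rewrite (pmp_act1 aP). Qed.

Let good_orbit x x' l : good x -> good x' -> th x' = b l (th x) -> exists t, x' = a t x.
Proof.
move=> gx gx' e; have [_ orb _ h _] := gx.
have : act_orbit b (th x) (th x') by exists l.
rewrite -orb => -[_ [t _ <-] e']; exists t.
by rewrite -[LHS](good_thK gx') -e' h.
Qed.

Let vt_equiv x t : good x -> vt (a t x) = b (delta t) (vt x).
Proof.
move=> [_ _ h _ h']; rewrite /vt h -!(pmp_actM bP); congr b.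
by apply: (mulgI (v (a t x))); rewrite mulVKg mulgA -h' mulgK.
Qed.

Let vt_free x l : good x -> b l (vt x) = vt x -> l = 1%g.
Proof.
move=> [fr _ _ _ _] e.
have {}e : b (v x * l * (v x)^-1)%g (th x) = th x.
  by rewrite !(pmp_actM bP) -/(vt x) e /vt -(pmp_actM bP) mulgV (pmp_act1 bP).
have := fr _ e; rewrite -mulgA => /(congr1 (fun g => (v x)^-1 * g)%g).
by rewrite mulKg mulg1 => /(congr1 (fun g => g * v x)%g); rewrite mulgVK mulVg.
Qed.

Let measurable_piecewise d1 d2 (T : measurableType d1) (T' : measurableType d2)
    (u : T -> L) (f : L -> T -> T') : dmeasurable u ->
  (forall l, measurable_fun setT (f l)) -> measurable_fun setT (fun x => f (u x) x).
Proof.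
move=> mu' mf _ B mB; rewrite setTI.
rewrite (_ : _ @^-1` B = \bigcup_l ((u @^-1` [set l]) `&` (f l @^-1` B))).
  apply: countable_bigcupT_measurable => // l; apply: measurableI => //.
  exact: (measurable_preimage (mf l) mB).
by apply/seteqP; split=> [x Bx|x [l _ [/= <-]]//]; exists (u x).
Qed.

Let measurable_vt : measurable_fun setT vt.
Proof.
apply: (measurable_piecewise (f := fun l x => b l^-1%g (th x)) mv) => l.
apply: (measurableT_comp (mb _).1); exact: mth.1.
Qed.

Lemma delta_mul s t : delta (s * t)%g = (delta s * delta t)%g.
Proof.
have h : {ae mu, forall x, good x /\ good (a t x)}.
  exact: filterI goodP (ae_mp (ma t) goodP).
have [x [[_ _ _ _ h1] [_ _ _ _ h2]]] := ae_ex h.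
apply: (mulgI (v (a (s * t)%g x))); rewrite -h1 cM -mulgA h1 !mulgA h2.
by rewrite (pmp_actM aP).
Qed.

Let delta1 : delta 1%g = 1%g.
Proof. by apply: (mulgI (delta 1%g)); rewrite -delta_mul !mulg1. Qed.

Let deltaV t : delta t^-1%g = (delta t)^-1%g.
Proof. by apply: (mulgI (delta t)); rewrite -delta_mul !mulgV delta1. Qed.

(* A nontrivial kernel is infinite, so by mixing [vt] maps [mu] to a measure with
   values 0 and 1; but [vt] is injective on [v @^-1` [set l]]. *)
Lemma delta_inj : injective delta.
Proof.
suff ker t : delta t = 1%g -> t = 1%g.
  move=> s t e; apply: (mulIg t^-1%g); rewrite mulgV; apply: ker.
  by rewrite delta_mul deltaV e mulgV.
move=> t1; apply: contrapT => t_nt.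
pose N := [set s | delta s = 1%g].
(* The conjugacy class of [t] lies in the kernel. *)
have iN : infinite_set N.
  move=> fN; apply: (iccG t_nt); apply: sub_finite_set fN => _ [s _ <-] /=.
  by rewrite /N /= conjgE !delta_mul t1 deltaV mul1g mulVg.
have zero_one B : measurable B -> pr mu (vt @^-1` B) = 0 \/ pr mu (vt @^-1` B) = 1.
  move=> mB; have mA := measurable_preimage measurable_vt mB.
  apply: (mixing_zero_one mixa iN mA) => s Ns.
  have mA' := measurable_preimage (ma s).1 mA.
  rewrite [RHS](prDI mu mA mA') [X in _ = X + _](_ : _ = 0) ?add0r//.
  apply: pr0_ae; first exact: measurableD.
  apply: filterS goodP => x gx [Bx]; apply.
  by rewrite /preimage /= vt_equiv// (_ : delta s = 1%g)// (pmp_act1 bP).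
have vl0 l : {ae mu, forall x, ~ (v x = l)}.
  apply: ae_pr0; first exact: mv.
  apply/eqP; rewrite eq_le pr_ge0 andbT leNgt; apply/negP => p0.
  (* A piece [A] has at most half the measure of the level set. By the zero-one law, either almost
     no point of the level set lies in [A], or almost all do, which the measures forbid. Since the
     pieces cover, the level set is null. *)
  have r0 : 0 < pr mu (v @^-1` [set l]) / 2 by rewrite divr_gt0.
  have [s [ms ps cs]] := small_cover sepC dmu r0.
  have s0 A : List.In A s -> {ae mu, forall x, ~ (v x = l /\ A x)}.
    move=> As; have mA := ms A As.
    pose B := (th' \o b l) @^-1` A.
    have mB : measurable B.
      by apply: measurable_preimage => //; apply: measurableT_comp => //; exact: (mb l).1.
    have BA x : good x -> v x = l -> B (vt x) <-> A x.
      move=> gx vx; rewrite /B /preimage /= /vt vx -(pmp_actM bP) mulgV (pmp_act1 bP).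
      by rewrite good_thK.
    have mvB := measurable_preimage measurable_vt mB.
    have [h|h] := zero_one B mB.
      apply: filterS (filterI goodP (ae_pr0 mvB h)) => x [gx nB] [vx Ax]; apply: nB.
      exact/BA.
    exfalso; have h1 : pr mu (v @^-1` [set l]) <= pr mu A.
      rewrite (prDI mu (mv l) mA) (pr0_ae (S := _ `\` _)) ?add0r.
      - by apply: pr_le => //; exact: measurableI.
      - exact: measurableD.
      have hC : pr mu (~` (vt @^-1` B)) = 0 by rewrite prC// h subrr.
      apply: filterS (filterI goodP (ae_pr0 (measurableC mvB) hC)) => x [gx nnB] [vx nA].
      by apply: nnB => Bx; apply: nA; exact/(BA x gx vx).
    have h2 := le_trans h1 (ps A As); move: h2 p0.
    by rewrite ler_pdivlMr// mulrDr mulr1 gerDl; case: ltgtP.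
  have : {ae mu, forall x, forall A, List.In A s -> ~ (v x = l /\ A x)}.
    elim: s s0 {ms ps cs} => [|A s IH] s0; first by apply: nearW => x A [].
    have h := IH (fun B hB => s0 B (or_intror hB)).
    apply: filterS (filterI (s0 A (or_introl erefl)) h) => x [h1 h2] B [<-//|]; exact: h2.
  move=> h; move: p0; rewrite (pr0_ae (mv l)) ?ltxx//.
  by apply: filterS h => x h vx; have [A As Ax] := cs x; apply: (h A As).
have [x hx] := ae_ex (ae_countable cL vl0).
exact: (hx (v x)).
Qed.

Let good_inj x x' : good x -> good x' -> vt x = vt x' -> x = x'.
Proof.
move=> gx gx' e.
have e' : th x' = b (v x' * (v x)^-1)%g (th x).
  by rewrite (pmp_actM bP) -/(vt x) e /vt -(pmp_actM bP) mulgV (pmp_act1 bP).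
have [t xt] := good_orbit gx gx' e'.
have : delta t = 1%g by apply: (vt_free gx); rewrite -vt_equiv// -xt.
by rewrite -delta1 => /delta_inj t1; rewrite xt t1 (pmp_act1 aP).
Qed.

(* [th' \o b l] is the inverse of [vt] on [V l]. *)
Let V l := [set y | v (th' (b l y)) = l].

Let mV l : measurable (V l).
Proof.
have h : measurable_fun setT (th' \o b l).
  by apply: measurableT_comp => //; exact: (mb l).1.
exact: (measurable_preimage h (mv l)).
Qed.

Let good2 y := forall l, good (th' (b l y)) /\ th (th' (b l y)) = b l y.

Let good2P : {ae nu, forall y, good2 y}.
Proof.
apply: (ae_countable cL) => l.
apply: filterI; last exact: (ae_mp (mb l) th'K).
exact: (ae_mp (mp_comp (mb l) mp_inverse) goodP).
Qed.

Let vtK y l : good2 y -> V l y -> vt (th' (b l y)) = y.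
Proof.
move=> /(_ l)[_ e]; rewrite /V /= /vt e => ->.
by rewrite -(pmp_actM bP) mulVg (pmp_act1 bP).
Qed.

Let V_uniq y l l' : good2 y -> V l y -> V l' y -> l = l'.
Proof.
move=> gy Vl Vl'; rewrite -Vl -Vl'; congr v.
apply: good_inj; [exact: (gy l).1|exact: (gy l').1|].
by rewrite !vtK.
Qed.

Lemma pr_ae_eq d1 (T : measurableType d1) (P : probability T R) (A B : set T) :
  measurable A -> measurable B -> {ae P, forall x, A x <-> B x} -> pr P A = pr P B.
Proof.
move=> mA mB h.
rewrite (prDI P mA mB) (prDI P mB mA) setIC; congr (_ + _).
rewrite !pr0_ae//; do ?exact: measurableD.
- by apply: filterS h => x h [/h].
- by apply: filterS h => x h [/h].
Qed.

Let vt_piece B l : measurable B ->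
  pr mu (vt @^-1` B `&` v @^-1` [set l]) = pr nu (B `&` V l).
Proof.
move=> mB; have mS : measurable (vt @^-1` B `&` v @^-1` [set l]).
  by apply: measurableI => //; exact: (measurable_preimage measurable_vt mB).
rewrite -(mp_pr (mp_comp (mb l) mp_inverse) mS); apply: pr_ae_eq.
- exact: (measurable_preimage (mp_comp (mb l) mp_inverse).1 mS).
- exact: measurableI.
apply: filterS good2P => y gy; split.
  by move=> [/= h1 h2]; split=> //; move: h1; rewrite /preimage /= vtK.
by move=> [By Vy]; split=> //; rewrite /preimage /= vtK.
Qed.

Let vt_pieces B (s : seq L) : measurable B -> uniq s ->
  pr mu (vt @^-1` B `&` [set x | v x \in s]) = pr nu (B `&` [set y | exists2 l, l \in s & V l y]).
Proof.
move=> mB; have mvB := measurable_preimage measurable_vt mB.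
have mvs (s' : seq L) : measurable [set x | v x \in s'] by exact: (dmeasurable_set cL [set l | l \in s']).
have mU (s' : seq L) : measurable [set y | exists2 l, l \in s' & V l y].
  rewrite (_ : [set y | _] = \big[setU/set0]_(l <- s') V l).
    exact: bigsetU_measurable.
  rewrite -bigcup_seq; apply/seteqP; split=> y [l h1 h2]; by exists l.
elim: s => [|l s IH].
  have e0 : [set x | v x \in [::]] = set0 by apply/seteqP; split.
  have e1 : [set y | exists2 l, l \in [::] & V l y] = set0.
    by apply/seteqP; split=> // y [].
  by rewrite e0 e1 !setI0 !pr0.
move=> /= /andP[ls us].
have m1 : measurable (vt @^-1` B `&` [set x | v x \in l :: s]) by exact: measurableI.
have m2 : measurable (B `&` [set y | exists2 l', l' \in l :: s & V l' y]) by exact: measurableI.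
rewrite (prDI mu m1 (mv l)) (prDI nu m2 (mV l)); congr (_ + _).
  rewrite (_ : _ `\` _ = vt @^-1` B `&` [set x | v x \in s]); last first.
    apply/seteqP; split=> x /=; first by rewrite inE => -[[h1 /predU1P[->|//]]].
    move=> [h1 h2]; split; first by split=> //; rewrite inE h2 orbT.
    by move=> e; move: ls; rewrite -e h2.
  rewrite (IH us); apply: pr_ae_eq; [exact: measurableI|exact: measurableD|].
  apply: filterS good2P => y gy; split.
    move=> [By [l' l's Vy]]; split; first by split=> //; exists l' => //; rewrite inE l's orbT.
    by move=> Vly; move: ls; rewrite (V_uniq gy Vly Vy) l's.
  move=> [[By [l' + Vy]] nV]; rewrite inE => /predU1P[l'l|l's].
    by exfalso; apply: nV; rewrite -l'l.
  by split=> //; exists l'.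
transitivity (pr mu (vt @^-1` B `&` v @^-1` [set l])).
  congr pr; apply/seteqP; split=> x; first by move=> [[h1 _] h2].
  by move=> [h1 h2]; split=> //; split=> //; rewrite /= h2 mem_head.
rewrite vt_piece//; congr pr; apply/seteqP; split=> y.
  by move=> [h1 h2]; split=> //; split=> //; exists l => //; exact: mem_head.
by move=> [[h1 _] h2].
Qed.

(* An inequality is enough, as it applies to the complement of [B] as well. *)
Lemma mp_vt : measure_preserving mu nu vt.
Proof.
have le B : measurable B -> pr mu (vt @^-1` B) <= pr nu B.
  move=> mB; have mvB := measurable_preimage measurable_vt mB.
  have [E EP] := exhaustion_ex cL.
  apply/ler_addgt0Pr => e e0.
  have [N hN] := dmeasurable_finite_range mu cL EP mv e0.
  have mvs : measurable [set x | v x \in E N] by exact: (dmeasurable_set cL [set l | l \in E N]).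
  rewrite (prDI mu mvB mvs) addrC; apply: lerD.
    rewrite vt_pieces ?(exhaustion_uniq EP)//; apply: pr_le => //.
    apply: measurableI => //.
    rewrite (_ : [set y | _] = \big[setU/set0]_(l <- E N) V l).
      exact: bigsetU_measurable.
    rewrite -bigcup_seq; apply/seteqP; split=> y [l h1 h2]; by exists l.
  apply: le_trans (hN N (leqnn N)); apply: pr_le; first exact: measurableD.
    exact: (dmeasurable_set cL [set l | l \notin E N]).
  by move=> x [_ /= /negP].
split=> // B mB; have mvB := measurable_preimage measurable_vt mB.
rewrite -!prE//; congr EFin; apply/eqP; rewrite eq_le le//=.
by have := le _ (measurableC mB); rewrite preimage_setC !prC// lerD2l lerN2.
Qed.

(** The sets [V l] cover almost all of [Y], because [vt] preserves measure and sends good points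
    into them. A measurable choice of [l] glues the local inverses. *)
Lemma vt_iso : exists vt' : Y -> X, [/\ measurable_fun setT vt',
  {ae mu, forall x, vt' (vt x) = x}, {ae nu, forall y, vt (vt' y) = y} &
  {ae nu, forall y, good (vt' y)}].
Proof.
have [s ms hs] := measurable_selection cL 1%g mV.
have VE x : good x -> V (v x) (vt x).
  move=> gx; rewrite /V /= /vt -(pmp_actM bP) mulgV (pmp_act1 bP).
  by rewrite good_thK.
have mU : measurable (\bigcup_l V l) by exact: countable_bigcupT_measurable.
have aeV : {ae nu, forall y, exists l, V l y}.
  have : pr nu (~` \bigcup_l V l) = 0.
    rewrite -(mp_pr mp_vt (measurableC mU)); apply: pr0_ae.
      exact: (measurable_preimage mp_vt.1 (measurableC mU)).
    by apply: filterS goodP => x gx; apply; exists (v x) => //; exact: VE.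
  move=> h; apply: filterS (ae_pr0 (measurableC mU) h) => y /contrapT[l _ Vl]; by exists l.
exists (fun y => th' (b (s y) y)); split.
- apply: (measurable_piecewise (f := fun l y => th' (b l y)) ms) => l.
  by apply: measurableT_comp => //; exact: (mb l).1.
- apply: filterS (filterI goodP (ae_mp mp_vt good2P)) => x [gx gy].
  have Vx := VE x gx; have sV : V (s (vt x)) (vt x) by apply: hs; exists (v x).
  rewrite (V_uniq gy sV Vx) /vt -(pmp_actM bP) mulgV (pmp_act1 bP).
  exact: good_thK.
- apply: filterS (filterI good2P aeV) => y [gy Vy].
  by apply: vtK => //; exact: hs.
- by apply: filterS good2P => y gy; exact: (gy (s y)).1.
Qed.

(** The point [b l (vt x)] is the image of some [x'] in the orbit of [x]; if [x' = a t x], freeness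
    identifies [delta t] with [l]. *)
Lemma delta_surj l : exists t, delta t = l.
Proof.
have [vt' [mvt' vtK1 vtK2 gvt']] := vt_iso.
have h : {ae mu, forall x, good x /\ (vt (vt' (b l (vt x))) = b l (vt x) /\
    good (vt' (b l (vt x))))}.
  apply: filterI goodP _; apply: filterI.
    exact: (ae_mp (mp_comp mp_vt (mb l)) vtK2).
  exact: (ae_mp (mp_comp mp_vt (mb l)) gvt').
have [x [gx [e gx']]] := ae_ex h.
set x' := vt' (b l (vt x)) in e gx'.
have e' : th x' = b (v x' * l * (v x)^-1)%g (th x).
  by rewrite !(pmp_actM bP) -/(vt x) -e /vt -(pmp_actM bP) mulgV (pmp_act1 bP).
have [t xt] := good_orbit gx gx' e'.
exists t; apply: (mulgI l^-1%g); rewrite mulVg; apply: (vt_free gx).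
by rewrite (pmp_actM bP) -vt_equiv// -xt e (pmp_actK bP).
Qed.

Lemma conjugate_of_untwisted : conjugate_actions mu nu a b.
Proof.
have [vt' [mvt' vtK1 vtK2 _]] := vt_iso.
have [g gE] := multiplicative_ex delta_mul.
exists g, vt; split.
- have [h hK] := choice delta_surj.
  exists h => [t|l]; last by rewrite gE hK.
  by apply: delta_inj; rewrite hK gE.
- by split; [exact: mp_vt.1|exact: mp_vt.2|exists vt'].
- by move=> t; apply: filterS goodP => x; rewrite gE; exact: vt_equiv.
Qed.

End Conjugacy.
End OrbitEquivalence.

(** * Application to Bernoulli actions *)

Section BernoulliSuperrigidity.
Context {R : realType} {d0 : measure_display} {X0 : measurableType d0}.
Context {G : groupType}.
Hypothesis cG : countable [set: G].
Let X := power_space X0 G.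
Variables (mu0 : probability X0 R) (mu : probability X R).
Hypothesis mu_power : is_power_measure mu0 mu.

Local Notation sh := (@bernoulli_shift d0 X0 G).

Lemma pmp_shift : pmp_action mu sh.
Proof.
split; [exact: shift1|exact: shiftM|by move=> t; exact: (mp_shift mu_power t).1|].
by move=> t A mA; exact: (mp_shift mu_power t).2.
Qed.

Lemma separated_power (C : nat -> set X0) : separated_by C ->
  exists D : nat -> set X, separated_by D.
Proof.
move=> [mC sepC]; have /countable_injP[i iinj] := cG.
have {}iinj g h : i g = i h -> g = h by apply: iinj; rewrite inE.
pose D n : set X := if choice.unpickle n is Some (k, j) then
  \bigcup_g ([set x : X | C j (x g)] `&` [set _ | i g = k]) else set0.
exists D; split=> [n|x y xy].
  rewrite /D; case: choice.unpickle => [[k j]|]; last exact: measurable0.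
  apply: countable_bigcupT_measurable => // g; apply: measurableI.
    exact: measurable_coord.
  exact: measurable_prop.
have [g xyg] : exists g, x g <> y g.
  by apply: contrapT => h; apply: xy; apply/funext => g; apply: contrapT => hg; apply: h; exists g.
have [j [Cx nCy]] := sepC _ _ xyg.
exists (choice.pickle (i g, j)); rewrite /D choice.pickleK; split.
  by exists g.
by move=> [g' _ [Cy /iinj e]]; apply: nCy; rewrite -e.
Qed.

Lemma measurable_singleton d (T : measurableType d) (D : nat -> set T) x :
  separated_by D -> measurable ([set x] : set T).
Proof.
by move=> sepD; apply: (measurable_eq_separated (f := id) (g := fun=> x) sepD).
Qed.

Lemma diffuse_power (C : nat -> set X0) : separated_by C -> diffuse mu0 -> diffuse mu.
Proof.
move=> sepC dmu0 x; have [D sepD] := separated_power sepC.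
have m1 := measurable_singleton x sepD; have m0 := measurable_singleton (x 1%g) sepC.
rewrite -prE//; congr EFin; apply: (pr_eq0_le m1 (measurable_coord 1%g m0)).
  by move=> y ->.
by rewrite (pr_coord mu_power)// /pr dmu0.
Qed.

(** The trivial group is amenable, so there is a nontrivial element, whose conjugacy class is
    infinite. *)
Lemma infinite_icc : ~ amenable R G -> icc G -> infinite_set [set: G].
Proof.
move=> nam iccG fG; have [t t1] : exists t : G, t <> 1%g.
  apply: contrapT => triv; apply: nam.
  have all1 s : s = 1%g :> G by apply: contrapT => s1; apply: triv; exists s.
  exists (fun f => f 1%g); split=> //.
  by move=> t f _; rewrite /translate_left (all1 (_ * _)%g).
by apply: (iccG t t1); exact: sub_finite_set fG.
Qed.

Section Untwist.
Context {L : groupType}.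
Hypothesis cL : countable [set: L].
Variable w : G -> X -> L.
Hypothesis wP : is_cocycle w.

(** When every mark counts, the mixed point is the independent copy itself. [mp_rotate] regroups the
    marks and this copy into the auxiliary factor, so that one side of the intertwining relation
    depends on it alone. *)
Lemma bernoulli_untwist (C : nat -> set X0) (ph : (G -> R) -> R) :
  infinite_set [set: G] -> separated_by C -> diffuse mu0 -> ~ amenable R G ->
  invariant_mean ph -> exists (v : X -> L) (delta : G -> L), dmeasurable v /\
  forall t, {ae mu, forall x, (w t x * v (sh t^-1%g x) = v x * delta t)%g}.
Proof.
move=> iG sepC dmu0 nam phP; have [En EP] := exhaustion_ex cG.
have [r r0 small] := interpolated_small mu_power cL wP cG iG phP nam EP.
have [xi mxi hxi] := interpolated_full mu_power cL sepC dmu0 r0 small.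
have mp t := mp_shift mu_power t; have mix := bernoulli_mixing mu_power.
have mrot := mp_rotate mu mu mu.
have mixQ := mixing_product mp mp mix mix.
pose b2 t (q : X * X) := (sh t q.1, sh t q.2).
apply: (@untwist _ _ _ iG cL _ _ X (X * X)%type mu (product_prob mu mu) sh b2 mp
  (fun t => mp_product (mp t) (mp t)) mix mixQ w (fun t q => w t q.2)
  (fun z => xi (z.1.1, (z.2, z.1.2)))).
  exact: (dmeasurable_comp mxi mrot.1).
move=> t; apply: filterS (ae_mp mrot (hxi t)) => -[[p y] x] /=.
rewrite /shift3 /= => ->; congr (_ * w t _)%g.
by apply/funext => g; rewrite /mixed /resample /marked /= asboolT.
Qed.

End Untwist.
End BernoulliSuperrigidity.

Theorem theorem1p4 (R : realType) (Gamma : groupType)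
    (Gamma_countable : countable [set: Gamma]%classic)
    (Gamma_nonamenable : ~ amenable R Gamma)
    (Gamma_icc : icc Gamma)
    (d0 : measure_display) (X0 : measurableType d0) (mu0 : probability X0 R)
    (X0_standard : standard_borel R X0) (mu0_diffuse : diffuse mu0)
    (mu : probability (power_space X0 Gamma) R)
    (mu_power : is_power_measure mu0 mu)
    (Gamma_exact : exact_group R Gamma)
    (Gamma_not_pp : ~ properly_proximal R Gamma)
    (Lambda : groupType) (Lambda_countable : countable [set: Lambda]%classic)
    (d : measure_display) (Y : measurableType d) (nu : probability Y R)
    (b : Lambda -> Y -> Y) (b_pmp : pmp_action nu b)
    (b_free : free_action nu b) (b_ergodic : ergodic_action nu b) :
  orbit_equivalent mu nu (@bernoulli_shift d0 X0 Gamma) b ->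
  conjugate_actions mu nu (@bernoulli_shift d0 X0 Gamma) b.
Proof.
move=> [th [mth thP [th' [mth' thK th'K]]] orbP].
have iG := infinite_icc Gamma_nonamenable Gamma_icc.
have [ph phP] := not_properly_proximal_mean Gamma_not_pp.
have [C sepC] := standard_separated X0_standard.
have [D sepD] := separated_power Gamma_countable sepC.
have aP := pmp_shift mu_power.
have mpth : measure_preserving mu nu th by [].
have [c [mc cM cP]] := cocycle_ex Gamma_countable Lambda_countable aP b_pmp sepD mpth
  mth' thK th'K orbP b_free.
(* Evaluating at the translate by [t^-1] puts the cocycle identity in the form of [is_cocycle]; the
   substitution is undone in [vP']. *)
pose w t (x : power_space X0 Gamma) := c t (bernoulli_shift t^-1%g x).
have wP : is_cocycle w.
  split=> [t|s t x]; first exact: (dmeasurable_shift mu_power).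
  by rewrite /w cM invgM !shiftM shiftVK.
have [v [delta [mv vP]]] := bernoulli_untwist Gamma_countable mu_power Lambda_countable wP
  iG sepC mu0_diffuse Gamma_nonamenable phP.
have vP' t : {ae mu, forall x, (c t x * v x = v (bernoulli_shift t x) * delta t)%g}.
  apply: filterS (ae_mp (mp_shift mu_power t) (vP t)) => x.
  by rewrite /w !shiftK.
have dmu := diffuse_power Gamma_countable mu_power sepC mu0_diffuse.
have mix := bernoulli_mixing mu_power.
exact: (conjugate_of_untwisted Gamma_countable Lambda_countable aP b_pmp sepD mpth
  mth' thK th'K orbP b_free cP cM mv vP' mix Gamma_icc dmu).
Qed.
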